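(* Let $c_1,c_2>0$. There is a constant $c>0$ depending only on $c_2$ such that the following holds. Suppose the kernel $K$ has exponentially decaying eigenvalues, i.e. $\mu_j\le c_1\exp(-c_2j^2)$ for all $j=1,2,\ldots$. Suppose $f^*\in\mathcal H$ and $\mathbb E[(Y-f^*(x))^2\mid X=x]\le\sigma^2$ for $x\in\mathcal X$. Let $\bar f$ be the averaged divide-and-conquer kernel ridge regression estimate with $\lambda=1/N$, based on $N$ i.i.d. samples split into $m$ equal subsets. Suppose that either (i) for some $k>2$ there is $\rho<\infty$ with $\mathbb E[\phi_j(X)^{2k}]\le\rho^{2k}$ for all $j$, and $$m\le c\,\frac{N^{\frac{k-4}{k-2}}}{\rho^{\frac{4k}{k-2}}\log^{\frac{2k-1}{k-2}}N};$$ or (ii) there is $\rho<\infty$ with $\sup_{x\in\mathcal X}|\phi_j(x)|\le\rho$ for all $j$, and $$m\le c\,\frac{N}{\rho^4\log^2N}.$$ Then the mean-squared error is bounded as $$\mathbb E\big[\|\bar f-f^*\|_2^2\big]=O\left(\sigma^2\,\frac{\sqrt{\log N}}{N}\right).$$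
   Context: Setting. $(X,Y)$ is a random pair with values in $\mathcal X\times\mathbb R$ and joint distribution $\mathbb P$ (the marginal law of $X$ is also denoted $\mathbb P$); $f^*(x)=\mathbb E[Y\mid X=x]$; $\|g\|_2=(\int_{\mathcal X}g^2\,d\mathbb P)^{1/2}$. $K:\mathcal X\times\mathcal X\to\mathbb R$ is a symmetric positive semidefinite kernel with reproducing kernel Hilbert space $\mathcal H\subset L^2(\mathbb P)$ and norm $\|\cdot\|_{\mathcal H}$. It has the Mercer expansion $K(x,x')=\sum_{j\ge1}\mu_j\phi_j(x)\phi_j(x')$ with $\mu_1\ge\mu_2\ge\cdots\ge0$ and $\{\phi_j\}$ an orthonormal basis of $L^2(\mathbb P)$. Algorithm. Given $N$ i.i.d. samples $(x_i,y_i)$ from $\mathbb P$, divide them evenly and uniformly at random into $m$ disjoint subsets $S_1,\ldots,S_m$ of equal size $N/m$. For each $i$ compute $\hat f_i=\arg\min_{f\in\mathcal H}\big\{\frac1{|S_i|}\sum_{(x,y)\in S_i}(f(x)-y)^2+\lambda\|f\|_{\mathcal H}^2\big\}$, and output $\bar f=\frac1m\sum_{i=1}^m\hat f_i$. The expectation is over the samples (and the random partition). Convention. $O(\cdot)$ is an asymptotic statement as $N\to\infty$ for a fixed problem (kernel, distribution, $f^*$, $\sigma$, $k$, $\rho$, $c_1,c_2$): the implied constant does not depend on $N$ or $m$.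
   Formalization: The formal statement assumes σ > 0; for σ = 0 the stated bound O(σ²√(log N)/N) would force zero error, which fails for noiseless data with f* ≠ 0 because ridge regression with λ = 1/N has nonzero bias. *)

(* Defs.v *)
From HB Require Import structures.
From mathcomp Require Import all_boot all_order all_algebra.
From mathcomp Require Import all_classical all_reals all_analysis.

Set Implicit Arguments.
Unset Strict Implicit.
Unset Printing Implicit Defensive.

Import Order.TTheory GRing.Theory Num.Theory.
Import numFieldTopology.Exports numFieldNormedType.Exports.

Local Open Scope classical_set_scope.
Local Open Scope ring_scope.

Definition psd_kernel (R : realType) (T : Type) (K : T -> T -> R) : Prop :=
  (forall x x', K x x' = K x' x) /\
  (forall (n : nat) (x : 'I_n -> T) (a : 'I_n -> R),
     0 <= \sum_(i < n) \sum_(j < n) a i * a j * K (x i) (x j)).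

Definition Hnorm (R : realType) (T : Type)
    (ip : (T -> R) -> (T -> R) -> R) (f : T -> R) : R :=
  Num.sqrt (ip f f).

(* The set H of real functions on T, with the inner product ip, is the
   reproducing kernel Hilbert space of K. The values of ip outside H are
   irrelevant. *)
Record is_rkhs (R : realType) (T : Type) (K : T -> T -> R)
    (H : set (T -> R)) (ip : (T -> R) -> (T -> R) -> R) : Prop := IsRkhs {
  rkhs_zero : H (fun=> 0) ;
  rkhs_lin : forall (a : R) f g, H f -> H g -> H (fun x => a * f x + g x) ;
  rkhs_ip_sym : forall f g, H f -> H g -> ip f g = ip g f ;
  rkhs_ip_lin : forall (a : R) f g h, H f -> H g -> H h ->
    ip (fun x => a * f x + g x) h = a * ip f h + ip g h ;
  rkhs_ip_pos : forall f, H f -> f <> (fun=> 0) -> 0 < ip f f ;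
  rkhs_complete : forall u : nat -> T -> R, (forall n, H (u n)) ->
    (forall e : R, 0 < e -> exists n0 : nat, forall p q : nat,
       (n0 <= p)%N -> (n0 <= q)%N -> Hnorm ip (u p \- u q) < e) ->
    exists2 f, H f & (fun n => Hnorm ip (u n \- f)) @ \oo --> (0 : R) ;
  rkhs_kernel : forall x, H (K x) ;
  rkhs_reproducing : forall f x, H f -> ip f (K x) = f x
}.

Definition L2norm (R : realType) (d : measure_display) (T : measurableType d)
    (P : {measure set T -> \bar R}) (f : T -> R) : \bar R :=
  'N[P]_2%:E [EFin \o f]%E.

Record orthonormal_basis (R : realType) (d : measure_display)
    (T : measurableType d) (P : {measure set T -> \bar R})
    (phi : nat -> T -> R) : Prop := OrthonormalBasis {
  onb_L2 : forall j, phi j \in Lfun P 2%:E ;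
  onb_orth : forall i j,
    (\int[P]_x (phi i x * phi j x)%:E = (i == j)%:R%:E)%E ;
  onb_total : forall g : T -> R, g \in Lfun P 2%:E ->
    L2norm P (fun x => g x -
        \sum_(j < n) (\int[P]_y (g y * phi j y))%R * phi j x)
      @[n --> \oo] --> 0%E
}.

(* Indices start at 0: mu j and phi j are the (j+1)-st eigenvalue and
   eigenfunction. *)
Record mercer_expansion (R : realType) (d : measure_display)
    (T : measurableType d) (P : {measure set T -> \bar R})
    (K : T -> T -> R) (mu : nat -> R) (phi : nat -> T -> R) : Prop :=
  MercerExpansion {
  mercer_ge0 : forall j, 0 <= mu j ;
  mercer_decr : forall i j, (i <= j)%N -> mu j <= mu i ;
  mercer_basis : orthonormal_basis P phi ;
  mercer_sum : forall x x',
    (fun n => \sum_(j < n) mu j * phi j x * phi j x') @ \oo --> K x x'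
}.

(* g is a version of x |-> E[Z | X = x]. *)
Definition is_cond_expectation (R : realType) (d0 d : measure_display)
    (Om : measurableType d0) (T : measurableType d) (P : probability Om R)
    (X : {RV P >-> T}) (Z : Om -> R) (g : T -> R) : Prop :=
  [/\ P.-integrable setT (EFin \o Z),
      measurable_fun setT g &
      forall A : set T, measurable A ->
        (\int[P]_(w in X @^-1` A) (Z w)%:E =
         \int[distribution P X]_(x in A) (g x)%:E)%E].

(* The N pairs (xs i, ys i) are i.i.d. with the law of (X, Y). Marginal laws
   and independence of subfamilies are obtained by taking some B i = setT. *)
Definition iid_sample (R : realType) (d0 d d' : measure_display)
    (Om0 : measurableType d0) (T : measurableType d) (P0 : probability Om0 R)
    (X : {RV P0 >-> T}) (Y : {RV P0 >-> R})
    (Om : measurableType d') (Q : probability Om R) (N : nat)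
    (xs : 'I_N -> {RV Q >-> T}) (ys : 'I_N -> {RV Q >-> R}) : Prop :=
  forall B : 'I_N -> set (T * R), (forall i, measurable (B i)) ->
    (Q [set w | forall i, B i (xs i w, ys i w)] =
     \prod_(i < N) P0 [set w0 | B i (X w0, Y w0)])%E.

(* A split is encoded by the map sending a sample index to the number of its
   subset. *)
Definition block (N m : nat) (a : {ffun 'I_N -> 'I_m}) (i : 'I_m) : {set 'I_N} :=
  [set s | a s == i]%SET.

Definition even_splits (N m : nat) : {set {ffun 'I_N -> 'I_m}} :=
  [set a | [forall i, #|block a i| == (N %/ m)%N]]%SET.

(* The split is uniform over the even splits and independent of the sample;
   independence is stated on measurable rectangles, a pi-system generating the
   sigma-algebra of the sample. *)
Definition uniform_even_split (R : realType) (d d' : measure_display)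
    (T : measurableType d) (Om : measurableType d') (Q : probability Om R)
    (N m : nat) (xs : 'I_N -> {RV Q >-> T}) (ys : 'I_N -> {RV Q >-> R})
    (S : Om -> {ffun 'I_N -> 'I_m}) : Prop :=
  [/\ forall w, S w \in even_splits N m,
      forall a, measurable [set w | S w = a] &
      forall (a : {ffun 'I_N -> 'I_m}) (B : 'I_N -> set (T * R)),
        a \in even_splits N m -> (forall i, measurable (B i)) ->
        (Q [set w | S w = a /\ forall i, B i (xs i w, ys i w)] =
         (#|even_splits N m|%:R^-1)%:E *
         Q [set w | forall i, B i (xs i w, ys i w)])%E].

Definition krr_objective (R : realType) (T : Type)
    (ip : (T -> R) -> (T -> R) -> R) (lambda : R) (N : nat) (S : {set 'I_N})
    (x : 'I_N -> T) (y : 'I_N -> R) (f : T -> R) : R :=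
  #|S|%:R^-1 * (\sum_(i in S) (f (x i) - y i) ^+ 2) + lambda * Hnorm ip f ^+ 2.

Definition is_krr_estimate (R : realType) (T : Type) (H : set (T -> R))
    (ip : (T -> R) -> (T -> R) -> R) (lambda : R) (N : nat) (S : {set 'I_N})
    (x : 'I_N -> T) (y : 'I_N -> R) (g : T -> R) : Prop :=
  H g /\ forall f, H f ->
    krr_objective ip lambda S x y g <= krr_objective ip lambda S x y f.

Definition averaged_estimate (R : realType) (T : Type) (m : nat)
    (fhat : 'I_m -> T -> R) (x : T) : R :=
  m%:R^-1 * \sum_(i < m) fhat i x.

(* Main.v *)
From HB Require Import structures.
Require Import Defs.
From mathcomp Require Import all_boot all_order all_algebra.
From mathcomp Require Import finmap.
From mathcomp Require Import all_classical all_reals all_analysis measurable_realfun.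
From mathcomp Require Import ring lra.

Set Implicit Arguments.
Unset Strict Implicit.
Unset Printing Implicit Defensive.

Import Order.TTheory GRing.Theory Num.Theory.
Import numFieldTopology.Exports numFieldNormedType.Exports.

Local Open Scope classical_set_scope.
Local Open Scope ring_scope.

(** The error of the averaged estimate splits into a bias, the fit of each block
    to the noiseless responses, and a noise term that is linear in the residuals
    of the responses. Both are controlled once the empirical covariance of the
    eigenfunctions on each block is close to the identity, in the Hilbert-Schmidt
    norm weighted by the shrinkage factors [mu j / (mu j + lam)] (predicate
    [good]). On that event the energy [integral of f^2 + lam * ip f f] of an
    element of [H] is at most twice its empirical counterpart ([energy_le_emp]).
    Optimality of the ridge estimate then bounds the squared bias by
    [2 * lam * ip fstar fstar] ([integral_bias_good]), and the squared norm of the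
    coefficient of each response by [4 / n^2] times the leverage of its design
    point ([integral_ridge_basis_good]), whose mean is the effective dimension
    [gam], the sum of the shrinkage factors. Off the good event crude bounds are
    enough, since they are multiplied by its failure probability [delta].

    Averaging over the blocks does not increase the bias and, as the residuals are
    uncorrelated given the design ([noise_sum_var]), divides the variance by [m].
    For [lam = N^-1] the risk is at most a constant times
    [N^-1 + gam / N + n * delta], where [n = N / m] is the block size
    ([block_risk]). The random split is independent of the sample, so the same
    bound holds for the random split ([averaged_risk]).

    The failure probability comes from moments of centred sums. Both moment
    inequalities are instances of one recursion that adds the observations one at
    a time ([moment_recursion]): with powers it gives a Rosenthal-type bound of
    order [n^(k/2)] for moments of order [k] ([sum_moment_power]), with
    exponentials a sub-Gaussian bound with explicit constants
    ([sum_moment_bounded]), used at order [2 * ln N]. Markov's inequality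
    ([not_good_prob]) gives [delta] of order [(gam^2 / n)^(k/2)] in the first case
    and [delta <= 2 / N^2] in the second; the bounds on [m] are what makes
    [n * delta] of order [1 / N] ([failure_rate]).

    Eigenvalues decaying like [expR (- c2 * j^2)] have effective dimension of order
    [sqrt (ln N)] ([sum_shrink_le]), because about [sqrt (ln N)] of them exceed
    [1 / N] and the others contribute a bounded amount. This is the factor
    [sqrt (ln N)] in the rate. *)

(** * Laws of finite samples *)

(** Measurable boxes form a pi-system that generates the product sigma-algebra. *)
Lemma tuple_measure_unique d (Z : measurableType d) (R : realType) N
    (m1 m2 : {measure set (N.-tuple Z) -> \bar R}) :
  (m1 setT < +oo)%E ->
  (forall B : 'I_N -> set Z, (forall i, measurable (B i)) ->
     m1 [set t | forall i, B i (tnth t i)] =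
     m2 [set t | forall i, B i (tnth t i)]) ->
  forall A, measurable A -> m1 A = m2 A.
Proof.
move=> m1fin mB A mA.
pose G : set (set (N.-tuple Z)) := [set C | exists2 B : 'I_N -> set Z,
  (forall i, measurable (B i)) & C = [set t | forall i, B i (tnth t i)]].
have GT : G setT.
  exists (fun=> setT); first by move=> i; exact: measurableT.
  by apply/seteqP; split.
apply: (measure_unique G (fun=> setT)) => //.
- apply/seteqP; split.
    apply: smallest_sub; first exact: smallest_sigma_algebra.
    rewrite -bigcup_seq; apply: bigcup_sub => i _ _ [B mBi <-].
    apply: sub_sigma_algebra.
    exists (fun j => if j == i then B else setT).
      by move=> j; case: ifP => // _; exact: measurableT.
    rewrite setTI; apply/seteqP; split => t /=.
      by move=> Bt j; case: eqP => [->|].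
    by move=> /(_ i); rewrite eqxx.
  apply: smallest_sub; first exact: sigma_algebra_measurable.
  move=> _ [B mBi ->].
  rewrite (_ : [set _ | _] =
      \bigcap_(i in [set: 'I_N]) ((fun t : N.-tuple Z => tnth t i) @^-1` B i)).
    apply: fin_bigcap_measurable => // i _.
    by rewrite -[X in measurable X]setTI; exact: measurable_tnth.
  by apply/seteqP; split => t /= + i; [move=> h _; exact: h|move/(_ i I)].
- move=> _ _ [B1 mB1 ->] [B2 mB2 ->].
  exists (fun i => B1 i `&` B2 i); first by move=> i; exact: measurableI.
  apply/seteqP; split => t /=.
    by move=> [h1 h2] i; split; [exact: h1|exact: h2].
  by move=> h; split => i; have [] := h i.
- by apply/seteqP; split => // t _; exists 0%N.
- by move=> _ [B mBi ->]; exact: mB.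
Qed.

(** Integrals only see the law of a sample, and that law is determined by
    measurable boxes; the two samples may live on different spaces. *)
Lemma integral_tuple_law d (Z : measurableType d) (R : realType) N
    d1 d2 (Om1 : measurableType d1) (Om2 : measurableType d2)
    (P1 : {measure set Om1 -> \bar R}) (P2 : {measure set Om2 -> \bar R})
    (U : Om1 -> N.-tuple Z) (V : Om2 -> N.-tuple Z) (F : N.-tuple Z -> \bar R) :
  measurable_fun setT U -> measurable_fun setT V -> (P1 setT < +oo)%E ->
  (forall B : 'I_N -> set Z, (forall i, measurable (B i)) ->
     P1 [set w | forall i, B i (tnth (U w) i)] =
     P2 [set w | forall i, B i (tnth (V w) i)]) ->
  measurable_fun [set: N.-tuple Z] F ->
  (\int[P1]_w F (U w) = \int[P2]_w F (V w))%E.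
Proof.
move=> mU mV P1fin PB mF.
have main A : measurable A -> pushforward P1 U A = pushforward P2 V A.
  move=> mA.
  pose U' : {mfun Om1 >-> N.-tuple Z} := HB.pack U (isMeasurableFun.Build _ _ _ _ _ mU).
  pose V' : {mfun Om2 >-> N.-tuple Z} := HB.pack V (isMeasurableFun.Build _ _ _ _ _ mV).
  have := @tuple_measure_unique _ Z R N
     (pushforward P1 U') (pushforward P2 V').
  by apply.
have ge0case (G : N.-tuple Z -> \bar R) : measurable_fun [set: N.-tuple Z] G ->
    (forall z, 0 <= G z)%E -> (\int[P1]_w G (U w) = \int[P2]_w G (V w))%E.
  move=> mG G0.
  transitivity (\int[pushforward P1 U]_z G z)%E.
    rewrite (@ge0_integral_pushforward _ _ _ _ _ _ mU P1 setT G)//.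
  transitivity (\int[pushforward P2 V]_z G z)%E.
    by apply: eq_measure_integral => A mA _; exact: main.
  by rewrite (@ge0_integral_pushforward _ _ _ _ _ _ mV P2 setT G).
have posE d' (Om : measurableType d') (W : Om -> N.-tuple Z) :
    ((fun w => F (W w))^\+ = F^\+ \o W)%E by rewrite -funepos_comp.
have negE d' (Om : measurableType d') (W : Om -> N.-tuple Z) :
    ((fun w => F (W w))^\- = F^\- \o W)%E by rewrite -funeneg_comp.
rewrite [LHS]integralE [RHS]integralE (posE _ _ U) (posE _ _ V) (negE _ _ U).
rewrite (negE _ _ V); congr (_ - _)%E.
  exact: (ge0case (F^\+)%E (measurable_funepos mF) (funepos_ge0 F)).
exact: (ge0case (F^\-)%E (measurable_funeneg mF) (funeneg_ge0 F)).
Qed.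

Definition tuple_set (A : Type) N (t : N.-tuple A) (s : 'I_N) (a : A) : N.-tuple A :=
  [tuple if i == s then a else tnth t i | i < N].

Lemma tnth_tuple_set (A : Type) N (t : N.-tuple A) s a i :
  tnth (tuple_set t s a) i = if i == s then a else tnth t i.
Proof. by rewrite tnth_mktuple. Qed.

Lemma measurable_tuple_set d (Z : measurableType d) N (s : 'I_N)
    d' (D : measurableType d') (U : D -> N.-tuple Z) (a : D -> Z) :
  measurable_fun setT U -> measurable_fun setT a ->
  measurable_fun setT (fun w => tuple_set (U w) s (a w)).
Proof.
move=> mU ma; apply/measurable_fun_tnthP => i.
rewrite (_ : _ \o _ = fun w => if i == s then a w else tnth (U w) i).
  case: (i == s) => //.
  by apply: (measurableT_comp (measurable_tnth i)).
by apply/funext => w /=; rewrite tnth_tuple_set.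
Qed.

Section resampling.
Context (d d0 d1 : measure_display) (Z : measurableType d) (R : realType).
Context (Om0 : measurableType d0) (P0 : probability Om0 R).
Context (Om : measurableType d1) (Q : probability Om R).
Context (N : nat) (z0 : Om0 -> Z) (z : Om -> N.-tuple Z).
Hypotheses (mz0 : measurable_fun setT z0) (mz : measurable_fun setT z).
Hypothesis iid : forall B : 'I_N -> set Z, (forall i, measurable (B i)) ->
  (Q [set w | forall i, B i (tnth (z w) i)] =
   \prod_(i < N) P0 [set w | B i (z0 w)])%E.

(** An i.i.d. sample keeps its law when the observation [s] is replaced by an
    independent copy. Independence of the observations is used below only in this
    form, which makes conditioning on all the other observations an iterated
    integral. *)
Lemma integral_resample_prod s (F : N.-tuple Z -> \bar R) :
  measurable_fun [set: N.-tuple Z] F ->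
  (\int[Q]_w F (z w) = \int[Q \x P0]_p F (tuple_set (z p.1) s (z0 p.2)))%E.
Proof.
move=> mF; apply: integral_tuple_law => //.
- apply: measurable_tuple_set; first exact: measurableT_comp.
  exact: measurableT_comp.
- exact: (le_lt_trans (probability_le1 _ measurableT) (ltry _)).
move=> B mB.
have mB1 i : measurable ([set w | B i (tnth (z w) i)]).
  rewrite -[X in measurable X]setTI.
  by apply: (measurableT_comp (measurable_tnth i) mz).
have mB0 i : measurable ([set w | B i (z0 w)]).
  by rewrite -[X in measurable X]setTI; exact: mz0.
pose B' i := if i == s then setT else B i.
have mB' i : measurable (B' i) by rewrite /B'; case: ifP.
rewrite (_ : [set p | _] = [set w | forall i, B' i (tnth (z w) i)] `*`
    [set w | B s (z0 w)]); last first.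
  apply/seteqP; split => p /=.
    move=> h; split.
      by move=> i; rewrite /B'; have := h i; rewrite tnth_tuple_set; case: ifP.
    by have := h s; rewrite tnth_tuple_set eqxx.
  move=> [h1 h2] i; rewrite tnth_tuple_set; case: eqP => [->//|/eqP/negPf nis].
  by have := h1 i; rewrite /B' nis.
have mA : measurable [set w | forall i, B' i (tnth (z w) i)].
  rewrite (_ : [set w | _] =
      \bigcap_(i in [set: 'I_N]) ([set w | B' i (tnth (z w) i)])).
    apply: fin_bigcap_measurable => // i _; rewrite /B'; case: ifP => // _.
    exact: measurableT.
  by apply/seteqP; split => t /= + i; [move=> h _; exact: h|move/(_ i I)].
rewrite [RHS](_ : _ = (Q [set w | forall i, B' i (tnth (z w) i)] *
  P0 [set w | B s (z0 w)])%E); last exact: product_measure1E.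
apply: etrans (iid mB) _.
rewrite (iid mB') (bigD1 s)//= [in RHS](bigD1 s)//= /B' eqxx.
rewrite (_ : [set w | setT (z0 w)] = setT); last by apply/seteqP.
rewrite probability_setT mul1e [RHS]muleC; congr (_ * _)%E.
by apply: eq_bigr => i /negPf ->.
Qed.

Lemma ge0_integral_resample s (F : N.-tuple Z -> \bar R) :
  measurable_fun [set: N.-tuple Z] F -> (forall t, 0 <= F t)%E ->
  (\int[Q]_w F (z w) = \int[Q]_w \int[P0]_v F (tuple_set (z w) s (z0 v)))%E.
Proof.
move=> mF F0; rewrite (integral_resample_prod s)//.
rewrite fubini_tonelli1//; apply: (measurableT_comp mF).
by apply: measurable_tuple_set; exact: measurableT_comp.
Qed.

Lemma ge0_integral_coord s (f : Z -> \bar R) :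
  measurable_fun setT f -> (forall t, 0 <= f t)%E ->
  (\int[Q]_w f (tnth (z w) s) = \int[P0]_v f (z0 v))%E.
Proof.
move=> mf f0.
have mF : measurable_fun [set: N.-tuple Z] (fun t : N.-tuple Z => f (tnth t s)).
  exact: (measurableT_comp mf (measurable_tnth s)).
rewrite (ge0_integral_resample s mF)//.
under eq_integral => w _.
  under eq_integral => v _ do rewrite tnth_tuple_set eqxx.
  over.
by rewrite integral_cst//= probability_setT mule1.
Qed.

End resampling.

(** * Reproducing kernel Hilbert spaces *)

Section rkhs.
Context (R : realType) (T : Type) (K : T -> T -> R) (H : set (T -> R))
  (ip : (T -> R) -> (T -> R) -> R).
Hypothesis rk : is_rkhs K H ip.

Lemma rkhs_add f g : H f -> H g -> H (f \+ g).
Proof.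
move=> Hf Hg; rewrite (_ : f \+ g = (fun x => 1 * f x + g x)).
  exact: (rkhs_lin rk 1 Hf Hg).
by apply/funext => x; rewrite mul1r.
Qed.

Lemma rkhs_sub f g : H f -> H g -> H (f \- g).
Proof.
move=> Hf Hg; rewrite (_ : f \- g = (fun x => -1 * g x + f x)).
  exact: (rkhs_lin rk (-1) Hg Hf).
by apply/funext => x /=; rewrite mulN1r addrC.
Qed.

Lemma rkhs_sum (I : Type) (r : seq I) (P : pred I) (a : I -> R) F :
  (forall i, P i -> H (F i)) ->
  H (fun x => \sum_(i <- r | P i) a i * F i x).
Proof.
move=> HF; elim: r => [|i r IH].
  rewrite (_ : (fun _ => _) = fun=> 0); first exact: (rkhs_zero rk).
  by apply/funext => x; rewrite big_nil.
have [Pi|nPi] := boolP (P i); last first.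
  by under eq_fun do rewrite big_cons (negPf nPi).
by under eq_fun do rewrite big_cons Pi; exact: (rkhs_lin rk _ (HF i Pi) IH).
Qed.

Lemma ip0 h : H h -> ip (fun=> 0) h = 0.
Proof.
move=> Hh; have := rkhs_ip_lin rk 1 (rkhs_zero rk) (rkhs_zero rk) Hh.
rewrite (_ : (fun _ => 1 * 0 + 0) = fun=> 0); last first.
  by apply/funext => x; rewrite mul1r addr0.
by move=> /eqP; rewrite mul1r -subr_eq0 opprD addrA subrr sub0r oppr_eq0 => /eqP.
Qed.

Lemma ipD f g h : H f -> H g -> H h -> ip (f \+ g) h = ip f h + ip g h.
Proof.
move=> Hf Hg Hh; rewrite (_ : f \+ g = (fun x => 1 * f x + g x)).
  by rewrite (rkhs_ip_lin rk 1 Hf Hg Hh) mul1r.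
by apply/funext => x; rewrite mul1r.
Qed.

Lemma ipB f g h : H f -> H g -> H h -> ip (f \- g) h = ip f h - ip g h.
Proof.
move=> Hf Hg Hh; rewrite (_ : f \- g = (fun x => -1 * g x + f x)).
  by rewrite (rkhs_ip_lin rk (-1) Hg Hf Hh) mulN1r addrC.
by apply/funext => x /=; rewrite mulN1r addrC.
Qed.

Lemma ip_sum (I : Type) (r : seq I) (P : pred I) (a : I -> R) F h :
  (forall i, P i -> H (F i)) -> H h ->
  ip (fun x => \sum_(i <- r | P i) a i * F i x) h =
  \sum_(i <- r | P i) a i * ip (F i) h.
Proof.
move=> HF Hh; elim: r => [|i r IH].
  rewrite (_ : (fun _ => _) = fun=> 0) ?ip0 ?big_nil//.
  by apply/funext => x; rewrite big_nil.
rewrite big_cons; have [Pi|nPi] := boolP (P i); last first.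
  by under eq_fun do rewrite big_cons (negPf nPi).
under eq_fun do rewrite big_cons Pi.
by rewrite (rkhs_ip_lin rk _ (HF i Pi) (rkhs_sum r a HF) Hh) IH.
Qed.

Lemma ip_ge0 f : H f -> 0 <= ip f f.
Proof.
move=> Hf; have [->|/eqP f0] := eqVneq f (fun=> 0).
  by rewrite ip0//; exact: rkhs_zero rk.
by apply/ltW/(rkhs_ip_pos rk).
Qed.

(** The variational arguments below minimise over [a] along such a line and read
    off the coefficient of [a]. *)
Lemma ip_line a f g : H f -> H g ->
  ip (fun x => a * g x + f x) (fun x => a * g x + f x) =
  ip f f + 2 * a * ip f g + a ^+ 2 * ip g g.
Proof.
move=> Hf Hg; have Hl := rkhs_lin rk a Hg Hf.
rewrite (rkhs_ip_lin rk a Hg Hf Hl) (rkhs_ip_sym rk Hg Hl).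
rewrite (rkhs_ip_sym rk Hf Hl).
rewrite (rkhs_ip_lin rk a Hg Hf Hg) (rkhs_ip_lin rk a Hg Hf Hf).
by rewrite (rkhs_ip_sym rk Hg Hf); ring.
Qed.

Lemma ip_sqrB f g : H f -> H g ->
  ip (f \- g) (f \- g) = ip f f - 2 * ip f g + ip g g.
Proof.
move=> Hf Hg; rewrite (_ : f \- g = (fun x => -1 * g x + f x)).
  by rewrite ip_line//; ring.
by apply/funext => x /=; rewrite mulN1r addrC.
Qed.

(** The discriminant of a quadratic polynomial that keeps its sign. For [a = 0]
    it gives [b = 0], the form in which first-order conditions are obtained. *)
Lemma quadratic_ge0 (a b c : R) :
  (forall t, 0 <= a + 2 * t * b + t ^+ 2 * c) -> 0 <= c -> b ^+ 2 <= a * c.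
Proof.
move=> h c0; have [c00|cn0] := eqVneq c 0.
  have [->|bn0] := eqVneq b 0; first by rewrite c00; lra.
  have := h (- (a + 1) / (2 * b)); rewrite c00.
  rewrite [X in 0 <= X](_ : _ = -1); first by lra.
  by field.
have := h (- b / c).
rewrite [X in 0 <= X](_ : _ = (a * c - b ^+ 2) / c); last by field.
by rewrite pmulr_lge0 ?invr_gt0 ?lt0r ?cn0// subr_ge0.
Qed.

Lemma ip_CS f g : H f -> H g -> ip f g ^+ 2 <= ip f f * ip g g.
Proof.
move=> Hf Hg; apply: (@quadratic_ge0 _ _ (ip g g)); last exact: ip_ge0.
by move=> t; rewrite -ip_line//; apply: ip_ge0; exact: (rkhs_lin rk).
Qed.

Lemma ip_kernel x y : ip (K x) (K y) = K x y.
Proof. exact: (rkhs_reproducing rk y (rkhs_kernel rk x)). Qed.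

Lemma rkhs_kernel_diag_ge0 x : 0 <= K x x.
Proof. by rewrite -ip_kernel; exact: (ip_ge0 (rkhs_kernel rk x)). Qed.

Lemma rkhs_eval_le f x : H f -> f x ^+ 2 <= ip f f * K x x.
Proof.
move=> Hf; rewrite -{1}(rkhs_reproducing rk x Hf) -ip_kernel.
exact: (ip_CS Hf (rkhs_kernel rk x)).
Qed.

Lemma Hnorm_sqr f : H f -> Hnorm ip f ^+ 2 = ip f f.
Proof. by move=> Hf; rewrite /Hnorm sqr_sqrtr// ip_ge0. Qed.

(** Riesz representation. The representer is the limit of a minimising
    sequence of the functional [ip f f - 2 l f]: near-minimality bounds the first
    variation [ip u f - l f], which makes the sequence Cauchy; completeness is
    part of [is_rkhs]. *)
Lemma riesz (l : (T -> R) -> R) (C : R) : 0 <= C ->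
  (forall a f g, H f -> H g -> l (fun x => a * f x + g x) = a * l f + l g) ->
  (forall f, H f -> l f ^+ 2 <= C * ip f f) ->
  exists2 h, H h & forall f, H f -> ip f h = l f.
Proof.
move=> C0 llin lbnd.
pose J f := ip f f - 2 * l f.
pose E : set R := [set J f | f in H].
have Jlow f : H f -> - C <= J f.
  move=> Hf; rewrite /J; have := lbnd f Hf; have := ip_ge0 Hf.
  set q := ip f f; set b := l f => q0 bq.
  rewrite leNgt; apply/negP => qb.
  have : (C + q) ^+ 2 < (2 * b) ^+ 2 by rewrite ltr_sqr ?nnegrE; lra.
  have := sqr_ge0 (C - q); nra.
have Einf : has_inf E.
  split; first by exists (J (fun=> 0)); exists (fun=> 0) => //; exact: rkhs_zero rk.
  by exists (- C) => _ [f Hf <-]; exact: Jlow.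
have /choice[u Hu] : forall n : nat, exists f, H f /\ J f < inf E + n.+1%:R^-1.
  move=> n; have n0 : 0 < n.+1%:R^-1 :> R by rewrite invr_gt0.
  by have [_ [f Hf <-] ?] := inf_adherent n0 Einf; exists f.
have var n f : H f -> (ip (u n) f - l f) ^+ 2 <= n.+1%:R^-1 * ip f f.
  move=> Hf; have [Hun Jun] := Hu n.
  apply: (@quadratic_ge0 _ _ (ip f f)); last exact: ip_ge0.
  move=> t; have Ht := rkhs_lin rk t Hf Hun.
  have : inf E <= J (fun x => t * f x + u n x).
    by apply: ge_inf; [case: Einf|exists (fun x => t * f x + u n x)].
  rewrite /J ip_line// llin//; move: Jun; rewrite /J.
  by move: (inf E) (_^-1) => i e; nra.
have small (e : R) : 0 < e -> exists k, forall n, (k <= n)%N -> n.+1%:R^-1 < e.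
  move=> e0; have [k] := ltr_add_invr e0; rewrite add0r => kR; exists k => n kn.
  by apply: le_lt_trans kR; rewrite lef_pV2 ?posrE// ler_nat ltnS.
have [] := rkhs_complete rk (u := u).
- by move=> n; case: (Hu n).
- move=> e e0; have e40 : 0 < e ^+ 2 / 4 by rewrite divr_gt0 ?exprn_gt0.
  have [n0 n0P] := small _ e40; exists n0 => p q np nq.
  have [Hp _] := Hu p; have [Hq _] := Hu q.
  have Hpq := rkhs_sub Hp Hq.
  rewrite -ltr_sqr ?nnegrE ?sqrtr_ge0 ?ltW// Hnorm_sqr//.
  set D := u p \- u q in Hpq *.
  have sE : ip D D = (ip (u p) D - l D) - (ip (u q) D - l D).
    by rewrite {1}/D ipB//; ring.
  have pD := var p _ Hpq; have qD := var q _ Hpq; have D0 := ip_ge0 Hpq.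
  have pe := n0P _ np; have qe := n0P _ nq.
  move: sE pD qD D0 pe qe.
  move: (ip D D) (ip (u p) D - l D) (ip (u q) D - l D) (p.+1%:R^-1) (q.+1%:R^-1).
  move=> s a b ep eq sE pD qD D0 pe qe; rewrite ltNge; apply/negP => es.
  have ss : s * s <= 2 * (ep + eq) * s.
    rewrite -expr2 {1}sE; have := sqr_ge0 (a + b).
    have -> : (a + b) ^+ 2 = 2 * a ^+ 2 + 2 * b ^+ 2 - (a - b) ^+ 2 by ring.
    lra.
  have s0 : 0 < s by apply: lt_le_trans es; rewrite exprn_gt0.
  by move: ss; rewrite ler_pM2r// => ss; lra.
move=> h Hh uh; exists h => // f Hf; apply/eqP.
rewrite -subr_eq0 -sqrf_eq0 eq_le sqr_ge0 andbT.
have cv : (fun n => (2 * Hnorm ip (u n \- h) ^+ 2 + 2 * harmonic n) * ip f f)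
    @ \oo --> (2 * 0 ^+ 2 + 2 * 0) * ip f f.
  apply: cvgMl; apply: cvgD; apply: cvgMr; last exact: cvg_harmonic.
  by rewrite expr0n /= -[X in _ --> X](mulr0 0); apply: cvgM.
have -> : 0 = (2 * 0 ^+ 2 + 2 * 0) * ip f f by ring.
apply: (cvgr_to_ge cv); apply: nearW => n; have [Hun _] := Hu n.
have := var n _ Hf; rewrite Hnorm_sqr; last exact: rkhs_sub.
have := ip_CS (rkhs_sub Hun Hh) Hf; rewrite ipB// (rkhs_ip_sym rk Hf Hh) /harmonic /=.
have -> : ip h f - l f = (ip (u n) f - l f) - (ip (u n) f - ip h f) by ring.
move: (ip (u n) f - l f) (ip (u n) f - ip h f) (ip (_ \- _) _) (ip f f) => a b r q.
have -> : (a - b) ^+ 2 = 2 * a ^+ 2 + 2 * b ^+ 2 - (a + b) ^+ 2 by ring.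
by move: (n.+1%:R^-1) (sqr_ge0 (a + b)) => e; nra.
Qed.

End rkhs.

(** * Mercer expansions *)

Section integral_tools.
Context d (T : measurableType d) (R : realType) (P : {measure set T -> \bar R}).

Lemma integrable_EFin_lin (I : Type) (s : seq I) (Pr : pred I) (a : I -> R)
    (F : I -> T -> R) :
  (forall i, P.-integrable setT (EFin \o F i)) ->
  P.-integrable setT (fun x => (\sum_(i <- s | Pr i) a i * F i x)%:E).
Proof.
move=> iF.
rewrite (_ : (fun x => _) = fun x => (\sum_(i <- s | Pr i) (a i * F i x)%:E)%E).
  by apply: integrable_sum => // i _; exact: (integrableZl measurableT (a i) (iF i)).
by apply/funext => x; rewrite sumEFin.
Qed.

Lemma integral_EFin_lin (I : Type) (s : seq I) (Pr : pred I) (a v : I -> R)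
    (F : I -> T -> R) :
  (forall i, P.-integrable setT (EFin \o F i)) ->
  (forall i, \int[P]_x (F i x)%:E = (v i)%:E)%E ->
  (\int[P]_x (\sum_(i <- s | Pr i) a i * F i x)%:E =
   (\sum_(i <- s | Pr i) a i * v i)%:E)%E.
Proof.
move=> iF vF.
transitivity (\int[P]_x (\sum_(i <- s | Pr i) (a i)%:E * (F i x)%:E))%E.
  by apply: eq_integral => x _; rewrite -sumEFin.
rewrite integral_sum//; last first.
  by move=> i; exact: (integrableZl measurableT (a i) (iF i)).
rewrite -sumEFin; apply: eq_bigr => i _.
by have := integralZl measurableT (iF i) (a i); rewrite /= vF => ->.
Qed.

Lemma fatou_bound (f : nat -> T -> R) (g : T -> R) (b : R) :
  (forall n, measurable_fun setT (f n)) -> (forall n x, 0 <= f n x) ->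
  (forall x, (fun n => f n x) @ \oo --> g x) ->
  (forall n, \int[P]_x (f n x)%:E <= b%:E)%E ->
  (\int[P]_x (g x)%:E <= b%:E)%E.
Proof.
move=> mf f0 fg fb.
have lime x : limn_einf (fun n => (f n x)%:E) = (g x)%:E.
  have cv : (fun n => (f n x)%:E) @ \oo --> (g x)%:E.
    by apply: cvg_EFin; [exact: nearW|exact: fg].
  by have [] := cvg_limn_einf_sup cv.
under eq_integral do rewrite -lime.
apply: le_trans (fatou P measurableT _ _) _.
- by move=> n; apply/measurable_EFinP.
- by move=> n x _; rewrite lee_fin.
rewrite limn_einf_lim; apply: lime_le; first exact: is_cvg_einfs.
apply: nearW => n; apply: le_trans (fb n).
by apply: ereal_inf_lbound; exists n => /=.
Qed.

End integral_tools.

Lemma sum_CS (R : realType) (I : Type) (s : seq I) (Pr : pred I) (a b : I -> R) :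
  (\sum_(i <- s | Pr i) a i * b i) ^+ 2 <=
  (\sum_(i <- s | Pr i) a i ^+ 2) * (\sum_(i <- s | Pr i) b i ^+ 2).
Proof.
apply: (@quadratic_ge0 _ _ _ (\sum_(i <- s | Pr i) b i ^+ 2)); last first.
  by apply: sumr_ge0 => i _; exact: sqr_ge0.
move=> t.
rewrite (_ : _ + _ = \sum_(i <- s | Pr i) (a i + t * b i) ^+ 2).
  by apply: sumr_ge0 => i _; exact: sqr_ge0.
rewrite !mulr_sumr -!big_split/=; apply: eq_bigr => i _; ring.
Qed.

Lemma cvg_sqr_dist (R : realType) (u v : nat -> R) (l : R) :
  (forall n, (l - u n) ^+ 2 <= v n) -> v @ \oo --> 0 -> u @ \oo --> l.
Proof.
move=> uv v0; apply/cvgrPdist_lt => e e0.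
have e20 : 0 < e ^+ 2 by rewrite exprn_gt0.
have vlt : \forall n \near \oo, v n < e ^+ 2 := cvgr_lt _ v0 _ e20.
near=> n; have vn : v n < e ^+ 2 by near: n; exact: vlt.
rewrite -ltr_sqr ?nnegrE ?normr_ge0 ?ltW// real_normK ?num_real//.
exact: le_lt_trans (uv n) vn.
Unshelve. all: by end_near. Qed.

Section mercer.
Context d (T : measurableType d) (R : realType) (P : probability T R)
  (K : T -> T -> R) (H : set (T -> R)) (ip : (T -> R) -> (T -> R) -> R)
  (mu : nat -> R) (phi : nat -> T -> R) (tr : R).
Hypothesis rk : is_rkhs K H ip.
Hypothesis HL2 : forall f, H f -> f \in Lfun P 2%:E.
Hypothesis mer : mercer_expansion P K mu phi.
Hypothesis mu_tr : forall J, \sum_(j < J) mu j <= tr.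

Let mu0 j : 0 <= mu j. Proof. exact: mercer_ge0 mer j. Qed.

Let mercerE x y :
  (fun n => \sum_(j < n) mu j * phi j x * phi j y) @ \oo --> K x y.
Proof. exact: (mercer_sum mer). Qed.

Lemma Lfun2_measurable (f : T -> R) : f \in Lfun P 2%:E -> measurable_fun setT f.
Proof. by move=> /sub_Lfun_mfun; rewrite inE. Qed.

Lemma phi_L2 j : phi j \in Lfun P 2%:E.
Proof. exact: onb_L2 (mercer_basis mer) j. Qed.

Lemma measurable_phi j : measurable_fun setT (phi j).
Proof. exact: Lfun2_measurable (phi_L2 j). Qed.

Lemma integrable_phiM i j :
  P.-integrable setT (EFin \o (fun x => phi i x * phi j x)).
Proof. by apply/Lfun1_integrable; exact: Lfun2_mul_Lfun1 (phi_L2 i) (phi_L2 j). Qed.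

Lemma integral_phiM i j : (\int[P]_x (phi i x * phi j x)%:E = (i == j)%:R%:E)%E.
Proof. exact: onb_orth (mercer_basis mer) i j. Qed.

Lemma integral_phi_sqr J (c : nat -> R) :
  (\int[P]_x ((\sum_(j < J) c j * phi j x) ^+ 2)%:E =
   (\sum_(j < J) c j ^+ 2)%:E)%E.
Proof.
transitivity (\int[P]_x (\sum_(j < J) c j *
    (\sum_(i < J) c i * (phi i x * phi j x)))%:E)%E.
  apply: eq_integral => x _; congr (_%:E).
  rewrite expr2 mulr_suml; apply: eq_bigr => j _.
  rewrite mulr_sumr mulr_sumr; apply: eq_bigr => i _; ring.
rewrite (@integral_EFin_lin _ _ _ _ _ _ _ _ (fun j : 'I_J => c j)).
- by congr (_%:E); apply: eq_bigr => j _; rewrite expr2.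
- by move=> j; apply: integrable_EFin_lin => i; exact: integrable_phiM.
- move=> j.
  rewrite (@integral_EFin_lin _ _ _ _ _ _ _ _ (fun i : 'I_J => (i == j)%:R)).
  + congr (_%:E); rewrite (bigD1 j)//= eqxx mulr1 big1 ?addr0// => i /negPf ->.
    by rewrite mulr0.
  + by move=> i; exact: integrable_phiM.
  + by move=> i; rewrite integral_phiM.
Qed.

Lemma mercer_partial_le x J : \sum_(j < J) mu j * phi j x ^+ 2 <= K x x.
Proof.
have cv := @mercerE x x.
rewrite -(cvg_lim (@Rhausdorff R) cv).
rewrite (_ : \sum_(j < J) _ = (fun n => \sum_(j < n) mu j * phi j x * phi j x) J).
  apply: nondecreasing_cvgn_le; last exact: cvgP cv.
  apply/nondecreasing_seqP => n; rewrite big_ord_recr/= lerDl.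
  by rewrite -mulrA mulr_ge0// -expr2 sqr_ge0.
by apply: eq_bigr => j _; rewrite expr2 mulrA.
Qed.

Lemma measurable_kernel : measurable_fun [set: T * T] (fun p => K p.1 p.2).
Proof.
apply: (@measurable_fun_cvg _ (T * T)%type R setT
  (fun n (p : T * T) => \sum_(j < n) mu j * phi j p.1 * phi j p.2)
  (fun p => K p.1 p.2)); last by move=> p _; exact: mercerE.
move=> n; apply: measurable_sum => j; apply: measurable_funM.
  apply: measurable_funM => //.
  exact: (measurableT_comp (measurable_phi j) measurable_fst).
exact: (measurableT_comp (measurable_phi j) measurable_snd).
Qed.

Lemma measurable_kernel_diag : measurable_fun setT (fun x => K x x).
Proof.
by apply: (measurableT_comp measurable_kernel (measurable_fun_pair _ _)).
Qed.

Lemma integral_kernel_diag : (\int[P]_x (K x x)%:E <= tr%:E)%E.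
Proof.
apply: (@fatou_bound _ _ _ _ (fun n x => \sum_(j < n) mu j * phi j x * phi j x)).
- move=> n; apply: measurable_sum => j; apply: measurable_funM.
    by apply: measurable_funM => //; exact: measurable_phi.
  exact: measurable_phi.
- by move=> n x; apply: sumr_ge0 => j _; rewrite -mulrA mulr_ge0// -expr2 sqr_ge0.
- by move=> x; exact: mercerE.
- move=> n; rewrite (eq_integral (fun x =>
    (\sum_(j < n) mu j * (phi j x * phi j x))%:E)); last first.
    by move=> x _; congr (_%:E); apply: eq_bigr => j _; rewrite mulrA.
  rewrite (@integral_EFin_lin _ _ _ _ _ _ _ _ (fun=> 1)).
  + by rewrite lee_fin (le_trans _ (mu_tr n))//; apply: ler_sum => j _; rewrite mulr1.
  + by move=> j; exact: integrable_phiM.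
  + by move=> j; rewrite integral_phiM eqxx.
Qed.

Let dom j x := K x x + phi j x ^+ 2.

Let kernel_diag_ge0 x : 0 <= K x x. Proof. exact: rkhs_kernel_diag_ge0 rk x. Qed.

Let dom_ge0 j x : 0 <= dom j x.
Proof. by rewrite addr_ge0// sqr_ge0. Qed.

Let mdom j : measurable_fun setT (dom j).
Proof.
apply: measurable_funD; first exact: measurable_kernel_diag.
by apply: measurable_funX; exact: measurable_phi.
Qed.

Let integral_dom j : (\int[P]_x (dom j x)%:E <= (tr + 1)%:E)%E.
Proof.
under eq_integral do rewrite EFinD.
rewrite ge0_integralD//.
- rewrite EFinD; apply: leeD; first exact: integral_kernel_diag.
  by under eq_integral do rewrite expr2; rewrite integral_phiM eqxx.
- by move=> x _; rewrite lee_fin.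
- by apply/measurable_EFinP; exact: measurable_kernel_diag.
- by move=> x _; rewrite lee_fin sqr_ge0.
- by apply/measurable_EFinP/measurable_funX; exact: measurable_phi.
Qed.

Let integrable_dom j : P.-integrable setT (EFin \o dom j).
Proof.
apply/integrableP; split; first by apply/measurable_EFinP; exact: mdom.
under eq_integral do rewrite gee0_abs ?lee_fin//.
exact: le_lt_trans (integral_dom j) (ltry _).
Qed.

Let tr0 : 0 <= tr. Proof. by have := mu_tr 0; rewrite big_ord0. Qed.

(** Young's inequality: up to a constant factor, [dom j] dominates the products of
    [phi j] with every element of [H], and with the partial sums of the kernel. *)
Let dom_bound (A B a : R) j x : 0 <= A -> a ^+ 2 <= A * K x x ->
  `|a * phi j x| <= Num.sqrt A * dom j x.
Proof.
move=> A0 aA; rewrite normrM.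
have s0 := sqrtr_ge0 (K x x); have n0 := normr_ge0 (phi j x).
have -> : dom j x = Num.sqrt (K x x) ^+ 2 + `|phi j x| ^+ 2.
  by rewrite sqr_sqrtr// real_normK ?num_real.
have a_le : `|a| <= Num.sqrt A * Num.sqrt (K x x).
  by rewrite -sqrtrM// -sqrtr_sqr ler_wsqrtr.
apply: le_trans (ler_wpM2r n0 a_le) _; rewrite -mulrA ler_wpM2l ?sqrtr_ge0//.
move: s0 n0; move: (Num.sqrt (K x x)) `|phi j x| => u v u0 v0.
have := sqr_ge0 (u - v); have := sqr_ge0 u; have := sqr_ge0 v.
by rewrite !expr2; nra.
Qed.

(** The Mercer expansion, known pointwise, may be integrated term by term against
    [phi j]: by Cauchy-Schwarz its partial sums are at most the geometric mean of
    [K x x] and [K y y], so [dom j] gives dominated convergence. *)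
Lemma kernel_coef x j :
  (\int[P]_y (K x y * phi j y)%:E = (mu j * phi j x)%:E)%E.
Proof.
pose f_ n y := ((\sum_(i < n) mu i * phi i x * phi i y) * phi j y)%:E.
have mf_ n : measurable_fun setT (f_ n).
  apply/measurable_EFinP/measurable_funM; last exact: measurable_phi.
  apply: measurable_sum => i; apply: measurable_funM => //.
  exact: measurable_phi.
have mK : measurable_fun setT (K x).
  exact: Lfun2_measurable (HL2 (rkhs_kernel rk x)).
have mf : measurable_fun setT (fun y => (K x y * phi j y)%:E).
  by apply/measurable_EFinP/measurable_funM => //; exact: measurable_phi.
have cv : {ae P, forall y, setT y -> f_ ^~ y @ \oo --> (K x y * phi j y)%:E}.
  apply: aeW => y _; apply: cvg_EFin; first exact: nearW.
  by apply: cvgMl; exact: mercerE.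
have bnd : {ae P, forall y n, setT y ->
    `|f_ n y| <= (Num.sqrt (K x x) * dom j y)%:E}%E.
  apply: aeW => y n _; rewrite /f_ lee_fin.
  apply: dom_bound => //.
  have -> : \sum_(i < n) mu i * phi i x * phi i y =
      \sum_(i < n) (Num.sqrt (mu i) * phi i x) * (Num.sqrt (mu i) * phi i y).
    apply: eq_bigr => i _.
    by rewrite -{1}(sqr_sqrtr (mu0 i)); ring.
  apply: le_trans (sum_CS _ _ _ _) _.
  have E z : \sum_(i < n) (Num.sqrt (mu i) * phi i z) ^+ 2 =
      \sum_(i < n) mu i * phi i z ^+ 2.
    by apply: eq_bigr => i _; rewrite exprMn sqr_sqrtr.
  rewrite !E; apply: ler_pM; [| |exact: mercer_partial_le|exact: mercer_partial_le].
    by apply: sumr_ge0 => i _; rewrite mulr_ge0 ?sqr_ge0.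
  by apply: sumr_ge0 => i _; rewrite mulr_ge0 ?sqr_ge0.
have ig : P.-integrable setT (fun y => (Num.sqrt (K x x) * dom j y)%:E).
  by have := integrableZl measurableT (Num.sqrt (K x x)) (integrable_dom j).
have [_ _ lim] := dominated_convergence measurableT mf_ mf cv ig bnd.
apply: (cvg_unique _ lim) => //.
apply: cvg_near_cst; near=> n.
have jn : (j < n)%N by near: n; exact: nbhs_infty_gt.
rewrite /= /f_ (eq_integral (fun y =>
    (\sum_(i < n) (mu i * phi i x) * (phi i y * phi j y))%:E)); last first.
  by move=> y _; congr (_%:E); rewrite mulr_suml; apply: eq_bigr => i _; rewrite mulrA.
rewrite (@integral_EFin_lin _ _ _ _ _ _ _ _ (fun i : 'I_n => (i == j :> nat)%:R)).
- congr (_%:E); rewrite (bigD1 (Ordinal jn))//= eqxx mulr1 big1 ?addr0// => i ij.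
  rewrite (_ : (i == j :> nat) = false) ?mulr0//.
  by apply: contraNF ij => /eqP ij; apply/eqP/val_inj.
- by move=> i; exact: integrable_phiM.
- by move=> i; rewrite integral_phiM.
Unshelve. all: by end_near. Qed.

Definition coef (f : T -> R) j : R := (\int[P]_x (f x * phi j x))%R.

Lemma integrable_coef f j : H f -> P.-integrable setT (EFin \o (fun x => f x * phi j x)).
Proof.
by move=> Hf; apply/Lfun1_integrable; exact: Lfun2_mul_Lfun1 (HL2 Hf) (phi_L2 j).
Qed.

Lemma coef_lin j a f g : H f -> H g ->
  coef (fun x => a * f x + g x) j = a * coef f j + coef g j.
Proof.
move=> Hf Hg; rewrite /coef.
rewrite -RintegralZl//; last exact: integrable_coef.
rewrite -RintegralD//; last 2 first.
- by have := integrableZl measurableT a (integrable_coef j Hf).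
- exact: integrable_coef.
by apply: eq_Rintegral => x _; ring.
Qed.

Lemma coef_bounded j f : H f -> coef f j ^+ 2 <= (tr + 1) ^+ 2 * ip f f.
Proof.
move=> Hf; have q0 := ip_ge0 rk Hf.
have h : `|coef f j| <= Num.sqrt (ip f f) * (tr + 1).
  apply: le_trans (le_normr_Rintegral measurableT (integrable_coef j Hf)) _.
  rewrite -lee_fin /Rintegral fineK; last first.
    by have := integrable_fin_num measurableT (integrable_norm (integrable_coef j Hf)).
  apply: le_trans (_ : \int[P]_x (Num.sqrt (ip f f) * dom j x)%:E <= _)%E.
    apply: ge0_le_integral => //.
    - apply/measurable_EFinP; apply: measurableT_comp => //.
      apply: measurable_funM; last exact: measurable_phi.
      exact: Lfun2_measurable (HL2 Hf).
    - by apply/measurable_EFinP; apply: measurable_funM.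
    - by move=> x _; rewrite lee_fin; apply: dom_bound => //; apply: (rkhs_eval_le rk).
  under eq_integral do rewrite EFinM.
  rewrite ge0_integralZl_EFin ?sqrtr_ge0//; last 2 first.
  - by move=> x _; rewrite lee_fin.
  - exact/measurable_EFinP.
  by rewrite EFinM lee_wpmul2l ?lee_fin ?sqrtr_ge0.
have -> : (tr + 1) ^+ 2 * ip f f = (Num.sqrt (ip f f) * (tr + 1)) ^+ 2.
  by rewrite exprMn sqr_sqrtr// mulrC.
rewrite -(real_normK (num_real (coef f j))) ler_sqr ?nnegrE//.
by rewrite mulr_ge0 ?sqrtr_ge0// addr_ge0.
Qed.

Definition eig j (x : T) := mu j * phi j x.

(** The scaled eigenfunctions lie in [H] although the [phi j] are only known in
    [L^2]: [eig j] represents the bounded functional [coef _ j]. *)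
Lemma eig_spec j : H (eig j) /\ forall f, H f -> ip f (eig j) = coef f j.
Proof.
have [h Hh hP] := @riesz _ _ _ _ _ rk (coef ^~ j) ((tr + 1) ^+ 2)
  (sqr_ge0 _) (coef_lin j) (@coef_bounded j).
suff -> : eig j = h by [].
apply/funext => x.
rewrite -(rkhs_reproducing rk x Hh) (rkhs_ip_sym rk Hh (rkhs_kernel rk x)).
by rewrite hP; [rewrite /coef /Rintegral kernel_coef|exact: (rkhs_kernel rk)].
Qed.

Lemma eig_H j : H (eig j). Proof. by have [] := eig_spec j. Qed.

Lemma ip_eig f j : H f -> ip f (eig j) = coef f j.
Proof. by have [_] := eig_spec j; apply. Qed.

Lemma ip_eig_eig i j : ip (eig i) (eig j) = mu i * (i == j)%:R.
Proof.
rewrite (ip_eig j (eig_H i)) /coef /Rintegral.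
rewrite (eq_integral (fun x => (mu i)%:E * (phi i x * phi j x)%:E)%E); last first.
  by move=> x _; rewrite /eig -EFinM mulrA.
by rewrite (integralZl measurableT (integrable_phiM i j)) /= integral_phiM.
Qed.

Lemma coef_mu0 f j : H f -> mu j = 0 -> coef f j = 0.
Proof.
move=> Hf mj; rewrite -ip_eig//.
have e0 : eig j = fun=> 0 by apply/funext => x; rewrite /eig mj mul0r.
by rewrite e0 (rkhs_ip_sym rk Hf (rkhs_zero rk)) (ip0 rk Hf).
Qed.

(** The Bessel inequality takes [c] to be the optimal coefficients of [f]; the
    pointwise expansion takes [f] to be a section of the kernel. *)
Lemma ip_eig_sum J (c : nat -> R) f : H f ->
  let g := fun x => \sum_(j < J) c j * eig j x in
  ip (f \- g) (f \- g) =
  ip f f - 2 * (\sum_(j < J) c j * coef f j) + \sum_(j < J) c j ^+ 2 * mu j.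
Proof.
move=> Hf g; have Hg : H g by apply: (rkhs_sum rk) => j _; exact: eig_H.
rewrite (ip_sqrB rk)//; congr (_ - _ * _ + _).
  rewrite (rkhs_ip_sym rk Hf Hg) (ip_sum rk)//; last by move=> j _; exact: eig_H.
  apply: eq_bigr => j _.
  by rewrite (rkhs_ip_sym rk (eig_H j) Hf) ip_eig.
rewrite {1}/g (ip_sum rk)//; last by move=> j _; exact: eig_H.
apply: eq_bigr => j _; rewrite (rkhs_ip_sym rk (eig_H j) Hg) /g.
rewrite (ip_sum rk); [|by move=> i _; exact: eig_H|exact: eig_H].
rewrite (bigD1 j)//= ip_eig_eig eqxx mulr1 big1 ?addr0; first by ring.
move=> i ij; rewrite ip_eig_eig (_ : (i == j :> nat) = false) ?mulr0//.
by apply: contraNF ij => /eqP ij; apply/eqP/val_inj.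
Qed.

Lemma coef_bessel f J : H f -> \sum_(j < J) coef f j ^+ 2 / mu j <= ip f f.
Proof.
move=> Hf; have := ip_eig_sum J (fun j => coef f j / mu j) Hf.
set g := (fun x => _) => /= gE.
have Hg : H g by apply: (rkhs_sum rk) => j _; exact: eig_H.
have := ip_ge0 rk (rkhs_sub rk Hf Hg); rewrite gE.
have -> : \sum_(j < J) coef f j / mu j * coef f j = \sum_(j < J) coef f j ^+ 2 / mu j.
  by apply: eq_bigr => j _; ring.
have -> : \sum_(j < J) (coef f j / mu j) ^+ 2 * mu j = \sum_(j < J) coef f j ^+ 2 / mu j.
  apply: eq_bigr => j _; have [->|m0] := eqVneq (mu j) 0.
    by rewrite invr0 !mulr0.
  by field.
by lra.
Qed.

(** By the reproducing property the error at [x] is the inner product of [f] with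
    the remainder of the expansion of [K x], whose squared norm is the Mercer
    remainder at [(x, x)]. *)
Lemma coef_expansion f x : H f ->
  (fun J => \sum_(j < J) coef f j * phi j x) @ \oo --> f x.
Proof.
move=> Hf.
apply: (@cvg_sqr_dist _ _
  (fun J => ip f f * (K x x - \sum_(j < J) mu j * phi j x * phi j x))); last first.
  rewrite [X in _ --> X](_ : 0 = ip f f * (K x x - K x x)); last by rewrite subrr mulr0.
  by apply: cvgMr; apply: cvgB; [exact: cvg_cst|exact: mercerE].
move=> J.
have Hx := rkhs_kernel rk x.
have := ip_eig_sum J (fun j => phi j x) Hx.
set g := (fun y => _) => /= gE.
have Hg : H g by apply: (rkhs_sum rk) => j _; exact: eig_H.
have coefK j : coef (K x) j = mu j * phi j x.
  by rewrite /coef /Rintegral kernel_coef.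
have -> : K x x - \sum_(j < J) mu j * phi j x * phi j x = ip (K x \- g) (K x \- g).
  rewrite gE (ip_kernel rk).
  have -> : \sum_(j < J) phi j x * coef (K x) j = \sum_(j < J) mu j * phi j x * phi j x.
    by apply: eq_bigr => j _; rewrite coefK; ring.
  have -> : \sum_(j < J) phi j x ^+ 2 * mu j = \sum_(j < J) mu j * phi j x * phi j x.
    by apply: eq_bigr => j _; ring.
  by ring.
have Hs := rkhs_sub rk Hx Hg.
apply: le_trans (ip_CS rk Hf Hs); rewrite le_eqVlt; apply/orP; left; apply/eqP.
congr (_ ^+ 2).
rewrite (rkhs_ip_sym rk Hf Hs) (ipB rk Hx Hg Hf).
rewrite -(rkhs_ip_sym rk Hf Hx) (rkhs_reproducing rk x Hf); congr (_ - _).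
rewrite (ip_sum rk)//; last by move=> j _; exact: eig_H.
by apply: eq_bigr => j _; rewrite (rkhs_ip_sym rk (eig_H j) Hf) ip_eig// mulrC.
Qed.

(** Fatou's lemma along the pointwise expansion gives the half of Parseval's
    identity that is needed. *)
Lemma integral_sqr_le_coef f b : H f ->
  (forall J, \sum_(j < J) coef f j ^+ 2 <= b) -> (\int[P]_x (f x ^+ 2)%:E <= b%:E)%E.
Proof.
move=> Hf fb.
apply: (@fatou_bound _ _ _ _ (fun J x => (\sum_(j < J) coef f j * phi j x) ^+ 2)).
- move=> J; apply: measurable_funX; apply: measurable_sum => j.
  by apply: measurable_funM => //; exact: measurable_phi.
- by move=> J x; exact: sqr_ge0.
- move=> x; rewrite expr2; under eq_fun do rewrite expr2.
  by apply: cvgM; exact: coef_expansion.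
- by move=> J; rewrite integral_phi_sqr lee_fin.
Qed.

(** Every eigenvalue is at most the trace. *)
Lemma integral_sqr_le_norm f : H f -> (\int[P]_x (f x ^+ 2)%:E <= (tr * ip f f)%:E)%E.
Proof.
move=> Hf; apply: integral_sqr_le_coef => // J.
have q0 := ip_ge0 rk Hf.
have muj (j : 'I_J) : mu j <= tr.
  apply: le_trans (mu_tr j.+1); rewrite big_ord_recr/= lerDr.
  by apply: sumr_ge0.
apply: le_trans (_ : \sum_(j < J) tr * (coef f j ^+ 2 / mu j) <= _).
  apply: ler_sum => j _; have [m0|m0] := eqVneq (mu j) 0.
    by rewrite coef_mu0// m0 invr0 expr0n mul0r mulr0.
  rewrite mulrA ler_pdivlMr ?lt0r ?m0//= mulrC.
  by rewrite ler_wpM2r ?sqr_ge0.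
by rewrite -mulr_sumr ler_wpM2l// coef_bessel.
Qed.

End mercer.

(** * Kernel ridge regression on one block *)

Lemma sqr_le_abs (R : realType) (a b : R) : 0 <= b -> a ^+ 2 <= b ^+ 2 -> a <= b.
Proof.
move=> b0 ab; rewrite leNgt; apply/negP => ba.
by move: ab; rewrite leNgt ltr_sqr ?nnegrE ?ba// ltW// (le_lt_trans b0).
Qed.

Section ridge.
Context (R : realType) (T : Type) (K : T -> T -> R) (H : set (T -> R))
  (ip : (T -> R) -> (T -> R) -> R).
Hypothesis psd : psd_kernel K.
Hypothesis rk : is_rkhs K H ip.
Context (N : nat) (B : {set 'I_N}) (x : 'I_N -> T) (lam : R).
Hypothesis lam0 : 0 < lam.
Hypothesis B0 : (0 < #|B|)%N.

Let n : R := #|B|%:R.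

Let n0 : 0 < n. Proof. by rewrite ltr0n. Qed.

Let nV0 : 0 <= n^-1. Proof. by rewrite invr_ge0 ltW. Qed.

Definition emp_sqnorm (f : T -> R) : R := n^-1 * \sum_(u in B) f (x u) ^+ 2.

Lemma emp_sqnorm_ge0 f : 0 <= emp_sqnorm f.
Proof. by apply: (mulr_ge0 nV0); apply: sumr_ge0 => u _; exact: sqr_ge0. Qed.

(** First-order optimality of a ridge estimate for the responses [v]. *)
Definition stationary (v : 'I_N -> R) (g : T -> R) := forall h, H h ->
  n^-1 * \sum_(u in B) (g (x u) - v u) * h (x u) + lam * ip g h = 0.

Lemma krr_stationary v g : is_krr_estimate H ip lam B x v g -> stationary v g.
Proof.
move=> [Hg gmin] h Hh.
set b := _ + _.
have c0 : 0 <= emp_sqnorm h + lam * ip h h.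
  by rewrite (addr_ge0 (emp_sqnorm_ge0 h))// (mulr_ge0 (ltW lam0))// (ip_ge0 rk).
suff : b ^+ 2 <= 0 * (emp_sqnorm h + lam * ip h h).
  rewrite mul0r => b2; apply/eqP; rewrite -sqrf_eq0 eq_le b2 sqr_ge0//.
apply: quadratic_ge0 => // t.
have Ht := rkhs_lin rk t Hh Hg.
have := gmin _ Ht.
rewrite /krr_objective !(Hnorm_sqr rk)// (ip_line rk)// -/n.
have -> : \sum_(s in B) (t * h (x s) + g (x s) - v s) ^+ 2 =
   \sum_(s in B) (g (x s) - v s) ^+ 2 +
   2 * t * (\sum_(s in B) (g (x s) - v s) * h (x s)) +
   t ^+ 2 * \sum_(s in B) h (x s) ^+ 2.
  by rewrite !mulr_sumr -!big_split/=; apply: eq_bigr => s _; ring.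
rewrite /b /emp_sqnorm; move: (\sum_(s in B) _) (\sum_(s in B) _) (\sum_(s in B) _) => s1 s2 s3.
move: (n^-1) (ip _ _) (ip _ _) (ip _ _) => k i1 i2 i3.
rewrite -subr_ge0; congr (_ <= _); ring.
Qed.

(** The difference of two solutions, used as test function, has zero energy. *)
Lemma stationary_unique v g1 g2 : H g1 -> H g2 ->
  stationary v g1 -> stationary v g2 -> g1 = g2.
Proof.
move=> H1 H2 s1 s2.
have HD := rkhs_sub rk H1 H2.
have E : emp_sqnorm (g1 \- g2) + lam * ip (g1 \- g2) (g1 \- g2) = 0.
  have := s1 _ HD; have := s2 _ HD; rewrite {4}/GRing.sub_fun.
  rewrite (ipB rk H1 H2 HD) /emp_sqnorm.
  have -> : \sum_(u in B) (g1 \- g2) (x u) ^+ 2 =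
    \sum_(u in B) (g1 (x u) - v u) * (g1 \- g2) (x u) -
    \sum_(u in B) (g2 (x u) - v u) * (g1 \- g2) (x u).
    by rewrite -sumrB; apply: eq_bigr => u _ /=; ring.
  by move=> e2 e1; rewrite mulrBr mulrBr; lra.
have D0 : g1 \- g2 = fun=> 0.
  apply: contrapT => Dn; have := rkhs_ip_pos rk HD Dn => ip0.
  have := emp_sqnorm_ge0 (g1 \- g2); have : 0 < lam * ip (g1 \- g2) (g1 \- g2).
    exact: mulr_gt0.
  by lra.
by apply/funext => y; apply/eqP; rewrite -subr_eq0; have /(congr1 (@^~ y)) /= -> := D0.
Qed.

(** The Gram matrix of the block, set to zero outside the block: the dimension
    is the same for all blocks, and the shift makes the matrix invertible. *)
Definition ridge_gram : 'M[R]_N :=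
  \matrix_(s, t) (if (s \in B) && (t \in B) then K (x s) (x t) else 0)
  + (n * lam)%:M.

Lemma ridge_gram_unit : ridge_gram \in unitmx.
Proof.
rewrite -row_free_unit; apply: inj_row_free => v vA.
have nl0 : 0 < n * lam by rewrite mulr_gt0.
have E : \sum_s \sum_t v 0 s * ridge_gram s t * v 0 t = 0.
  rewrite exchange_big/=; apply: big1 => t _; rewrite -mulr_suml.
  have /(congr1 (fun M : 'rV_N => M 0 t)) := vA.
  by rewrite /mulmx mxE [RHS]mxE => ->; rewrite mul0r.
have [_ Kpsd] := psd.
pose a (s : 'I_N) := if s \in B then v 0 s else 0.
have := Kpsd N x a.
have E2 : \sum_s \sum_t v 0 s * ridge_gram s t * v 0 t =
    \sum_(i < N) \sum_(j < N) a i * a j * K (x i) (x j) +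
    (n * lam) * \sum_s v 0 s ^+ 2.
  rewrite mulr_sumr -big_split/=; apply: eq_bigr => s _.
  transitivity (\sum_t (a s * a t * K (x s) (x t) +
      (if t == s then n * lam * v 0 s ^+ 2 else 0))).
    apply: eq_bigr => t _; rewrite !mxE /a (eq_sym s t).
    case: (s \in B); case: (t \in B) => /=; have [->|ts] := eqVneq t s;
      rewrite ?mulr1n ?mulr0n; ring.
  by rewrite big_split/= -big_mkcond/= big_pred1_eq.
move: E; rewrite E2 => E a0.
have q0 : 0 <= \sum_s v 0 s ^+ 2 by apply: sumr_ge0 => s _; exact: sqr_ge0.
have qE : \sum_s v 0 s ^+ 2 = 0.
  have : n * lam * \sum_s v 0 s ^+ 2 <= 0 by lra.
  rewrite pmulr_rle0// => q1; apply/eqP; rewrite eq_le q1 q0//.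
apply/rowP => s; rewrite mxE; apply/eqP; rewrite -sqrf_eq0; apply/eqP.
apply: (psumr_eq0P _ qE) => // i _; exact: sqr_ge0.
Qed.

Definition ridge_coef : 'M[R]_N := invmx ridge_gram.

(** The coefficient of the response at [s] in the estimate. *)
Definition ridge_basis (s : 'I_N) (y : T) : R :=
  \sum_(t in B) ridge_coef t s * K (x t) y.

Definition ridge (v : 'I_N -> R) (y : T) : R := \sum_(s in B) v s * ridge_basis s y.

Lemma ridge_basis_H s : H (ridge_basis s).
Proof. by apply: (rkhs_sum rk) => t _; exact: rkhs_kernel rk (x t). Qed.

Lemma ridge_H v : H (ridge v).
Proof. by apply: (rkhs_sum rk) => s _; exact: ridge_basis_H. Qed.

Lemma ip_ridge_basis s h : H h ->
  ip (ridge_basis s) h = \sum_(t in B) ridge_coef t s * h (x t).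
Proof.
move=> Hh; rewrite /ridge_basis (ip_sum rk)//; last first.
  by move=> t _; exact: (rkhs_kernel rk).
apply: eq_bigr => t _.
by rewrite (rkhs_ip_sym rk (rkhs_kernel rk _) Hh) (rkhs_reproducing rk).
Qed.

Lemma ridge_basis_sample s u : u \in B ->
  ridge_basis s (x u) = (u == s)%:R - n * lam * ridge_coef u s.
Proof.
move=> uB; have /matrixP/(_ u s) := mulmxV ridge_gram_unit.
rewrite !mxE => <-.
transitivity (\sum_t ((if t \in B then ridge_coef t s * K (x t) (x u) else 0) +
   (if t == u then n * lam * ridge_coef u s else 0)) - n * lam * ridge_coef u s).
  by rewrite big_split/= -!big_mkcond/= big_pred1_eq addrK.
congr (_ - _); apply: eq_bigr => t _; rewrite !mxE uB /= /ridge_coef (eq_sym u t).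
have [Ksym _] := psd; rewrite (Ksym (x t)).
by have [->|tu] := eqVneq t u; case: (_ \in B); rewrite ?mulr1n ?mulr0n; ring.
Qed.

Lemma ridge_stationary v : stationary v (ridge v).
Proof.
move=> h Hh; rewrite /ridge (ip_sum rk)//; last by move=> s _; exact: ridge_basis_H.
under [X in _ + lam * X]eq_bigr do rewrite ip_ridge_basis// mulr_sumr.
rewrite exchange_big/= 2!mulr_sumr -big_split/= big1// => u uB.
have -> : \sum_(s in B) v s * ridge_basis s (x u) =
    v u - n * lam * \sum_(s in B) v s * ridge_coef u s.
  under eq_bigr do rewrite ridge_basis_sample// mulrBr.
  rewrite sumrB; congr (_ - _).
    rewrite (bigD1 u)//= eqxx mulr1 big1 ?addr0// => s /andP[_ su].
    by rewrite eq_sym (negPf su) mulr0.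
  by rewrite mulr_sumr; apply: eq_bigr => s _; ring.
have -> : \sum_(i in B) v i * (ridge_coef u i * h (x u)) =
   (\sum_(i in B) v i * ridge_coef u i) * h (x u).
  by rewrite mulr_suml; apply: eq_bigr => i _; ring.
by field; rewrite gt_eqF.
Qed.

(** The minimiser is unique and linear in the responses, so its error splits into
    a bias, the fit to the noiseless responses, and a sum over the noise. *)
Lemma krr_ridge v g : is_krr_estimate H ip lam B x v g -> g = ridge v.
Proof.
move=> kg; apply: stationary_unique (ridge_stationary v).
- by case: kg.
- exact: ridge_H.
- exact: krr_stationary.
Qed.

(** [ridge_basis s] fits a unit response at [s]; its optimality condition is
    tested against itself. *)
Lemma ridge_basis_energy s : s \in B ->
  emp_sqnorm (ridge_basis s) + lam * ip (ridge_basis s) (ridge_basis s) =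
  n^-1 * ridge_basis s (x s).
Proof.
move=> sB; have Hg := ridge_basis_H s.
have st : stationary (fun u => (u == s)%:R) (ridge_basis s).
  have <- : ridge (fun u => (u == s)%:R) = ridge_basis s.
    apply/funext => y; rewrite /ridge (bigD1 s)//= eqxx mul1r big1 ?addr0//.
    by move=> u /andP[_ /negPf ->]; rewrite mul0r.
  exact: ridge_stationary.
have := st _ Hg; rewrite /emp_sqnorm.
have -> : \sum_(u in B) (ridge_basis s (x u) - (u == s)%:R) * ridge_basis s (x u)
  = \sum_(u in B) ridge_basis s (x u) ^+ 2 - ridge_basis s (x s).
  rewrite (bigD1 s)//= [in RHS](bigD1 s)//= eqxx.
  rewrite (eq_bigr (fun u => ridge_basis s (x u) ^+ 2)); first by rewrite mulr1n; ring.
  by move=> u /andP[_ /negPf ->]; rewrite mulr0n; ring.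
by rewrite mulrBr; lra.
Qed.

(** A consequence of [p - p ^+ 2 <= 1] for the value [p] at the point [s]. *)
Lemma ridge_basis_norm s : s \in B ->
  ip (ridge_basis s) (ridge_basis s) <= (n * lam)^-1.
Proof.
move=> sB; have := ridge_basis_energy sB.
set p := ridge_basis s (x s); set q := ip _ _ => E.
have e1 : n^-1 * p ^+ 2 <= emp_sqnorm (ridge_basis s).
  rewrite (ler_wpM2l nV0)// (bigD1 s)//= lerDl.
  by apply: sumr_ge0 => u _; exact: sqr_ge0.
have h : lam * q <= n^-1 * 1.
  apply: le_trans (_ : n^-1 * (p - p ^+ 2) <= _); first by rewrite mulrBr; lra.
  rewrite (ler_wpM2l nV0)//.
  by have := sqr_ge0 (p - 1); rewrite !expr2; nra.
by rewrite invfM mulrC -ler_pdivrMl ?invr_gt0// invrK mulrC mulrC -[n^-1]mulr1.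
Qed.

Section bias.
Variable f : T -> R.
Hypothesis Hf : H f.

Let D := ridge (fun u => f (x u)) \- f.

Lemma ridge_bias_H : H D. Proof. exact: (rkhs_sub rk (ridge_H _) Hf). Qed.

Let bias_energy : emp_sqnorm D + lam * ip D D = - (lam * ip f D).
Proof.
have HD := ridge_bias_H; have := ridge_stationary (fun u => f (x u)) HD.
have -> : ip (ridge (fun u => f (x u))) D = ip D D + ip f D.
  by rewrite -[in RHS](ipD rk HD Hf HD); congr (ip _ D); apply/funext => y /=; rewrite subrK.
have -> : \sum_(u in B) (ridge (fun u => f (x u)) (x u) - f (x u)) * D (x u) =
   \sum_(u in B) D (x u) ^+ 2 by apply: eq_bigr => u _; rewrite expr2.
by rewrite /emp_sqnorm; lra.
Qed.

(** The norm of [f \+ D] is nonnegative. *)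
Let ip_fD : - ip f D <= (ip f f + ip D D) / 2.
Proof.
have := ip_ge0 rk (rkhs_add rk Hf ridge_bias_H).
have -> : ip (f \+ D) (f \+ D) = ip f f + 2 * ip f D + ip D D.
  rewrite (_ : f \+ D = (fun y => 1 * D y + f y)).
    by rewrite (ip_line rk _ Hf ridge_bias_H); ring.
  by apply/funext => y; rewrite mul1r addrC.
by lra.
Qed.

Lemma ridge_bias_norm : ip D D <= ip f f.
Proof.
have := ler_wpM2l (ltW lam0) ip_fD; have := emp_sqnorm_ge0 D.
rewrite mulrN -bias_energy => e0 h.
have : lam * ip D D <= lam * ip f f by lra.
by rewrite ler_pM2l.
Qed.

Lemma ridge_bias_energy : emp_sqnorm D + lam * ip D D <= lam * ip f f.
Proof.
have := ler_wpM2l (ltW lam0) ip_fD; have := ler_wpM2l (ltW lam0) ridge_bias_norm.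
by rewrite mulrN -bias_energy; lra.
Qed.

End bias.

End ridge.

(** * The event on which the empirical norm is comparable with the true one *)

Section good_event.
Context d (T : measurableType d) (R : realType) (P : probability T R)
  (K : T -> T -> R) (H : set (T -> R)) (ip : (T -> R) -> (T -> R) -> R)
  (mu : nat -> R) (phi : nat -> T -> R) (tr lam gam : R).
Hypothesis psd : psd_kernel K.
Hypothesis rk : is_rkhs K H ip.
Hypothesis HL2 : forall f, H f -> f \in Lfun P 2%:E.
Hypothesis mer : mercer_expansion P K mu phi.
Hypothesis mu_tr : forall J, \sum_(j < J) mu j <= tr.
Hypothesis lam0 : 0 < lam.

Let mu0 j : 0 <= mu j. Proof. exact: mercer_ge0 mer j. Qed.

(** The factor by which ridge regression with infinitely many observations
    shrinks the coefficient on [phi j]. *)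
Definition shrink j : R := mu j / (mu j + lam).

Hypothesis shrink_gam : forall J, \sum_(j < J) shrink j <= gam.

Let mul0 j : 0 < mu j + lam. Proof. by rewrite ltr_wpDl. Qed.

Lemma shrink_ge0 j : 0 <= shrink j.
Proof. by rewrite /shrink divr_ge0// ltW. Qed.

Lemma gam_ge0 : 0 <= gam.
Proof. by have := shrink_gam 0; rewrite big_ord0. Qed.

Lemma tr_ge0 : 0 <= tr.
Proof. by have := mu_tr 0; rewrite big_ord0. Qed.

(** Leverage of the point [x]: the diagonal of the kernel with the eigenvalues
    [mu j] replaced by the shrinkage factors [shrink j]; its mean is the effective
    dimension. *)
Definition leverage (x : T) : R := limn (fun J => \sum_(j < J) shrink j * phi j x ^+ 2).

Let lev_partial x : nondecreasing_seq (fun J => \sum_(j < J) shrink j * phi j x ^+ 2).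
Proof.
apply/nondecreasing_seqP => J; rewrite big_ord_recr/= lerDl.
by rewrite mulr_ge0 ?shrink_ge0 ?sqr_ge0.
Qed.

Let lev_cvg x : cvgn (fun J => \sum_(j < J) shrink j * phi j x ^+ 2).
Proof.
apply: nondecreasing_is_cvgn (lev_partial x) _.
exists (lam^-1 * K x x) => _ [J _ <-].
apply: le_trans (_ : lam^-1 * \sum_(j < J) mu j * phi j x ^+ 2 <= _); last first.
  by rewrite ler_wpM2l ?invr_ge0 ?(ltW lam0)//; exact: mercer_partial_le mer _ _.
rewrite mulr_sumr; apply: ler_sum => j _; rewrite [leRHS]mulrA.
apply: ler_wpM2r; first exact: sqr_ge0.
rewrite /shrink [leRHS]mulrC ler_wpM2l// lef_pV2 ?posrE//.
by rewrite lerDr.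
Qed.

Lemma leverage_ge x J : \sum_(j < J) shrink j * phi j x ^+ 2 <= leverage x.
Proof. by have := nondecreasing_cvgn_le (@lev_partial x) (lev_cvg (x:=x)) J. Qed.

Lemma leverage_ge0 x : 0 <= leverage x.
Proof. by have := leverage_ge x 0; rewrite big_ord0. Qed.

Lemma measurable_leverage : measurable_fun setT leverage.
Proof.
apply: (@measurable_fun_cvg _ T R setT
  (fun J x => \sum_(j < J) shrink j * phi j x ^+ 2)); last by move=> x _; exact: lev_cvg.
move=> J; apply: measurable_sum => j; apply: measurable_funM => //.
by apply: measurable_funX; exact: measurable_phi mer _.
Qed.

Lemma integral_leverage : (\int[P]_x (leverage x)%:E <= gam%:E)%E.
Proof.
apply: (@fatou_bound _ _ _ _ (fun J x => \sum_(j < J) shrink j * phi j x ^+ 2)).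
- move=> J; apply: measurable_sum => j; apply: measurable_funM => //.
  by apply: measurable_funX; exact: measurable_phi mer _.
- by move=> J x; apply: sumr_ge0 => j _; rewrite mulr_ge0 ?shrink_ge0 ?sqr_ge0.
- by move=> x; exact: lev_cvg.
- move=> J.
  rewrite (@integral_EFin_lin _ _ _ _ _ _ _ _ (fun=> 1)).
  + by rewrite lee_fin (le_trans _ (shrink_gam J))//; apply: ler_sum => j _; rewrite mulr1.
  + move=> j; have := integrable_phiM mer j j.
    by under eq_fun do rewrite -expr2.
  + by move=> j; under eq_integral do rewrite expr2; rewrite (integral_phiM mer) eqxx.
Qed.

(** [integral of f^2 + lam * ip f f], truncated to the first [J] coordinates. A
    coordinate with [mu j = 0] contributes nothing, by [coef_mu0]. *)
Definition energy (f : T -> R) J : R :=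
  \sum_(j < J) coef P phi f j ^+ 2 * (1 + lam / mu j).

Let energy_term_ge0 f j : 0 <= coef P phi f j ^+ 2 * (1 + lam / mu j).
Proof. by rewrite mulr_ge0 ?sqr_ge0// addr_ge0// divr_ge0// ltW. Qed.

Lemma energy_nd f : nondecreasing_seq (energy f).
Proof.
apply/(nondecreasing_seqP (energy f)) => J; rewrite /energy big_ord_recr/= lerDl.
exact: energy_term_ge0.
Qed.

(** Coordinates in which the energy is the Euclidean norm. *)
Let escale f j : R := coef P phi f j / Num.sqrt (shrink j).

Let escaleE f j : H f -> coef P phi f j = Num.sqrt (shrink j) * escale f j.
Proof.
move=> Hf; have [m0|m0] := eqVneq (mu j) 0.
  by rewrite /escale (coef_mu0 rk HL2 mer mu_tr Hf m0) mul0r mulr0.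
have mgt0 : 0 < mu j by rewrite lt0r m0 mu0.
by rewrite /escale mulrC divfK// sqrtr_eq0 -ltNge /shrink divr_gt0.
Qed.

Let escale_sqr f j : H f -> escale f j ^+ 2 = coef P phi f j ^+ 2 * (1 + lam / mu j).
Proof.
move=> Hf; have [m0|m0] := eqVneq (mu j) 0.
  by rewrite /escale (coef_mu0 rk HL2 mer mu_tr Hf m0) !mul0r expr0n mul0r.
rewrite /escale exprMn exprVn sqr_sqrtr ?shrink_ge0// /shrink.
by field; rewrite m0 gt_eqF.
Qed.

(** Cauchy-Schwarz in the pointwise expansion, with the square roots of [shrink j]
    moved from the coefficients to the eigenfunctions. *)
Lemma eval_le_leverage f b x : H f -> (forall J, energy f J <= b) ->
  f x ^+ 2 <= b * leverage x.
Proof.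
move=> Hf fb.
have cv : (fun J => (\sum_(j < J) coef P phi f j * phi j x) ^+ 2) @ \oo --> f x ^+ 2.
  rewrite expr2; under eq_fun do rewrite expr2.
  by apply: cvgM; exact: (coef_expansion rk HL2 mer mu_tr).
apply: (cvgr_to_le cv); apply: nearW => J.
have -> : \sum_(j < J) coef P phi f j * phi j x =
    \sum_(j < J) escale f j * (Num.sqrt (shrink j) * phi j x).
  by apply: eq_bigr => j _; rewrite escaleE//; ring.
apply: le_trans (sum_CS _ _ _ _) _; apply: ler_pM.
- by apply: sumr_ge0 => j _; exact: sqr_ge0.
- by apply: sumr_ge0 => j _; exact: sqr_ge0.
- by apply: le_trans (fb J); apply: ler_sum => j _; rewrite escale_sqr.
- apply: le_trans (leverage_ge x J); apply: ler_sum => j _.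
  by rewrite exprMn sqr_sqrtr ?shrink_ge0.
Qed.

Lemma integral_sqr_le_energy f b : H f -> (forall J, energy f J <= b) ->
  (\int[P]_x (f x ^+ 2)%:E <= b%:E)%E.
Proof.
move=> Hf fb; apply: (integral_sqr_le_coef rk HL2 mer mu_tr Hf) => J.
apply: le_trans (fb J); apply: ler_sum => j _.
by rewrite ler_peMr ?sqr_ge0// lerDl divr_ge0// ltW.
Qed.

Context (N : nat) (B : {set 'I_N}) (x : 'I_N -> T).
Hypothesis B0 : (0 < #|B|)%N.

Let n : R := #|B|%:R.

Let n0 : 0 < n. Proof. by rewrite ltr0n. Qed.

Definition cov_dev i j : R :=
  n^-1 * \sum_(s in B) (phi i (x s) * phi j (x s) - (i == j)%:R).

Definition cov_dev_norm J : R :=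
  \sum_(i < J) \sum_(j < J) shrink i * shrink j * cov_dev i j ^+ 2.

(** The weighted Hilbert-Schmidt distance of the empirical covariance of the
    [phi j] from the identity is at most 1/2. *)
Definition good : Prop := forall J, cov_dev_norm J <= 4^-1.

Let emp_truncation f J :
  n^-1 * (\sum_(s in B) (\sum_(j < J) coef P phi f j * phi j (x s)) ^+ 2) -
  \sum_(j < J) coef P phi f j ^+ 2 =
  \sum_(i < J) \sum_(j < J) coef P phi f i * coef P phi f j * cov_dev i j.
Proof.
set c := coef P phi f.
have -> : \sum_(i < J) \sum_(j < J) c i * c j * cov_dev i j =
  \sum_(i < J) \sum_(j < J) (n^-1 * \sum_(s in B) c i * phi i (x s) * (c j * phi j (x s))
    - (if j == i then c i ^+ 2 else 0)).
  apply: eq_bigr => i _; apply: eq_bigr => j _; rewrite /cov_dev sumrB sumr_const.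
  rewrite -(mulr_natl (i == j :> nat)%:R #|B|) mulrBr mulKf ?(gt_eqF n0)// mulrBr.
  congr (_ - _).
    by rewrite !mulr_sumr; apply: eq_bigr => s _; ring.
  rewrite (_ : (i == j :> nat) = (j == i)); last by rewrite eq_sym.
  by have [->|_] := eqVneq j i; rewrite ?mulr1n ?mulr0n; ring.
under [RHS]eq_bigr do rewrite sumrB -big_mkcond/= big_pred1_eq.
rewrite sumrB; congr (_ - _).
under [RHS]eq_bigr do rewrite -mulr_sumr.
rewrite -mulr_sumr; congr (_ * _).
under [RHS]eq_bigr do rewrite exchange_big/=.
rewrite exchange_big/=; apply: eq_bigr => s _.
rewrite expr2 mulr_suml; apply: eq_bigr => i _; rewrite mulr_sumr.
by [].
Qed.

(** Cauchy-Schwarz over pairs of indices: the quadratic form of the covariance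
    deviation is at most its Hilbert-Schmidt norm times the energy. *)
Let cross_le f J : H f -> good ->
  `|\sum_(i < J) \sum_(j < J) coef P phi f i * coef P phi f j * cov_dev i j|
  <= energy f J / 2.
Proof.
move=> Hf gd.
have e0 : 0 <= energy f J by apply: sumr_ge0 => j _; exact: energy_term_ge0.
apply: sqr_le_abs; first by rewrite divr_ge0.
rewrite real_normK ?num_real//.
have -> : \sum_(i < J) \sum_(j < J) coef P phi f i * coef P phi f j * cov_dev i j =
  \sum_(p : 'I_J * 'I_J) (escale f p.1 * escale f p.2) *
    (Num.sqrt (shrink p.1) * Num.sqrt (shrink p.2) * cov_dev p.1 p.2).
  rewrite pair_big/=; apply: eq_bigr => -[i j] _ /=.
  by rewrite (escaleE i Hf) (escaleE j Hf); ring.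
apply: le_trans (sum_CS _ _ _ _) _.
have -> : (energy f J / 2) ^+ 2 = energy f J ^+ 2 * 4^-1 by field.
apply: ler_pM.
- by apply: sumr_ge0 => j _; exact: sqr_ge0.
- by apply: sumr_ge0 => j _; exact: sqr_ge0.
- rewrite le_eqVlt; apply/orP; left; apply/eqP.
  rewrite expr2 {1}/energy mulr_suml.
  transitivity (\sum_(i < J) \sum_(j < J) escale f i ^+ 2 * escale f j ^+ 2).
    by rewrite pair_big/=; apply: eq_bigr => -[i j] _ /=; rewrite exprMn.
  apply: eq_bigr => i _; rewrite escale_sqr// mulr_sumr.
  by apply: eq_bigr => j _; rewrite escale_sqr.
- apply: le_trans (gd J); rewrite /cov_dev_norm pair_big/=.
  apply: ler_sum => -[i j] _ /=.
  by rewrite !exprMn !sqr_sqrtr ?shrink_ge0.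
Qed.

(** The empirical and population norms of a truncation differ by the quadratic
    form of the covariance deviation, hence by at most half of the energy on the
    good event. The truncation is then removed in the empirical norm, where only
    finitely many points matter. *)
Lemma energy_le_emp f J : H f -> good ->
  energy f J <= 2 * (emp_sqnorm B x f + lam * ip f f).
Proof.
move=> Hf gd.
pose fJ J' s := \sum_(j < J') coef P phi f j * phi j (x s).
have cv : (fun J' => 2 * (n^-1 * (\sum_(s in B) fJ J' s ^+ 2) + lam * ip f f)) @ \oo -->
    2 * (emp_sqnorm B x f + lam * ip f f).
  apply: cvgMr; apply: cvgD; last exact: cvg_cst.
  apply: cvgMr; apply: cvg_big => [|s _]; first exact: add_continuous.
  rewrite expr2; under eq_fun do rewrite expr2.
  by apply: cvgM; exact: (coef_expansion rk HL2 mer mu_tr).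
apply: (cvgr_to_ge cv); near=> J'.
have JJ' : (J <= J')%N by near: J'; exact: nbhs_infty_ge.
apply: le_trans (@energy_nd f _ _ JJ') _.
pose a := \sum_(j < J') coef P phi f j ^+ 2.
pose b := \sum_(j < J') coef P phi f j ^+ 2 / mu j.
pose m := n^-1 * (\sum_(s in B) fJ J' s ^+ 2).
have : - (energy f J' / 2) <= m - a.
  have := cross_le J' Hf gd; rewrite -emp_truncation ler_norml => /andP[+ _].
  by [].
have lb : lam * b <= lam * ip f f.
  by apply: ler_wpM2l; [exact: ltW|exact: (coef_bessel rk HL2 mer mu_tr J' Hf)].
have eE : energy f J' = a + lam * b.
  by rewrite /energy mulr_sumr -big_split/=; apply: eq_bigr => j _; ring.
rewrite -/m; lra.
Unshelve. all: by end_near. Qed.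

Local Notation ridge_basis := (ridge_basis K B x lam).

(** Self-bounding: the energy of [ridge_basis s] is at most a bound [b]
    proportional to its value at [x s], while the square of that value is at most
    [b] times the leverage of [x s]; this leaves [b <= 4 / n ^+ 2 * leverage]. *)
Lemma integral_ridge_basis_good s : s \in B -> good ->
  (\int[P]_y (ridge_basis s y ^+ 2)%:E <= (4 / n ^+ 2 * leverage (x s))%:E)%E.
Proof.
move=> sB gd; have Hg := ridge_basis_H rk B x lam s.
pose b := 2 * (n^-1 * ridge_basis s (x s)).
have eb J : energy (ridge_basis s) J <= b.
  by rewrite /b -(ridge_basis_energy psd rk x lam0 B0)//; exact: energy_le_emp.
have b0 : 0 <= b by apply: le_trans (eb 0%N); rewrite /energy big_ord0.
apply: le_trans (integral_sqr_le_energy Hg eb) _; rewrite lee_fin.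
have [->|bn0] := eqVneq b 0.
  by rewrite mulr_ge0 ?leverage_ge0// divr_ge0// exprn_ge0// ltW.
have bgt0 : 0 < b by rewrite lt0r bn0.
rewrite -(ler_pM2l bgt0).
have -> : b * b = 4 / n ^+ 2 * ridge_basis s (x s) ^+ 2.
  by rewrite /b; field; rewrite gt_eqF.
rewrite [leRHS]mulrCA; apply: ler_wpM2l; first by rewrite divr_ge0// exprn_ge0// ltW.
exact: eval_le_leverage.
Qed.

Lemma integral_ridge_basis s : s \in B ->
  (\int[P]_y (ridge_basis s y ^+ 2)%:E <= (tr / (n * lam))%:E)%E.
Proof.
move=> sB; have Hg := ridge_basis_H rk B x lam s.
apply: le_trans (integral_sqr_le_norm rk HL2 mer mu_tr Hg) _.
rewrite lee_fin; apply: ler_wpM2l; first exact: tr_ge0.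
exact: (ridge_basis_norm psd rk x lam0 B0).
Qed.

Section bias.
Variable f : T -> R.
Hypothesis Hf : H f.

Local Notation D := (ridge K B x lam (fun u => f (x u)) \- f).

Lemma integral_bias_good : good ->
  (\int[P]_y (D y ^+ 2)%:E <= (2 * (lam * ip f f))%:E)%E.
Proof.
move=> gd; have HD := ridge_bias_H rk B x lam Hf.
apply: (integral_sqr_le_energy HD) => J.
apply: le_trans (energy_le_emp J HD gd) _.
by rewrite ler_pM2l//; exact: (ridge_bias_energy psd rk x lam0 B0 Hf).
Qed.

Lemma integral_bias : (\int[P]_y (D y ^+ 2)%:E <= (tr * ip f f)%:E)%E.
Proof.
have HD := ridge_bias_H rk B x lam Hf.
apply: le_trans (integral_sqr_le_norm rk HL2 mer mu_tr HD) _.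
rewrite lee_fin; apply: ler_wpM2l; first exact: tr_ge0.
exact: (ridge_bias_norm psd rk x lam0 B0 Hf).
Qed.

End bias.

End good_event.

(** * Moments of sums of independent variables *)

Section scalar_inequalities.
Variable R : realType.
Implicit Types a b x y t p k : R.

(** Young's inequality for the product [x * 1], with exponents [p] and
    [p / (p - 1)]. *)
Lemma powR_bernoulli x p : 0 <= x -> 1 <= p -> 1 + p * (x - 1) <= x `^ p.
Proof.
move=> x0; rewrite le_eqVlt => /predU1P[<-|p1]; first by rewrite powRr1//; lra.
have p0 : 0 < p by lra.
have q0 : 0 < p / (p - 1) by rewrite divr_gt0//; lra.
have pq : p^-1 + (p / (p - 1))^-1 = 1.
  by field; rewrite !gt_eqF//; lra.
have := conjugate_powR x0 ler01 p0 q0 pq.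
rewrite powR1 mulr1 mul1r => h.
have := ler_wpM2l (ltW p0) h.
rewrite mulrDr mulrCA mulfV ?gt_eqF// mulr1.
have -> : p * (p / (p - 1))^-1 = p - 1.
  by field; rewrite !gt_eqF//; lra.
by lra.
Qed.

(** The tangent of the power at [y] lies below the power at 1. *)
Let powR_tangent1 y p : 0 < y -> 1 <= p -> y `^ p <= 1 + p * (y - 1) * y `^ (p - 1).
Proof.
move=> y0 p1; have yp : 0 < y `^ p by rewrite powR_gt0.
have yV0 : 0 <= y^-1 by rewrite invr_ge0 ltW.
have yVp : y^-1 `^ p = (y `^ p)^-1.
  by rewrite -powR_inv1 ?(ltW y0)// -powRrM mulN1r powRN.
have := ler_wpM2l (ltW yp) (powR_bernoulli yV0 p1); rewrite yVp mulfV ?gt_eqF//.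
have -> : y `^ (p - 1) = y `^ p / y.
  by rewrite powRB ?(lt0r_neq0 y0) ?implybT// powRr1// ltW.
have -> : y `^ p * (1 + p * (y^-1 - 1)) = y `^ p - p * (y - 1) * (y `^ p / y).
  by field; rewrite gt_eqF.
by lra.
Qed.

Lemma powR_taylor2_small t k : 2 <= k -> `|t| <= 2^-1 ->
  (1 + t) `^ k <= 1 + k * t + k * (k - 1) * 2 `^ k * t ^+ 2.
Proof.
move=> k2; rewrite ler_norml => /andP[t1 t2].
have y0 : 0 < 1 + t by lra.
have h := powR_tangent1 y0 (_ : 1 <= k); have {}h := h ltac:(lra).
apply: le_trans h _; rewrite (_ : 1 + t - 1 = t); last by ring.
rewrite -[leRHS]addrA lerD2l.
rewrite -mulrA -!mulrA -mulrDr ler_pM2l; last by lra.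
have one_le : 1 <= 2 `^ k :> R.
  by rewrite -[leLHS](powRr0 (2 : R)) ler_powR//; lra.
have [t0|t0] := leP 0 t.
  have h1 := powR_tangent1 y0 (_ : 1 <= k - 1); have {}h1 := h1 ltac:(lra).
  have h2 : (1 + t) `^ (k - 1 - 1) <= 2 `^ k.
    apply: le_trans (_ : (2 : R) `^ (k - 1 - 1) <= _).
      apply: ge0_ler_powR; rewrite ?nnegrE; lra.
    by apply: ler_powR; lra.
  have e : (1 + t) `^ (k - 1) <= 1 + (k - 1) * t * 2 `^ k.
    apply: le_trans h1 _; rewrite (_ : 1 + t - 1 = t) ?lerD2l; last by ring.
    by apply: ler_wpM2l => //; apply: mulr_ge0 => //; lra.
  apply: le_trans (ler_wpM2l t0 e) _.
  by rewrite le_eqVlt; apply/orP; left; apply/eqP; ring.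
have h1 : 1 + (k - 1) * t <= (1 + t) `^ (k - 1).
  have := @powR_bernoulli (1 + t) (k - 1) (ltW y0) ltac:(lra).
  by rewrite (_ : 1 + t - 1 = t)//; ring.
have h3 : t * (1 + t) `^ (k - 1) <= t * (1 + (k - 1) * t).
  by apply: ler_wnM2l => //; exact: ltW.
apply: le_trans h3 _.
have -> : t * (1 + (k - 1) * t) = t + (k - 1) * t ^+ 2 by ring.
rewrite lerD2l ler_wpM2l; [by []|lra|].
by rewrite ler_peMl ?sqr_ge0.
Qed.

Let taylor_cst k : R := 3 `^ k + 2 * k + k * (k - 1) * 2 `^ k.

Let powR_taylor2 t k : 2 <= k ->
  `|1 + t| `^ k <= 1 + k * t + taylor_cst k * (t ^+ 2 + `|t| `^ k).
Proof.
move=> k2.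
have c0 : 0 <= k * (k - 1) * 2 `^ k.
  by rewrite mulr_ge0 ?powR_ge0// mulr_ge0//; lra.
have c3 : (0 : R) <= 3 `^ k := powR_ge0 _ _.
have tk : 0 <= `|t| `^ k := powR_ge0 _ _.
have t2 := sqr_ge0 t.
have [ts|tb] := leP `|t| 2^-1.
  rewrite ger0_norm; last by move: ts; rewrite ler_norml => /andP[]; lra.
  apply: le_trans (powR_taylor2_small k2 ts) _; rewrite lerD2l /taylor_cst.
  have : 0 <= (3 `^ k + 2 * k) * (t ^+ 2 + `|t| `^ k).
    by apply: mulr_ge0; lra.
  have : 0 <= k * (k - 1) * 2 `^ k * `|t| `^ k by rewrite mulr_ge0.
  rewrite 2!mulrDl; lra.
have n1 : `|1 + t| <= 3 * `|t|.
  by apply: le_trans (ler_normD _ _) _; rewrite normr1; lra.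
have p1 : `|1 + t| `^ k <= 3 `^ k * `|t| `^ k.
  have t30 : 0 <= 3 * `|t| by rewrite mulr_ge0.
  by rewrite -powRM//; apply: ge0_ler_powR => //; lra.
have kt : - (k * t) <= 2 * k * t ^+ 2.
  have : `|t| <= 2 * `|t| ^+ 2 by rewrite expr2; nra.
  rewrite real_normK ?num_real// => tt.
  have : - t <= `|t| by rewrite lerNl lerNnormlW.
  nra.
have m1 : 0 <= 3 `^ k * t ^+ 2 by rewrite mulr_ge0.
have m2 : 0 <= 2 * k * `|t| `^ k by apply: mulr_ge0 => //; lra.
have m3 : 0 <= k * (k - 1) * 2 `^ k * t ^+ 2 by rewrite mulr_ge0.
have m4 : 0 <= k * (k - 1) * 2 `^ k * `|t| `^ k by rewrite mulr_ge0.
rewrite /taylor_cst; lra.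
Qed.

(** Either [n * b ^+ 2 <= a ^+ 2], and the first term dominates, or the second
    one does. *)
Let powR_young n a b k : 1 <= n -> 2 <= k ->
  `|a| `^ (k - 2) * b ^+ 2 <= n^-1 * `|a| `^ k + n `^ (k / 2 - 1) * `|b| `^ k.
Proof.
move=> n1 k2; have n0 : 0 < n by lra.
have sq c : `|c| `^ k = `|c| `^ (k - 2) * c ^+ 2.
  rewrite -(real_normK (num_real c)) -powR_mulrn//.
  have [->|c0] := eqVneq `|c| 0.
    by rewrite [in RHS](powR0 (_ : 2%:R != 0)) ?mulr0 ?powR0//; lra.
  by rewrite -powRD ?c0 ?implybT// subrK.
have pa := powR_ge0 `|a| (k - 2); have pb := powR_ge0 `|b| (k - 2).
have [ab|ab] := leP (n * b ^+ 2) (a ^+ 2).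
  apply: le_trans (_ : n^-1 * `|a| `^ k <= _); last first.
    by rewrite lerDl mulr_ge0 ?powR_ge0.
  rewrite sq [leRHS]mulrCA; apply: ler_wpM2l => //.
  by rewrite ler_pdivlMl.
apply: le_trans (_ : n `^ (k / 2 - 1) * `|b| `^ k <= _); last first.
  by rewrite lerDr mulr_ge0 ?powR_ge0// invr_ge0 ltW.
rewrite (sq b) mulrA; apply: ler_wpM2r; first exact: sqr_ge0.
have e c : `|c| `^ (k - 2) = (c ^+ 2) `^ (k / 2 - 1).
  by rewrite -(real_normK (num_real c)) -powR_mulrn// -powRrM; congr (_ `^ _); field.
rewrite !e -powRM ?sqr_ge0//; last exact: ltW.
apply: ge0_ler_powR; rewrite ?nnegrE ?sqr_ge0//; first by lra.
  by rewrite mulr_ge0 ?sqr_ge0// ltW.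
exact: ltW.
Qed.

Definition rosenthal_cst k : R := 2 * taylor_cst k.

Lemma rosenthal_cst_ge1 k : 2 <= k -> 1 <= rosenthal_cst k.
Proof.
move=> k2; rewrite /rosenthal_cst /taylor_cst.
have : (1 : R) <= 3 `^ k by rewrite -[leLHS](powRr0 (3 : R)) ler_powR//; lra.
have : 0 <= k * (k - 1) * 2 `^ k by rewrite mulr_ge0 ?powR_ge0// mulr_ge0//; lra.
by lra.
Qed.

(** One step of the recursion behind a Rosenthal-type inequality: in the
    expansion of [|a + b|^k] the term linear in [b] has mean zero when [b] is
    centred, and the weights let the step be iterated [n] times. *)
Lemma powR_add_le n k : 1 <= n -> 2 <= k -> exists kappa : R -> R, forall a b,
  `|a + b| `^ k <= (1 + rosenthal_cst k / n) * `|a| `^ k + kappa a * b +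
     rosenthal_cst k * n `^ (k / 2 - 1) * `|b| `^ k.
Proof.
move=> n1 k2; have n0 : 0 < n by lra.
exists (fun a => k * `|a| `^ k / a) => a b.
have c1 := rosenthal_cst_ge1 k2.
have nk : 1 <= n `^ (k / 2 - 1) by rewrite -[leLHS](powRr0 n) ler_powR//; lra.
have bk : 0 <= `|b| `^ k := powR_ge0 _ _.
have [->|a0] := eqVneq a 0.
  rewrite invr0 mulr0 mul0r addr0 add0r normr0 powR0 ?mulr0 ?add0r; last by lra.
  by rewrite ler_peMl// -[leLHS]mulr1; apply: ler_pM.
have ak : 0 < `|a| `^ k by rewrite powR_gt0// normr_gt0.
have := powR_taylor2 (b / a) k2 => h.
have {h} := ler_wpM2l (ltW ak) h.
have -> : `|a| `^ k * `|1 + b / a| `^ k = `|a + b| `^ k.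
  by rewrite -powRM// -normrM; congr (`|_| `^ _); field.
have -> : `|a| `^ k * (1 + k * (b / a) + taylor_cst k * ((b / a) ^+ 2 + `|b / a| `^ k))
  = `|a| `^ k + k * `|a| `^ k / a * b +
    taylor_cst k * (`|a| `^ (k - 2) * b ^+ 2 + `|b| `^ k).
  have -> : `|b| `^ k = `|a| `^ k * `|b / a| `^ k.
    by rewrite -powRM// -normrM; congr (`|_| `^ _); field.
  have -> : `|a| `^ (k - 2) * b ^+ 2 = `|a| `^ k * (b / a) ^+ 2.
    rewrite powRB ?normr_eq0 ?a0 ?implybT// powR_mulrn// real_normK ?num_real//.
    by field.
  by ring.
move=> h; apply: le_trans h _.
have t0 : 0 <= taylor_cst k by move: c1; rewrite /rosenthal_cst; lra.
have h1 := ler_wpM2l t0 (powR_young a b n1 k2).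
have h2 : taylor_cst k * `|b| `^ k <= taylor_cst k * (n `^ (k / 2 - 1) * `|b| `^ k).
  by apply: ler_wpM2l => //; rewrite ler_peMl.
have h3 : 0 <= taylor_cst k * (n^-1 * `|a| `^ k).
  by rewrite mulr_ge0// mulr_ge0 ?invr_ge0 ?(ltW n0) ?(ltW ak).
rewrite /rosenthal_cst; move: h1 h2 h3.
move: (taylor_cst k) (`|a| `^ k) (`|b| `^ k) (n `^ _) (`|a| `^ (k - 2) * _) (k * _ / a) (n^-1).
by move=> t A Bk np y z ni h1 h2 h3; nra.
Qed.

(** The linear term on the right has mean zero for a centred variable, which
    leaves a sub-Gaussian bound for its exponential moment. *)
Lemma expR_le_sqr x : expR x <= x + expR (2 * x ^+ 2).
Proof.
have [xs|xb] := leP x 2^-1; last first.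
  apply: le_trans (_ : expR (2 * x ^+ 2) <= _); last by rewrite lerDr; lra.
  by rewrite ler_expR expr2; nra.
apply: le_trans (_ : x + (1 + 2 * x ^+ 2) <= _); last first.
  by rewrite lerD2l expR_ge1Dx.
have h := expR_ge1Dx (- (x / 2)).
have y0 : 0 < 1 - x / 2 by lra.
have e2 : expR x * (expR (- (x / 2)) ^+ 2) = 1.
  have -> : expR (- (x / 2)) ^+ 2 = expR (- x).
    by rewrite -expRM_natl; congr (expR _); field.
  by rewrite -expRD subrr expR0.
have h2 : (1 - x / 2) ^+ 2 <= expR (- (x / 2)) ^+ 2.
  by rewrite ler_sqr ?nnegrE ?expR_ge0 ?(ltW y0).
have h3 : expR x * (1 - x / 2) ^+ 2 <= 1.
  by rewrite -[leRHS]e2; apply: ler_wpM2l => //; exact: expR_ge0.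
have q0 : 0 < (1 - x / 2) ^+ 2 by rewrite exprn_gt0.
rewrite -(ler_pM2r q0); apply: le_trans h3 _.
rewrite -subr_ge0.
have -> : (x + (1 + 2 * x ^+ 2)) * (1 - x / 2) ^+ 2 - 1 =
  x ^+ 2 * (5 / 4 - 7 / 4 * x + x ^+ 2 / 2) by field.
by rewrite mulr_ge0 ?sqr_ge0//; have := sqr_ge0 x; lra.
Qed.

Lemma sqr_powR_le_expR x t p : 0 < t -> 0 < p ->
  (x ^+ 2) `^ p <= ((2 * p / t) ^+ 2) `^ p * (expR (t * x) + expR (- t * x)).
Proof.
move=> t0 p0; have q0 : 0 < 2 * p / t by rewrite divr_gt0// mulr_gt0.
have h : `|x| <= 2 * p / t * expR (t * `|x| / (2 * p)).
  have := expR_ge1Dx (t * `|x| / (2 * p)) => h.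
  have {}h : t * `|x| / (2 * p) <= expR (t * `|x| / (2 * p)) by lra.
  apply: le_trans (ler_wpM2l (ltW q0) h); rewrite le_eqVlt; apply/orP; left.
  by apply/eqP; field; rewrite !gt_eqF.
have h2 : x ^+ 2 <= (2 * p / t) ^+ 2 * expR (t * `|x| / (2 * p)) ^+ 2.
  have b0 : 0 <= 2 * p / t * expR (t * `|x| / (2 * p)).
    by rewrite mulr_ge0 ?expR_ge0// ltW.
  by rewrite -exprMn -[leLHS](real_normK (num_real x)) ler_sqr ?nnegrE.
apply: le_trans (_ : ((2 * p / t) ^+ 2 * expR (t * `|x| / (2 * p)) ^+ 2) `^ p <= _).
  apply: ge0_ler_powR; rewrite ?nnegrE ?sqr_ge0 ?(ltW p0)//.
  by rewrite mulr_ge0 ?sqr_ge0.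
rewrite powRM ?sqr_ge0//; apply: ler_wpM2l; first exact: powR_ge0.
rewrite -expRM_natl -expRM (_ : _ * p = t * `|x|); last by field; rewrite gt_eqF.
have [x0|x0] := leP 0 x; first by rewrite (ger0_norm x0) lerDl expR_ge0.
by rewrite (ltr0_norm x0) mulrN mulNr lerDr expR_ge0.
Qed.

End scalar_inequalities.

Section moment_recursion.
Context (d d0 d1 : measure_display) (Z : measurableType d) (R : realType).
Context (Om0 : measurableType d0) (P0 : probability Om0 R).
Context (Om : measurableType d1) (Q : probability Om R).
Context (N : nat) (z0 : Om0 -> Z) (z : Om -> N.-tuple Z).
Hypotheses (mz0 : measurable_fun setT z0) (mz : measurable_fun setT z).
Hypothesis iid : forall B : 'I_N -> set Z, (forall i, measurable (B i)) ->
  (Q [set w | forall i, B i (tnth (z w) i)] =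
   \prod_(i < N) P0 [set w | B i (z0 w)])%E.
Variable f : Z -> R.
Hypothesis mf : measurable_fun setT f.
Hypothesis f_int : P0.-integrable setT (EFin \o (f \o z0)).
Hypothesis f_mean0 : (\int[P0]_v (f (z0 v))%:E = 0)%E.

Let measurable_sum_coord (l : seq 'I_N) :
  measurable_fun [set: N.-tuple Z] (fun t : N.-tuple Z => \sum_(s <- l) f (tnth t s)).
Proof.
by apply: measurable_sum => s; exact: (measurableT_comp mf (measurable_tnth s)).
Qed.

(** Observations are added one at a time: averaging over the last one kills the
    term linear in it. With [Phi] a power this yields a Rosenthal inequality, with
    [Phi] a sum of exponentials a sub-Gaussian bound. *)
Lemma moment_recursion (Phi : R -> R) (alpha beta : R) (kappa : R -> R) (b : Z -> R) :
  measurable_fun setT Phi -> (forall a, 0 <= Phi a) -> 1 <= alpha -> 0 <= beta ->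
  measurable_fun setT b -> (forall y, 0 <= b y) ->
  (\int[P0]_v (b (z0 v))%:E <= beta%:E)%E ->
  (forall a y, Phi (a + f y) <= alpha * Phi a + kappa a * f y + b y) ->
  forall l : seq 'I_N, uniq l ->
  (\int[Q]_w (Phi (\sum_(s <- l) f (tnth (z w) s)))%:E <=
   (alpha ^+ size l * (Phi 0 + (size l)%:R * beta))%:E)%E.
Proof.
move=> mPhi Phi0 alpha1 beta0 mb b0 b_beta step.
have mbz : measurable_fun setT (b \o z0) by exact: measurableT_comp.
have b_int : P0.-integrable setT (EFin \o (b \o z0)).
  apply/integrableP; split; first exact/measurable_EFinP.
  under eq_integral => v _ do rewrite /= ger0_norm//.
  exact: le_lt_trans b_beta (ltry _).
have inner a : (\int[P0]_v (Phi (a + f (z0 v)))%:E <= (alpha * Phi a + beta)%:E)%E.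
  apply: (@le_trans _ _
    (\int[P0]_v ((alpha * Phi a)%:E + ((kappa a * f (z0 v))%:E + (b (z0 v))%:E)))%E).
    apply: ge0_le_integral => //.
    - by move=> v _; rewrite lee_fin.
    - apply/measurable_EFinP; apply: measurableT_comp => //.
      by apply: measurable_funD => //; exact: measurableT_comp.
    - apply: emeasurable_funD => //; apply: emeasurable_funD.
        apply/measurable_EFinP; apply: measurable_funM => //.
        exact: measurableT_comp.
      exact/measurable_EFinP.
    - by move=> v _; rewrite -!EFinD lee_fin addrA; exact: step.
  have kf_int : P0.-integrable setT (fun v => (kappa a * f (z0 v))%:E).
    by have := integrableZl measurableT (kappa a) f_int.
  have cst_int : P0.-integrable setT (fun=> (alpha * Phi a)%:E).
    exact: finite_measure_integrable_cst.
  rewrite integralD//=; last by apply: integrableD.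
  rewrite integralD//=.
  have -> : (\int[P0]_v (kappa a * f (z0 v))%:E = 0)%E.
    by have := integralZl measurableT f_int (kappa a) => /= ->; rewrite f_mean0 mule0.
  rewrite add0e integral_cst//= probability_setT mule1 EFinD.
  exact: leeD.
elim => [_|s l IH].
  rewrite expr0 mul1r mul0r addr0.
  under eq_integral do rewrite big_nil.
  by rewrite integral_cst//= probability_setT mule1.
rewrite cons_uniq => /andP[sl /IH{}IH].
have mS (l' : seq 'I_N) : measurable_fun [set: N.-tuple Z]
    (fun t : N.-tuple Z => (Phi (\sum_(u <- l') f (tnth t u)))%:E).
  apply/measurable_EFinP; apply: measurableT_comp => //.
rewrite (ge0_integral_resample mz0 mz iid s (mS (s :: l))); last first.
  by move=> t; rewrite lee_fin.
apply: (@le_trans _ _ (\int[Q]_w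
   (alpha%:E * (Phi (\sum_(u <- l) f (tnth (z w) u)))%:E + beta%:E))%E).
  have sumE t v : \sum_(u <- s :: l) f (tnth (tuple_set t s (z0 v)) u) =
      \sum_(u <- l) f (tnth t u) + f (z0 v).
    rewrite big_cons tnth_tuple_set eqxx addrC; congr (_ + _).
    rewrite big_seq [in RHS]big_seq; apply: eq_bigr => u ul.
    by rewrite tnth_tuple_set; case: eqP => // us; move: sl; rewrite -us ul.
  apply: ge0_le_integral => //.
  - by move=> w _; apply: integral_ge0 => v _; rewrite lee_fin.
  - apply: (@measurable_fun_fubini_tonelli_F _ _ _ _ _ P0
      (fun p : Om * Om0 =>
        (Phi (\sum_(u <- s :: l) f (tnth (tuple_set (z p.1) s (z0 p.2)) u)))%:E)).
      apply: (measurableT_comp (mS (s :: l))).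
      by apply: measurable_tuple_set; exact: measurableT_comp.
    by move=> p; rewrite lee_fin.
  - apply: emeasurable_funD => //; apply: emeasurable_funM => //.
    exact: (measurableT_comp (mS l)).
  - move=> w _; under eq_integral do rewrite sumE.
    by rewrite -EFinM -EFinD; exact: inner.
rewrite ge0_integralD//; last 2 first.
- by move=> w _; rewrite -EFinM lee_fin mulr_ge0//; lra.
- by apply: emeasurable_funM => //; exact: (measurableT_comp (mS l)).
rewrite ge0_integralZl_EFin//; last 3 first.
- by move=> w _; rewrite lee_fin.
- exact: (measurableT_comp (mS l)).
- by lra.
rewrite integral_cst//= probability_setT mule1.
apply: (@le_trans _ _ (alpha%:E *
   (alpha ^+ size l * (Phi 0 + (size l)%:R * beta))%:E + beta%:E)%E).
  by apply: leeD => //; apply: lee_wpmul2l => //; rewrite lee_fin; lra.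
rewrite -EFinM -EFinD lee_fin /=.
have a1 : 1 <= alpha ^+ (size l).+1 by apply: exprn_ege1.
rewrite [leLHS](_ : _ = alpha ^+ (size l).+1 * (Phi 0 + (size l)%:R * beta) + beta).
  by rewrite -natr1 mulrDl mul1r addrA [leRHS]mulrDr lerD2l ler_peMl.
by rewrite exprS; ring.
Qed.

End moment_recursion.

Section sum_moments.
Context (d d0 d1 : measure_display) (Z : measurableType d) (R : realType).
Context (Om0 : measurableType d0) (P0 : probability Om0 R).
Context (Om : measurableType d1) (Q : probability Om R).
Context (N : nat) (z0 : Om0 -> Z) (z : Om -> N.-tuple Z).
Hypotheses (mz0 : measurable_fun setT z0) (mz : measurable_fun setT z).
Hypothesis iid : forall B : 'I_N -> set Z, (forall i, measurable (B i)) ->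
  (Q [set w | forall i, B i (tnth (z w) i)] =
   \prod_(i < N) P0 [set w | B i (z0 w)])%E.
Variable f : Z -> R.
Hypothesis mf : measurable_fun setT f.
Hypothesis f_int : P0.-integrable setT (EFin \o (f \o z0)).
Hypothesis f_mean0 : (\int[P0]_v (f (z0 v))%:E = 0)%E.
Variable B : {set 'I_N}.
Hypothesis B0 : (0 < #|B|)%N.

Let n : R := #|B|%:R.

Let n0 : 0 < n. Proof. by rewrite ltr0n. Qed.

Let S (w : Om) : R := \sum_(s in B) f (tnth (z w) s).

Let S_enum w : S w = \sum_(s <- enum B) f (tnth (z w) s).
Proof. by rewrite big_enum. Qed.

Let measurable_S : measurable_fun setT S.
Proof.
rewrite (_ : S = fun w => \sum_(s <- enum B) f (tnth (z w) s)); last first.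
  exact/funext/S_enum.
apply: measurable_sum => s; apply: (measurableT_comp mf).
exact: (measurableT_comp (measurable_tnth s)).
Qed.

Definition moment_cst (p : R) : R :=
  expR (rosenthal_cst (2 * p)) * rosenthal_cst (2 * p).

Lemma moment_cst_ge0 p : 1 <= p -> 0 <= moment_cst p.
Proof.
move=> p1; rewrite mulr_ge0 ?expR_ge0//.
by apply: le_trans (rosenthal_cst_ge1 (_ : 2 <= 2 * p)); lra.
Qed.

(** The step [powR_add_le] loses a factor [1 + c / n], so that [n] steps lose at
    most [expR c]. *)
Lemma sum_moment_power p tau : 1 <= p -> 0 <= tau ->
  (\int[P0]_v ((f (z0 v) ^+ 2) `^ p)%:E <= tau%:E)%E ->
  (\int[Q]_w ((S w ^+ 2) `^ p)%:E <= (moment_cst p * n `^ p * tau)%:E)%E.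
Proof.
move=> p1 tau0 f_tau.
have k2 : 2 <= 2 * p by lra.
have sqE x : (x ^+ 2) `^ p = `|x| `^ (2 * p).
  by rewrite -(real_normK (num_real x)) -powR_mulrn// -powRrM.
have n1 : 1 <= n by rewrite ler1n.
have [kappa kappaP] := powR_add_le n1 k2.
set c := rosenthal_cst (2 * p) in kappaP.
have c1 : 1 <= c by exact: rosenthal_cst_ge1.
pose b0 := c * n `^ (2 * p / 2 - 1).
have b00 : 0 <= b0 by rewrite mulr_ge0 ?powR_ge0//; lra.
under eq_integral do rewrite S_enum sqE.
have mpow : measurable_fun setT (fun x : R => `|x| `^ (2 * p)).
  by apply: (measurableT_comp (measurable_powR _)).
have := @moment_recursion _ _ _ Z R _ P0 _ Q N z0 z mz0 mz iid f mf f_int f_mean0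
  (fun a => `|a| `^ (2 * p)) (1 + c / n) (b0 * tau) kappa
  (fun y => b0 * `|f y| `^ (2 * p)) mpow (fun a => powR_ge0 _ _) _ _ _ _ _ _
  (enum B) (enum_uniq _).
rewrite -cardE -/n => main.
apply: le_trans (main _ _ _ _ _ _) _.
- by rewrite lerDl divr_ge0//; lra.
- exact: mulr_ge0.
- by apply: measurable_funM => //; exact: (measurableT_comp mpow).
- by move=> y; rewrite mulr_ge0 ?powR_ge0.
- under eq_integral do rewrite EFinM.
  rewrite ge0_integralZl_EFin//; last first.
    apply/measurable_EFinP; apply: (measurableT_comp mpow).
    exact: measurableT_comp.
  rewrite [leRHS]EFinM; apply: lee_wpmul2l; first by rewrite lee_fin.
  by under eq_integral do rewrite -sqE.
- by move=> a y; exact: kappaP.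
have q0 : 2 * p != 0 by rewrite gt_eqF//; lra.
rewrite lee_fin normr0 (powR0 q0) add0r.
have e1 : (1 + c / n) ^+ #|B| <= expR c.
  apply: le_trans (_ : expR (c / n) ^+ #|B| <= _).
    apply: lerXn2r; rewrite ?nnegrE ?expR_ge0 ?expR_ge1Dx//.
    by rewrite addr_ge0// divr_ge0//; lra.
  by rewrite -expRM_natr divfK// (lt0r_neq0 n0).
have np : n * n `^ (2 * p / 2 - 1) = n `^ p.
  rewrite -{1}(powRr1 (ltW n0)) -powRD ?(lt0r_neq0 n0) ?implybT//.
  by congr (_ `^ _); field.
rewrite [leRHS](_ : _ = expR c * (n * (b0 * tau))); last first.
  by rewrite /moment_cst /b0 -np -/c; ring.
apply: ler_wpM2r => //.
by rewrite mulr_ge0 ?(ltW n0)// mulr_ge0.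
Qed.

(** Sub-Gaussian moments of bounded variables; unlike in [sum_moment_power],
    the dependence on [p] is explicit, so that [p] may grow with the sample. *)
Lemma sum_moment_bounded p b : 1 <= p -> 0 < b -> (forall y, `|f y| <= b) ->
  (\int[Q]_w ((S w ^+ 2) `^ p)%:E <=
   (2 * (8 * expR 1 * p * b ^+ 2 * n) `^ p)%:E)%E.
Proof.
move=> p1 b0 fb.
have p0 : 0 < p by lra.
have nb0 : 0 < 2 * n * b ^+ 2 by rewrite mulr_gt0 ?mulr_gt0 ?exprn_gt0.
(* This [t] makes the [n]-th power of the growth factor [alpha] equal to
   [expR p], while [2 * p / t] is of order [sqrt (n * p) * b]. *)
pose t := Num.sqrt (p / (2 * n * b ^+ 2)).
have t2 : t ^+ 2 = p / (2 * n * b ^+ 2) by rewrite sqr_sqrtr// divr_ge0// ltW.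
have t0 : 0 < t by rewrite sqrtr_gt0 divr_gt0.
pose Phi a : R := expR (t * a) + expR (- t * a).
pose alpha := expR (2 * t ^+ 2 * b ^+ 2).
have mPhi : measurable_fun setT Phi.
  have mexp u : measurable_fun setT (fun a : R => expR (u * a)).
    apply: (@measurableT_comp _ _ _ _ _ _ expR _ (fun a : R => u * a)) => //.
    exact: measurable_funM.
  exact: measurable_funD.
have alpha1 : 1 <= alpha.
  rewrite /alpha -expR0 ler_expR mulr_ge0 ?sqr_ge0//.
  by rewrite mulr_ge0 ?sqr_ge0.
have step u a y : u ^+ 2 = t ^+ 2 -> `|y| <= b ->
    expR (u * (a + y)) <= alpha * expR (u * a) + u * expR (u * a) * y.
  move=> ut yb; rewrite mulrDr expRD.
  have := expR_le_sqr (u * y) => h.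
  have h2 : expR (2 * (u * y) ^+ 2) <= alpha.
    rewrite ler_expR exprMn ut -mulrA ler_pM2l// ler_wpM2l ?sqr_ge0//.
    by rewrite -(real_normK (num_real y)) ler_sqr ?nnegrE// ltW.
  have h3 : expR (u * y) <= u * y + alpha by lra.
  apply: le_trans (ler_wpM2l (expR_ge0 _) h3) _.
  by rewrite le_eqVlt; apply/orP; left; apply/eqP; ring.
have := @moment_recursion _ _ _ Z R _ P0 _ Q N z0 z mz0 mz iid f mf f_int f_mean0
  Phi alpha 0 (fun a => t * expR (t * a) + - t * expR (- t * a))
  (fun=> 0) mPhi (fun a => addr_ge0 (expR_ge0 _) (expR_ge0 _)) alpha1 (lexx _) _ _ _ _
  (enum B) (enum_uniq _).
rewrite -cardE -/n => main.
pose A := ((2 * p / t) ^+ 2) `^ p.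
apply: (@le_trans _ _ (\int[Q]_w (A%:E * (Phi (S w))%:E))%E).
  apply: ge0_le_integral => //.
  - by move=> w _; rewrite lee_fin powR_ge0.
  - apply/measurable_EFinP; apply: (measurableT_comp (measurable_powR _)).
    by apply: measurable_funX; exact: measurable_S.
  - apply: emeasurable_funM => //; apply/measurable_EFinP.
    exact: (measurableT_comp mPhi measurable_S).
  - by move=> w _; rewrite -EFinM lee_fin; exact: sqr_powR_le_expR.
rewrite ge0_integralZl_EFin ?powR_ge0//; last 2 first.
- by move=> w _; rewrite lee_fin addr_ge0 ?expR_ge0.
- apply/measurable_EFinP.
  exact: (measurableT_comp mPhi measurable_S).
apply: (@le_trans _ _ (A%:E * (alpha ^+ #|B| * 2)%:E)%E).
  apply: lee_wpmul2l; first by rewrite lee_fin powR_ge0.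
  under eq_integral do rewrite S_enum.
  apply: le_trans (main _ _ _ _) _ => //.
  - by under eq_integral do rewrite /=; rewrite integral0.
  - move=> a y; rewrite addr0 /Phi.
    have h1 := step t a (f y) erefl (fb y).
    have h2 := step (- t) a (f y) (sqrrN t) (fb y).
    apply: le_trans (lerD h1 h2) _.
    by rewrite le_eqVlt; apply/orP; left; apply/eqP; ring.
  by rewrite lee_fin mulr0 addr0 /Phi !mulr0 expR0.
rewrite -EFinM lee_fin.
have -> : alpha ^+ #|B| = expR 1 `^ p.
  rewrite -expRM mul1r -expRM_natr; congr expR; rewrite -/n t2.
  by field; rewrite ?(lt0r_neq0 n0) ?(lt0r_neq0 b0) ?(lt0r_neq0 p0).
have AE : A = (8 * p * b ^+ 2 * n) `^ p.
  rewrite /A; congr (_ `^ _). rewrite exprMn exprVn t2; field.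
  by rewrite ?(lt0r_neq0 n0) ?(lt0r_neq0 b0) ?(lt0r_neq0 p0).
have h8 : 0 <= 8 * p * b ^+ 2 * n.
  by rewrite mulr_ge0 ?(ltW n0)// mulr_ge0 ?sqr_ge0// mulr_ge0// ltW.
have -> : 8 * expR 1 * p * b ^+ 2 * n = (8 * p * b ^+ 2 * n) * expR 1 by ring.
rewrite AE (powRM _ h8 (expR_ge0 1)).
by rewrite le_eqVlt; apply/orP; left; apply/eqP; ring.
Qed.

End sum_moments.

(** * The probability of an ill-conditioned block *)

(** The power lies above its tangent at [(4 G)^-1], the value that the weighted
    mean of [x] is known to reach. *)
Lemma power_mean_large (R : realType) (I : finType) (a x : I -> R) (G p : R) :
  0 < G -> 1 <= p -> (forall i, 0 <= a i) -> (forall i, 0 <= x i) ->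
  \sum_i a i <= G -> 4^-1 <= \sum_i a i * x i ->
  1 <= (4 * G) `^ p / G * \sum_i a i * x i `^ p.
Proof.
move=> G0 p1 a0 x0 aG ax.
have G40 : 0 <= 4 * G by lra.
have h : G <= (4 * G) `^ p * \sum_i a i * x i `^ p.
  apply: le_trans (_ : \sum_i a i * (1 + p * (4 * G * x i - 1)) <= _); last first.
    rewrite mulr_sumr; apply: ler_sum => i _; rewrite mulrCA -powRM//.
    by apply: ler_wpM2l => //; apply: powR_bernoulli => //; exact: mulr_ge0.
  have -> : \sum_i a i * (1 + p * (4 * G * x i - 1)) =
     (1 - p) * \sum_i a i + p * (4 * G) * \sum_i a i * x i.
    by rewrite !mulr_sumr -big_split/=; apply: eq_bigr => i _; ring.
  have h1 : (1 - p) * G <= (1 - p) * \sum_i a i by apply: ler_wnM2l => //; lra.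
  have h2 : p * (4 * G) * 4^-1 <= p * (4 * G) * \sum_i a i * x i.
    by apply: ler_wpM2l => //; rewrite mulr_ge0//; lra.
  by lra.
by rewrite mulrAC ler_pdivlMr// mul1r.
Qed.

Section bad_event.
Context d (T : measurableType d) (R : realType) (P : probability T R)
  (K : T -> T -> R) (mu : nat -> R) (phi : nat -> T -> R) (lam gam : R).
Hypothesis mer : mercer_expansion P K mu phi.
Hypothesis lam0 : 0 < lam.
Hypothesis gam0 : 0 < gam.
Hypothesis shrink_gam : forall J, \sum_(j < J) shrink mu lam j <= gam.
Context d1 (Om : measurableType d1) (Q : probability Om R) (N : nat)
  (x : Om -> 'I_N -> T) (B : {set 'I_N}).
Hypothesis mx : forall s, measurable_fun setT (x ^~ s).

Local Notation dev w i j := (cov_dev phi B (x w) i j).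

Lemma measurable_cov_dev i j : measurable_fun setT (fun w => dev w i j).
Proof.
apply: measurable_funM => //.
rewrite (_ : (fun w => _) = fun w => \sum_(s <- enum B)
    (phi i (x w s) * phi j (x w s) - (i == j)%:R)); last first.
  by apply/funext => w; rewrite big_enum.
apply: measurable_sum => s; apply: measurable_funB => //.
by apply: measurable_funM; apply: (measurableT_comp (measurable_phi mer _)).
Qed.

Let bad J := [set w | 4^-1 < cov_dev_norm mu phi lam B (x w) J].

Let measurable_norm J :
  measurable_fun setT (fun w => cov_dev_norm mu phi lam B (x w) J).
Proof.
apply: measurable_sum => i; apply: measurable_sum => j; apply: measurable_funM => //.
by apply: measurable_funX; exact: measurable_cov_dev.
Qed.

Let measurable_bad J : measurable (bad J).
Proof.
rewrite (_ : bad J = setT `&`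
   (fun w => cov_dev_norm mu phi lam B (x w) J) @^-1` `]4^-1, +oo[%classic).
  exact: measurable_norm.
by apply/seteqP; split => w /=; rewrite /bad/= in_itv/= andbT => // -[].
Qed.

Let not_goodE : [set w | ~ good mu phi lam B (x w)] = \bigcup_J bad J.
Proof.
apply/seteqP; split => w /=.
  by move=> /existsNP[J /negP]; rewrite -ltNge => hJ; exists J.
by move=> [J _]; rewrite /bad/= => hJ /(_ J); rewrite leNgt hJ.
Qed.

Lemma measurable_not_good : measurable [set w | ~ good mu phi lam B (x w)].
Proof. by rewrite not_goodE; exact: bigcup_measurable. Qed.

Let norm_nd w : nondecreasing_seq (fun J => cov_dev_norm mu phi lam B (x w) J).
Proof.
apply/nondecreasing_seqP => J; rewrite /cov_dev_norm big_ord_recr/=.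
have t0 i j : 0 <= shrink mu lam i * shrink mu lam j * dev w i j ^+ 2.
  by rewrite mulr_ge0 ?sqr_ge0// mulr_ge0// (shrink_ge0 mer).
apply: ler_wpDr; first by apply: sumr_ge0 => j _.
by apply: ler_sum => i _; rewrite big_ord_recr/= lerDl.
Qed.

(** Markov's inequality, where convexity against the weights [shrink i * shrink j], of
    total mass at most [gam ^+ 2], reduces the [p]-th power of the weighted norm to
    powers of the single entries. *)
Lemma not_good_prob p L : 1 <= p -> 0 <= L ->
  (forall i j, \int[Q]_w ((dev w i j ^+ 2) `^ p)%:E <= L%:E)%E ->
  (Q [set w | ~ good mu phi lam B (x w)] <= ((4 * gam ^+ 2) `^ p * L)%:E)%E.
Proof.
move=> p1 L0 devL.
have G0 : 0 < gam ^+ 2 by rewrite exprn_gt0.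
have wt0 := shrink_ge0 mer lam0.
have badJ J : (Q (bad J) <= ((4 * gam ^+ 2) `^ p * L)%:E)%E.
  pose a (q : 'I_J * 'I_J) := shrink mu lam q.1 * shrink mu lam q.2.
  have a0 q : 0 <= a q by rewrite mulr_ge0.
  have aG : \sum_q a q <= gam ^+ 2.
    rewrite -(pair_big xpredT xpredT (fun i j : 'I_J => shrink mu lam i * shrink mu lam j))/=.
    have s0 : 0 <= \sum_(j < J) shrink mu lam j by apply: sumr_ge0.
    apply: le_trans (_ : (\sum_(j < J) shrink mu lam j) ^+ 2 <= _).
      by rewrite expr2 mulr_suml; apply: ler_sum => i _; rewrite mulr_sumr.
    by rewrite ler_sqr ?nnegrE ?shrink_gam// ltW.
  pose c := (4 * gam ^+ 2) `^ p / gam ^+ 2.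
  have c0 : 0 <= c by rewrite divr_ge0 ?powR_ge0// ltW.
  have mdev (q : 'I_J * 'I_J) :
      measurable_fun setT (fun w => ((dev w q.1 q.2 ^+ 2) `^ p)%:E).
    apply/measurable_EFinP; apply: (measurableT_comp (measurable_powR _)).
    by apply: measurable_funX; exact: measurable_cov_dev.
  have -> : Q (bad J) = (\int[Q]_w (\1_(bad J) w)%:E)%E.
    by rewrite integral_indic ?setIT//; exact: measurable_bad.
  apply: (@le_trans _ _ (\int[Q]_w
     (c%:E * \sum_(q : 'I_J * 'I_J) ((a q)%:E * ((dev w q.1 q.2 ^+ 2) `^ p)%:E)))%E).
    apply: ge0_le_integral => //.
    - by apply/measurable_EFinP; apply: measurable_indic; exact: measurable_bad.
    - apply: emeasurable_funM => //; apply: emeasurable_sum => q.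
      exact: emeasurable_funM.
    - move=> w _; have -> : (\sum_(q : 'I_J * 'I_J)
         ((a q)%:E * ((dev w q.1 q.2 ^+ 2) `^ p)%:E))%E =
         (\sum_q a q * (dev w q.1 q.2 ^+ 2) `^ p)%:E.
        by rewrite -sumEFin.
      rewrite -EFinM lee_fin indicE; have [wb|_] := boolP (w \in bad J); last first.
        rewrite mulr_ge0//; apply: sumr_ge0 => q _.
        by rewrite mulr_ge0 ?powR_ge0.
      apply: power_mean_large => //; first by move=> q; exact: sqr_ge0.
      move: wb; rewrite inE /bad/= /cov_dev_norm pair_big/= => /ltW.
      by [].
  rewrite ge0_integralZl_EFin//; last 2 first.
  - move=> w _; apply: sume_ge0 => q _.
    by rewrite -EFinM lee_fin mulr_ge0 ?powR_ge0.
  - by apply: emeasurable_sum => q; exact: emeasurable_funM.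
  rewrite ge0_integral_sum//; last 2 first.
  - by move=> q; exact: emeasurable_funM.
  - by move=> q w _; rewrite -EFinM lee_fin mulr_ge0 ?powR_ge0.
  apply: (@le_trans _ _ (c%:E * \sum_(q : 'I_J * 'I_J) ((a q)%:E * L%:E))%E).
    apply: lee_wpmul2l => //; apply: lee_sum => q _.
    rewrite ge0_integralZl_EFin//; last by move=> w _; rewrite lee_fin powR_ge0.
    by apply: lee_wpmul2l; rewrite ?lee_fin.
  rewrite -ge0_sume_distrl; last by move=> q _; rewrite lee_fin.
  rewrite sumEFin -!EFinM lee_fin /c.
  rewrite mulrA; apply: ler_wpM2r => //.
  rewrite -mulrA -[leRHS]mulr1; apply: ler_wpM2l; first exact: powR_ge0.
  by rewrite ler_pdivrMl// mulr1.
rewrite not_goodE.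
have cv : Q \o bad @ \oo --> Q (\bigcup_J bad J).
  apply: nondecreasing_cvg_mu => //; first exact: bigcup_measurable.
  move=> J J' JJ'; apply/subsetPset => w; rewrite /bad/= => h.
  by apply: lt_le_trans h _; exact: norm_nd.
by apply: (cvge_to_le cv); apply: nearW => J; exact: badJ.
Qed.

End bad_event.

(** * Noise that is centred given the design *)

Section weighted_comparison.
Context (d0 d : measure_display) (Om0 : measurableType d0) (T : measurableType d).
Context (R : realType) (P0 : {measure set Om0 -> \bar R}) (X : Om0 -> T).
Hypothesis mX : measurable_fun setT X.

Import HBNNSimple.

Let measurable_preimage_X A : measurable A -> measurable (X @^-1` A).
Proof. by move=> mA; rewrite -[X in measurable X]setTI; exact: mX. Qed.

Let ge0_integral_nnsfun_weight (f : Om0 -> R) (g : {nnsfun T >-> R})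
    (s := fset_set (range g)) : measurable_fun setT f -> (forall w, 0 <= f w) ->
  (\int[P0]_w (g (X w) * f w)%:E =
   \sum_(i < #|`s|) (s`_i)%:E * \int[P0]_(w in X @^-1` (g @^-1` [set s`_i])) (f w)%:E)%E.
Proof.
move=> mf f0.
have s0 (i : 'I_#|`s|) : 0 <= s`_i.
  have : s`_i \in s by apply: mem_nth; exact: ltn_ord.
  by rewrite in_fset_set// inE/= => -[y _ <-].
pose A i := X @^-1` (g @^-1` [set s`_i]).
have mA i : measurable (A i) by exact: measurable_preimage_X.
have mterm i : measurable_fun setT (fun w => (\1_(A i) w * f w)%:E).
  by apply/measurable_EFinP; apply: measurable_funM => //; exact: measurable_indic.
have t0 i w : (0 <= (\1_(A i) w * f w)%:E)%E by rewrite lee_fin mulr_ge0.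
transitivity (\int[P0]_w (\sum_(i < #|`s|) ((s`_i)%:E * (\1_(A i) w * f w)%:E)))%E.
  apply: eq_integral => w _; rewrite sumEFin fimfunEord mulr_suml; congr (_%:E).
  by apply: eq_bigr => i _; rewrite mulrA.
rewrite ge0_integral_sum//; last 2 first.
- by move=> i; apply: emeasurable_funM.
- by move=> i w _; rewrite mule_ge0// lee_fin.
apply: eq_bigr => i _; rewrite ge0_integralZl//; last by rewrite lee_fin.
congr (_ * _)%E; rewrite [RHS]integral_mkcond; apply: eq_integral => w _.
by rewrite patchE indicE; case: ifP; rewrite ?mul1r ?mul0r.
Qed.

(** Approximation of the weight by simple functions: this replaces the rules of
    conditional expectation, which is only given through its integrals over the
    events of [X]. *)
Lemma ge0_le_integral_weight (f1 f2 : Om0 -> R) (G : T -> R) :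
  measurable_fun setT f1 -> measurable_fun setT f2 ->
  (forall w, 0 <= f1 w) -> (forall w, 0 <= f2 w) ->
  (forall A, measurable A ->
     \int[P0]_(w in X @^-1` A) (f1 w)%:E <= \int[P0]_(w in X @^-1` A) (f2 w)%:E)%E ->
  measurable_fun setT G -> (forall x, 0 <= G x) ->
  (\int[P0]_w (G (X w) * f1 w)%:E <= \int[P0]_w (G (X w) * f2 w)%:E)%E.
Proof.
move=> mf1 mf2 f10 f20 f12 mG G0.
have mGE : measurable_fun setT (EFin \o G) by exact/measurable_EFinP.
pose g := nnsfun_approx measurableT mGE.
have gG x : (g n x)%:E @[n --> \oo] --> (G x)%:E.
  by apply: (cvg_nnsfun_approx measurableT mGE) => // y _; rewrite lee_fin.
have int_cvg (f : Om0 -> R) : measurable_fun setT f -> (forall w, 0 <= f w) ->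
    (\int[P0]_w (g n (X w) * f w)%:E)%E @[n --> \oo] -->
    (\int[P0]_w (G (X w) * f w)%:E)%E.
  move=> mf f0.
  have -> : (\int[P0]_w (G (X w) * f w)%:E =
      \int[P0]_w limn (fun n => (g n (X w) * f w)%:E))%E.
    apply: eq_integral => w _; apply/esym/cvg_lim => //.
    under eq_fun do rewrite EFinM.
    by rewrite EFinM; apply: cvgeZr => //; exact: gG.
  apply: (@cvg_monotone_convergence _ _ _ P0 setT measurableT
    (fun n w => (g n (X w) * f w)%:E)) => //.
  - move=> n; apply/measurable_EFinP; apply: measurable_funM => //.
    exact: measurableT_comp.
  - by move=> n w _; rewrite lee_fin mulr_ge0.
  - move=> w _ m n mn; rewrite lee_fin ler_wpM2r//.
    exact/lefP/nd_nnsfun_approx.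
rewrite -(cvg_lim (@ereal_hausdorff R) (int_cvg f1 mf1 f10)).
rewrite -(cvg_lim (@ereal_hausdorff R) (int_cvg f2 mf2 f20)).
apply: lee_lim; [exact: cvgP (int_cvg f1 mf1 f10)|exact: cvgP (int_cvg f2 mf2 f20)|].
apply: nearW => n; rewrite !ge0_integral_nnsfun_weight//.
apply: lee_sum => i _; apply: lee_wpmul2l; last by apply: f12; exact: measurable_sfunP.
have : (fset_set (range (g n)))`_i \in fset_set (range (g n)).
  by apply: mem_nth; exact: ltn_ord.
by rewrite in_fset_set// inE/= lee_fin => -[y _ <-].
Qed.

End weighted_comparison.

Section noise.
Context (d0 d : measure_display) (Om0 : measurableType d0) (T : measurableType d)
  (R : realType) (P0 : probability Om0 R) (X : {RV P0 >-> T}) (Y : {RV P0 >-> R})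
  (fstar : T -> R) (sigma : R).
Hypothesis fstar_L2 : fstar \in Lfun (distribution P0 X) 2%:E.
Hypothesis fstar_cond : is_cond_expectation X Y fstar.
Hypothesis noise_cond : exists2 v : T -> R,
  is_cond_expectation X (fun w => (Y w - fstar (X w)) ^+ 2) v &
  forall x, v x <= sigma ^+ 2.

Let e (w : Om0) : R := Y w - fstar (X w).

Let mX : measurable_fun setT X. Proof. exact: measurable_funP. Qed.

Let mfstar : measurable_fun setT fstar. Proof. exact: Lfun2_measurable fstar_L2. Qed.

Let me_ : measurable_fun setT e.
Proof. by apply: measurable_funB => //; exact: measurableT_comp. Qed.

Let measurable_preimage_X A : measurable A -> measurable (X @^-1` A).
Proof. by move=> mA; rewrite -[X in measurable X]setTI; exact: mX. Qed.

Let e2_int : P0.-integrable setT (fun w => (e w ^+ 2)%:E).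
Proof. by have [v [+ _ _] _] := noise_cond. Qed.

Let e_int : P0.-integrable setT (EFin \o e).
Proof.
have [Yint _ _] := fstar_cond.
have fint : P0.-integrable setT (EFin \o (fstar \o X)).
  have : (distribution P0 X).-integrable setT (EFin \o fstar).
    by apply/Lfun1_integrable; apply: Lfun_subset12 fstar_L2; exact: fin_num_measure.
  move=> /integrableP[mf fi]; apply/integrableP; split.
    exact: (measurableT_comp mf mX).
  by move: fi; rewrite ge0_integral_distribution//; exact: measurableT_comp.
rewrite (_ : EFin \o e = (EFin \o Y) \- (EFin \o (fstar \o X)))%E.
  exact: integrableB.
by apply/funext => w.
Qed.

Let integral_e A : measurable A -> (\int[P0]_(w in X @^-1` A) (e w)%:E = 0)%E.
Proof.
move=> mA; have mXA := measurable_preimage_X mA.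
have [Yint _ Yf] := fstar_cond.
have fint : P0.-integrable setT (EFin \o (fstar \o X)).
  rewrite (_ : EFin \o _ = (EFin \o Y) \- (EFin \o e))%E; first exact: integrableB.
  by apply/funext => w; rewrite /e/= -EFinB; congr (_%:E); ring.
have iS f : P0.-integrable setT f -> P0.-integrable (X @^-1` A) f.
  by move=> fi; apply: integrableS fi.
have fE : (\int[distribution P0 X]_(x in A) (fstar x)%:E =
    \int[P0]_(w in X @^-1` A) (fstar (X w))%:E)%E.
  rewrite /distribution integral_pushforward//; last exact: iS fint.
  exact/measurable_EFinP.
under eq_integral do rewrite EFinB.
rewrite (integralB mXA (iS _ Yint) (iS _ fint)) Yf//= fE subee//.
exact: (integrable_fin_num mXA (iS _ fint)).
Qed.

Let e_pos w : R := Num.max (e w) 0.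
Let e_neg w : R := Num.max (- e w) 0.

Let e_parts w : e w = e_pos w - e_neg w.
Proof.
rewrite /e_pos /e_neg; have [h|h] := leP (e w) 0; have [h'|h'] := leP (- e w) 0; lra.
Qed.

Let e_pos_ge0 w : 0 <= e_pos w. Proof. by rewrite /e_pos le_max lexx orbT. Qed.
Let e_neg_ge0 w : 0 <= e_neg w. Proof. by rewrite /e_neg le_max lexx orbT. Qed.

Let e_pos_le w : e_pos w <= `|e w|.
Proof. by rewrite /e_pos ge_max ler_norm normr_ge0. Qed.
Let e_neg_le w : e_neg w <= `|e w|.
Proof. by rewrite /e_neg ge_max -normrN ler_norm normr_ge0. Qed.

Let me_pos : measurable_fun setT e_pos.
Proof. by apply: measurable_maxr. Qed.
Let me_neg : measurable_fun setT e_neg.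
Proof. by apply: measurable_maxr => //; exact: measurableT_comp. Qed.

Let part_int (f : Om0 -> R) : measurable_fun setT f -> (forall w, 0 <= f w) ->
  (forall w, f w <= `|e w|) -> P0.-integrable setT (EFin \o f).
Proof.
move=> mf f0 fe; apply: le_integrable (e_int) => //; first exact/measurable_EFinP.
by move=> w _; rewrite /= lee_fin ger0_norm.
Qed.

Let integral_parts A : measurable A ->
  (\int[P0]_(w in X @^-1` A) (e_pos w)%:E = \int[P0]_(w in X @^-1` A) (e_neg w)%:E)%E.
Proof.
move=> mA; have mXA := measurable_preimage_X mA.
have ip := integrableS measurableT mXA (@subsetT _ _) (part_int me_pos e_pos_ge0 e_pos_le).
have iN := integrableS measurableT mXA (@subsetT _ _) (part_int me_neg e_neg_ge0 e_neg_le).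
have := integral_e mA.
under eq_integral do rewrite e_parts EFinB.
rewrite (integralB mXA ip iN)/= => /eqP; rewrite sube_eq ?add0e.
- by move/eqP.
- exact: (integrable_fin_num mXA ip).
- by rewrite fin_num_adde_defl//; exact: (integrable_fin_num mXA iN).
Qed.

(** The positive and negative parts of the noise have the same integral over every
    event of [X], hence against every nonnegative bounded function of [X]. *)
Lemma noise_orth (G : T -> R) (M : R) : measurable_fun setT G ->
  (forall x, `|G x| <= M) -> (\int[P0]_w (G (X w) * e w)%:E = 0)%E.
Proof.
have ge0case (G' : T -> R) M' : measurable_fun setT G' -> (forall x, 0 <= G' x) ->
    (forall x, G' x <= M') ->
    P0.-integrable setT (fun w => (G' (X w) * e w)%:E) /\
    (\int[P0]_w (G' (X w) * e w)%:E = 0)%E.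
  move=> mG' G'0 G'M.
  have M'0 : 0 <= M' by apply: le_trans (G'0 (X point)) (G'M _).
  have mGX : measurable_fun setT (G' \o X) by exact: measurableT_comp.
  have wint (f : Om0 -> R) : measurable_fun setT f -> (forall w, `|f w| <= `|e w|) ->
      P0.-integrable setT (fun w => (G' (X w) * f w)%:E).
    move=> mf fe; have := integrableZl measurableT M' e_int.
    apply: le_integrable => //.
      by apply/measurable_EFinP; exact: measurable_funM.
    move=> w _; rewrite /= lee_fin !normrM (ger0_norm (G'0 _)) (ger0_norm M'0).
    exact: ler_pM.
  split; first exact: wint.
  have ip : P0.-integrable setT (fun w => (G' (X w) * e_pos w)%:E).
    by apply: wint => // w; rewrite ger0_norm.
  have iN : P0.-integrable setT (fun w => (G' (X w) * e_neg w)%:E).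
    by apply: wint => // w; rewrite ger0_norm.
  under eq_integral do rewrite e_parts mulrBr EFinB.
  rewrite (integralB measurableT ip iN).
  have -> : (\int[P0]_w (G' (X w) * e_pos w)%:E = \int[P0]_w (G' (X w) * e_neg w)%:E)%E.
    apply/eqP; rewrite eq_le; apply/andP; split; apply: ge0_le_integral_weight => // A mA;
      by rewrite integral_parts.
  by rewrite subee//; exact: (integrable_fin_num measurableT iN).
move=> mG GM.
have M0 : 0 <= M by apply: le_trans (normr_ge0 (G (X point))) (GM _).
have GM2 x : 0 <= G x + M /\ G x + M <= M + M.
  by have := GM x; rewrite ler_norml => /andP[? ?]; split; lra.
have [i1 E1] := ge0case (fun x => G x + M) (M + M)
  (measurable_funD mG (measurable_cst M)) (fun x => (GM2 x).1) (fun x => (GM2 x).2).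
have [i2 E2] := ge0case (fun=> M) M (measurable_cst M) (fun=> M0) (fun=> lexx M).
rewrite (eq_integral (fun w => ((G (X w) + M) * e w)%:E - (M * e w)%:E)%E); last first.
  by move=> w _; rewrite -EFinB; congr (_%:E); ring.
by rewrite (integralB measurableT i1 i2) E1 E2 subee.
Qed.

Lemma noise_var (G : T -> R) : measurable_fun setT G -> (forall x, 0 <= G x) ->
  (\int[P0]_w (G (X w) * e w ^+ 2)%:E <= \int[P0]_w (G (X w) * sigma ^+ 2)%:E)%E.
Proof.
move=> mG G0; apply: (ge0_le_integral_weight mX) => //.
- exact: measurable_funX.
- by move=> w; exact: sqr_ge0.
- by move=> w; exact: sqr_ge0.
move=> A mA; have mXA := measurable_preimage_X mA.
have [v [_ mv vE] v_le] := noise_cond.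
rewrite vE// [leLHS]integralE.
apply: (@le_trans _ _ (\int[distribution P0 X]_(x in A) (EFin \o v)^\+ x)%E).
  by rewrite -[leRHS]sube0; apply: leeB => //; apply: integral_ge0.
apply: (@le_trans _ _ (\int[distribution P0 X]_(x in A) (sigma ^+ 2)%:E)%E).
  apply: ge0_le_integral => //.
    by apply: measurable_funepos; apply/measurable_EFinP; exact: measurable_funTS.
  by move=> x _; rewrite funeposE/= -EFin_max lee_fin ge_max v_le sqr_ge0.
by rewrite /distribution ge0_integral_pushforward// => x _; rewrite lee_fin sqr_ge0.
Qed.

Context d1 (Om : measurableType d1) (Q : probability Om R) (N : nat)
  (z : Om -> N.-tuple (T * R)).

Let z0 (v : Om0) : T * R := (X v, Y v).

Hypothesis mz : measurable_fun setT z.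
Hypothesis iid : forall B : 'I_N -> set (T * R), (forall i, measurable (B i)) ->
  (Q [set w | forall i, B i (tnth (z w) i)] =
   \prod_(i < N) P0 [set w | B i (z0 w)])%E.

Let mz0 : measurable_fun setT z0. Proof. exact: measurable_fun_pair. Qed.

Definition design_only (h : N.-tuple (T * R) -> R) : Prop :=
  forall t t', (forall u, (tnth t u).1 = (tnth t' u).1) -> h t = h t'.

Variables (h : 'I_N -> N.-tuple (T * R) -> R) (M : R).
Hypothesis mh : forall s, measurable_fun [set: N.-tuple (T * R)] (h s).
Hypothesis h_design : forall s, design_only (h s).
Hypothesis h_bounded : forall s t, `|h s t| <= M.

Definition residual (y : T * R) : R := y.2 - fstar y.1.

Let residual_z0 v : residual (z0 v) = e v. Proof. by []. Qed.

Let measurable_residual : measurable_fun setT residual.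
Proof. by apply: measurable_funB => //; exact: measurableT_comp. Qed.

Let r s (t : N.-tuple (T * R)) : R := residual (tnth t s).

Let mr s : measurable_fun [set: N.-tuple (T * R)] (r s).
Proof. exact: (measurableT_comp measurable_residual (measurable_tnth s)). Qed.

(** A coefficient does not see the response drawn at [u]. *)
Let h_tuple_set s u t v : h s (tuple_set t u (z0 v)) = h s (tuple_set t u (X v, 0)).
Proof. by apply: h_design => i; rewrite !tnth_tuple_set; case: ifP. Qed.

Let measurable_h_tuple_set s u t : measurable_fun setT (fun x : T => h s (tuple_set t u (x, 0))).
Proof.
by apply: (measurableT_comp (mh s)); apply: measurable_tuple_set.
Qed.

Let M_ge0 (s : 'I_N) : 0 <= M.
Proof. by apply: le_trans (normr_ge0 (h s (z point))) (h_bounded _ _). Qed.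

Let F s u t : R := h s t * h u t * (r s t * r u t).

Let mF s u : measurable_fun [set: N.-tuple (T * R)] (F s u).
Proof. by apply: measurable_funM; apply: measurable_funM. Qed.

Let integral_r2 s : (\int[Q]_w (r s (z w) ^+ 2)%:E = \int[P0]_v (e v ^+ 2)%:E)%E.
Proof.
apply: (ge0_integral_coord mz0 mz iid s (f := fun y => (residual y ^+ 2)%:E)).
  by apply/measurable_EFinP; exact: measurable_funX.
by move=> y; rewrite lee_fin sqr_ge0.
Qed.

Let r2_int s : Q.-integrable setT (fun w => (r s (z w) ^+ 2)%:E).
Proof.
apply/integrableP; split.
  by apply/measurable_EFinP; apply: measurable_funX; exact: (measurableT_comp (mr s)).
under eq_integral => w _ do rewrite /= ger0_norm ?sqr_ge0//.
by rewrite integral_r2; exact: (integrable_lty measurableT e2_int).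
Qed.

Let F_int s u : Q.-integrable setT (fun w => (F s u (z w))%:E).
Proof.
have := integrableZl measurableT (M ^+ 2) (integrableD measurableT (r2_int s) (r2_int u)).
apply: le_integrable => //.
  by apply/measurable_EFinP; exact: (measurableT_comp (mF s u)).
move=> w _; rewrite /= lee_fin.
have M0 := M_ge0 s.
rewrite /F [leRHS]ger0_norm; last first.
  by rewrite mulr_ge0 ?sqr_ge0// addr_ge0 ?sqr_ge0.
rewrite !normrM.
apply: ler_pM; [by rewrite mulr_ge0|by rewrite mulr_ge0| |].
  by rewrite expr2; apply: ler_pM.
rewrite -(real_normK (num_real (r s (z w)))) -(real_normK (num_real (r u (z w)))).
have := normr_ge0 (r s (z w)); have := normr_ge0 (r u (z w)).
move: `|_| `|_| => a b a0 b0.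
by have := sqr_ge0 (a - b); rewrite !expr2; nra.
Qed.

(** Redrawing the observation [s] leaves a bounded function of the new design
    point times its noise. *)
Let F_off s u : s != u -> (\int[Q]_w (F s u (z w))%:E = 0)%E.
Proof.
move=> su.
have mFE : measurable_fun [set: N.-tuple (T * R)] (fun t => (F s u t)%:E).
  by apply/measurable_EFinP; exact: mF.
have mFp : measurable_fun setT (fun p : Om * Om0 => (F s u (tuple_set (z p.1) s (z0 p.2)))%:E).
  apply: (measurableT_comp mFE).
  by apply: measurable_tuple_set; exact: measurableT_comp.
have pint : (Q \x P0)%E.-integrable setT
    (fun p : Om * Om0 => (F s u (tuple_set (z p.1) s (z0 p.2)))%:E).
  apply/integrableP; split => //.
  rewrite -(integral_resample_prod mz0 mz iid s (F := fun t => `|(F s u t)%:E|%E)).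
    by have /integrableP[] := F_int s u.
  exact: measurableT_comp.
rewrite (integral_resample_prod mz0 mz iid s mFE) -integral12_prod_meas1//.
rewrite /fubini_F; apply: integral0_eq => w _.
pose G x := h s (tuple_set (z w) s (x, 0)) * h u (tuple_set (z w) s (x, 0)) * r u (z w).
rewrite (eq_integral (fun v => (G (X v) * e v)%:E)); last first.
  move=> v _; congr (_%:E); rewrite /F /G !h_tuple_set /r !tnth_tuple_set eqxx.
  by rewrite eq_sym (negPf su) residual_z0; ring.
apply: (@noise_orth _ (M * M * `|r u (z w)|)).
  by apply: measurable_funM => //; exact: measurable_funM.
move=> x; rewrite /G !normrM; apply: ler_wpM2r => //.
by apply: ler_pM.
Qed.

Let F_diag s :
  (\int[Q]_w (F s s (z w))%:E <= (sigma ^+ 2)%:E * \int[Q]_w (h s (z w) ^+ 2)%:E)%E.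
Proof.
have F0 t : 0 <= F s s t by rewrite /F -!expr2 mulr_ge0 ?sqr_ge0.
have mFE : measurable_fun [set: N.-tuple (T * R)] (fun t => (F s s t)%:E).
  by apply/measurable_EFinP; exact: mF.
have mh2 : measurable_fun [set: N.-tuple (T * R)] (fun t => (h s t ^+ 2)%:E).
  by apply/measurable_EFinP; exact: measurable_funX.
have mh2s : measurable_fun [set: N.-tuple (T * R)] (fun t => (h s t ^+ 2 * sigma ^+ 2)%:E).
  by apply/measurable_EFinP; apply: measurable_funM => //; exact: measurable_funX.
rewrite -ge0_integralZl_EFin ?sqr_ge0//; last 2 first.
- by move=> w _; rewrite lee_fin sqr_ge0.
- exact: (measurableT_comp mh2).
under [leRHS]eq_integral => w _ do rewrite -EFinM mulrC.
rewrite (ge0_integral_resample mz0 mz iid s mFE); last by move=> t; rewrite lee_fin.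
rewrite (ge0_integral_resample mz0 mz iid s mh2s); last first.
  by move=> t; rewrite lee_fin mulr_ge0 ?sqr_ge0.
have mres (f : N.-tuple (T * R) -> \bar R) : measurable_fun [set: N.-tuple (T * R)] f ->
    (forall t, 0 <= f t)%E ->
    measurable_fun setT (fun w => \int[P0]_v f (tuple_set (z w) s (z0 v)))%E.
  move=> mf f0.
  apply: (@measurable_fun_fubini_tonelli_F _ _ _ _ _ P0
    (fun p : Om * Om0 => f (tuple_set (z p.1) s (z0 p.2)))) => //.
  apply: (measurableT_comp mf).
  by apply: measurable_tuple_set; exact: measurableT_comp.
apply: ge0_le_integral => //.
- by move=> w _; apply: integral_ge0 => v _; rewrite lee_fin.
- by apply: (mres (fun t => (F s s t)%:E)) => // t; rewrite lee_fin.
- apply: (mres (fun t => (h s t ^+ 2 * sigma ^+ 2)%:E)) => // t.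
  by rewrite lee_fin mulr_ge0 ?sqr_ge0.
move=> w _.
pose G x := h s (tuple_set (z w) s (x, 0)) ^+ 2.
have := @noise_var G (measurable_funX _ (measurable_h_tuple_set s s (z w))) (fun x => sqr_ge0 _).
rewrite (eq_integral (fun v => (F s s (tuple_set (z w) s (z0 v)))%:E)); last first.
  move=> v _; congr (_%:E); rewrite /F /G h_tuple_set /r tnth_tuple_set eqxx residual_z0.
  by ring.
move=> H; apply: le_trans H _; rewrite le_eqVlt; apply/orP; left; apply/eqP.
by apply: eq_integral => v _; rewrite /G h_tuple_set.
Qed.

(** The noise variables are uncorrelated given the design, with conditional
    variance at most [sigma ^+ 2]. *)
Lemma noise_sum_var :
  (\int[Q]_w ((\sum_s h s (z w) * residual (tnth (z w) s)) ^+ 2)%:E <=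
   (sigma ^+ 2)%:E * \sum_s \int[Q]_w (h s (z w) ^+ 2)%:E)%E.
Proof.
have sqE w : ((\sum_s h s (z w) * residual (tnth (z w) s)) ^+ 2)%:E =
    (\sum_s \sum_u (F s u (z w))%:E)%E.
  rewrite expr2 mulr_suml -sumEFin; apply: eq_bigr => s _.
  rewrite mulr_sumr -sumEFin; apply: eq_bigr => u _; congr (_%:E).
  by rewrite /F /r; ring.
under eq_integral do rewrite sqE.
rewrite integral_sum//; last by move=> s; apply: integrable_sum => // u _.
rewrite ge0_sume_distrr; last first.
  by move=> s _; apply: integral_ge0 => w _; rewrite lee_fin sqr_ge0.
apply: lee_sum => s _; rewrite integral_sum// (bigD1 s)//= big1 ?adde0.
  exact: F_diag.
by move=> u us; apply: F_off; rewrite eq_sym.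
Qed.

End noise.

(** * Risk of the averaged estimate for a fixed split *)

Section measurable_inverse.
Context d (D : measurableType d) (R : realType).

Lemma measurable_det n (A : D -> 'M[R]_n) :
  (forall i j, measurable_fun setT (fun w => A w i j)) ->
  measurable_fun setT (fun w => \det (A w)).
Proof.
move=> mA; apply: measurable_sum => s; apply: measurable_funM => //.
by apply: measurable_prod => i _; exact: mA.
Qed.

Lemma measurable_invr (f : D -> R) :
  measurable_fun setT f -> measurable_fun setT (fun w => (f w)^-1).
Proof.
move=> mf; rewrite (_ : (fun w => _) = fun w => f w * (f w ^+ 2) `^ (-1)).
  apply: measurable_funM => //; apply: (measurableT_comp (measurable_powR _)).
  exact: measurable_funX.
apply/funext => w; rewrite powR_inv1 ?sqr_ge0//.
have [->|f0] := eqVneq (f w) 0; first by rewrite invr0 mul0r.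
by field.
Qed.

(** Cramer's rule. *)
Lemma measurable_invmx n (A : D -> 'M[R]_n) i j :
  (forall i j, measurable_fun setT (fun w => A w i j)) ->
  (forall w, A w \in unitmx) ->
  measurable_fun setT (fun w => invmx (A w) i j).
Proof.
move=> mA uA; rewrite (_ : (fun w => _) = fun w => (\det (A w))^-1 * cofactor (A w) j i).
  apply: measurable_funM; first by apply: measurable_invr; exact: measurable_det.
  apply: measurable_funM => //; apply: measurable_det => k l.
  by under eq_fun do rewrite !mxE; exact: mA.
by apply/funext => w; rewrite /invmx uA !mxE.
Qed.

End measurable_inverse.

Section risk.
Context (d0 d : measure_display) (Om0 : measurableType d0) (T : measurableType d)
  (R : realType) (P0 : probability Om0 R) (X : {RV P0 >-> T}) (Y : {RV P0 >-> R})
  (K : T -> T -> R) (H : set (T -> R)) (ip : (T -> R) -> (T -> R) -> R)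
  (mu : nat -> R) (phi : nat -> T -> R) (fstar : T -> R) (sigma tr lam gam : R).

Let P := distribution P0 X.

Hypothesis psd : psd_kernel K.
Hypothesis rk : is_rkhs K H ip.
Hypothesis HL2 : forall f, H f -> f \in Lfun P 2%:E.
Hypothesis mer : mercer_expansion P K mu phi.
Hypothesis mu_tr : forall J, \sum_(j < J) mu j <= tr.
Hypothesis lam0 : 0 < lam.
Hypothesis shrink_gam : forall J, \sum_(j < J) shrink mu lam j <= gam.
Hypothesis Hfstar : H fstar.
Hypothesis fstar_cond : is_cond_expectation X Y fstar.
Hypothesis noise_cond : exists2 v : T -> R,
  is_cond_expectation X (fun w => (Y w - fstar (X w)) ^+ 2) v &
  forall x, v x <= sigma ^+ 2.

Context d1 (Om : measurableType d1) (Q : probability Om R) (N m n : nat)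
  (z : Om -> N.-tuple (T * R)).

Let z0 (v : Om0) : T * R := (X v, Y v).

Hypothesis mz : measurable_fun setT z.
Hypothesis iid : forall B : 'I_N -> set (T * R), (forall i, measurable (B i)) ->
  (Q [set w | forall i, B i (tnth (z w) i)] =
   \prod_(i < N) P0 [set w | B i (z0 w)])%E.

Definition design (t : N.-tuple (T * R)) (s : 'I_N) : T := (tnth t s).1.
Definition response (t : N.-tuple (T * R)) (s : 'I_N) : R := (tnth t s).2.

Let mz0 : measurable_fun setT z0. Proof. exact: measurable_fun_pair. Qed.

Lemma measurable_design s : measurable_fun [set: N.-tuple (T * R)] (design ^~ s).
Proof. exact: (measurableT_comp measurable_fst (measurable_tnth s)). Qed.

Lemma measurable_response s : measurable_fun [set: N.-tuple (T * R)] (response ^~ s).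
Proof. exact: (measurableT_comp measurable_snd (measurable_tnth s)). Qed.

Lemma measurable_ridge_coef (B : {set 'I_N}) s u : (0 < #|B|)%N ->
  measurable_fun [set: N.-tuple (T * R)] (fun t => ridge_coef K B (design t) lam s u).
Proof.
move=> B0; apply: measurable_invmx; last by move=> t; exact: ridge_gram_unit.
move=> i j; under eq_fun do rewrite !mxE.
apply: measurable_funD => //; case: ((i \in B) && (j \in B)) => //.
apply: (measurableT_comp (measurable_kernel mer)
  (measurable_fun_pair (measurable_design i) (measurable_design j))).
Qed.

Let mridge_basis (B : {set 'I_N}) s : (0 < #|B|)%N ->
  measurable_fun [set: N.-tuple (T * R) * T]
    (fun p => ridge_basis K B (design p.1) lam s p.2).
Proof.
move=> B0; rewrite /ridge_basis.
rewrite (_ : (fun p => _) = fun p : N.-tuple (T * R) * T =>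
    \sum_(t <- enum B) ridge_coef K B (design p.1) lam t s * K (design p.1 t) p.2).
  apply: measurable_sum => t; apply: measurable_funM.
    exact: (measurableT_comp (measurable_ridge_coef t s B0) measurable_fst).
  apply: (measurableT_comp (measurable_kernel mer) (measurable_fun_pair _ _)) => //.
  exact: (measurableT_comp (measurable_design t) measurable_fst).
by apply/funext => p; rewrite big_enum.
Qed.

Variable a : {ffun 'I_N -> 'I_m}.
Hypothesis m0 : (0 < m)%N.
Hypothesis n0 : (0 < n)%N.
Hypothesis a_even : forall i, #|block a i| = n.

Let block_gt0 i : (0 < #|block a i|)%N. Proof. by rewrite a_even. Qed.

Let in_block s : s \in block a (a s). Proof. by rewrite inE. Qed.

Let N_mn : N = (m * n)%N.
Proof.
rewrite -[LHS]card_ord -sum1_card (partition_big (fun s : 'I_N => a s) xpredT)//=.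
rewrite (eq_bigr (fun=> n)); first by rewrite sum_nat_const card_ord.
by move=> i _; rewrite sum1_card -(a_even i); apply: eq_card => s; rewrite !inE.
Qed.

Let g s (t : N.-tuple (T * R)) (y : T) : R :=
  ridge_basis K (block a (a s)) (design t) lam s y.

Let mg s : measurable_fun [set: N.-tuple (T * R) * T] (fun p => g s p.1 p.2).
Proof. exact: mridge_basis. Qed.

Let mg1 s y : measurable_fun [set: N.-tuple (T * R)] (fun t => g s t y).
Proof. exact: (measurableT_comp (mg s) (measurable_pair2 y)). Qed.

Let bad i := [set w | ~ good mu phi lam (block a i) (design (z w))].

Let mdes s : measurable_fun setT (fun w => design (z w) s).
Proof. exact: (measurableT_comp (measurable_design s) mz). Qed.

Let measurable_bad i : measurable (bad i).
Proof. exact: (@measurable_not_good _ _ _ _ _ _ _ lam mer _ _ _ (fun w => design (z w))). Qed.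

Variable delta : R.
Hypothesis bad_delta : forall i, (Q (bad i) <= delta%:E)%E.

Let delta_ge0 : 0 <= delta.
Proof.
by rewrite -lee_fin; apply: le_trans (bad_delta (Ordinal m0)); exact: measure_ge0.
Qed.

Let tr0 : 0 <= tr. Proof. exact: tr_ge0 mu_tr. Qed.

Let integral_bad i c : 0 <= c ->
  (\int[Q]_w (c * \1_(bad i) w)%:E <= (c * delta)%:E)%E.
Proof.
move=> c0; under eq_integral do rewrite EFinM.
rewrite ge0_integralZl_EFin//; last first.
  by apply/measurable_EFinP; exact: measurable_indic.
rewrite integral_indic// setIT.
rewrite EFinM; apply: lee_wpmul2l; [by rewrite lee_fin|exact: bad_delta].
Qed.

(** The leverage bound on the good event is averaged over the design, where the
    mean leverage is the effective dimension; elsewhere the crude norm bound is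
    multiplied by the failure probability. *)
Let integral_g s :
  (\int[Q]_w \int[P]_y (g s (z w) y ^+ 2)%:E <=
   (4 / n%:R ^+ 2 * gam + tr / (n%:R * lam) * delta)%:E)%E.
Proof.
have c1 : 0 <= 4 / n%:R ^+ 2 :> R by rewrite divr_ge0// exprn_ge0.
have c2 : 0 <= tr / (n%:R * lam) by rewrite divr_ge0// mulr_ge0// ltW.
have mlev : measurable_fun setT (fun w => leverage mu phi lam (design (z w) s)).
  exact: (measurableT_comp (measurable_leverage mer lam0) (mdes s)).
have lev0 := leverage_ge0 mer lam0.
apply: (@le_trans _ _ (\int[Q]_w
  ((4 / n%:R ^+ 2)%:E * (leverage mu phi lam (design (z w) s))%:E +
   (tr / (n%:R * lam) * \1_(bad (a s)) w)%:E))%E).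
  apply: ge0_le_integral => //.
  - by move=> w _; apply: integral_ge0 => y _; rewrite lee_fin sqr_ge0.
  - apply: (@measurable_fun_fubini_tonelli_F _ _ _ _ _ P
      (fun p : Om * T => (g s (z p.1) p.2 ^+ 2)%:E)) => //.
      apply/measurable_EFinP; apply: measurable_funX.
      apply: (measurableT_comp (mg s) (measurable_fun_pair _ _)) => //.
      exact: measurableT_comp.
    by move=> p; rewrite lee_fin sqr_ge0.
  - apply: emeasurable_funD.
      by apply: emeasurable_funM => //; exact/measurable_EFinP.
    apply/measurable_EFinP; apply: measurable_funM => //; exact: measurable_indic.
  - move=> w _; rewrite indicE; have [wb|wg] := boolP (w \in bad (a s)).
      have h := integral_ridge_basis psd rk HL2 mer mu_tr lam0 (design (z w))
        (block_gt0 (a s)) (in_block s).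
      rewrite a_even in h; apply: le_trans h _.
      by rewrite mulr1 -EFinM -EFinD lee_fin lerDr mulr_ge0.
    have gd : good mu phi lam (block a (a s)) (design (z w)).
      by apply: contrapT => h; move: wg; rewrite notin_setE; apply.
    have h := integral_ridge_basis_good psd rk HL2 mer mu_tr lam0
      (block_gt0 (a s)) (in_block s) gd.
    rewrite a_even in h; apply: le_trans h _.
    by rewrite mulr0 adde0 -EFinM.
rewrite ge0_integralD//; last 4 first.
- by move=> w _; rewrite -EFinM lee_fin mulr_ge0.
- by apply: emeasurable_funM => //; exact/measurable_EFinP.
- by move=> w _; rewrite lee_fin mulr_ge0.
- by apply/measurable_EFinP; apply: measurable_funM => //; exact: measurable_indic.
rewrite EFinD; apply: leeD; last exact: integral_bad.
rewrite ge0_integralZl_EFin//; last 2 first.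
- by move=> w _; rewrite lee_fin.
- exact/measurable_EFinP.
rewrite [leRHS]EFinM; apply: lee_wpmul2l; first by rewrite lee_fin.
rewrite (ge0_integral_coord mz0 mz iid s
  (f := fun y => (leverage mu phi lam y.1)%:E)); last 2 first.
- apply/measurable_EFinP.
  exact: (measurableT_comp (measurable_leverage mer lam0) measurable_fst).
- by move=> y; rewrite lee_fin.
rewrite -(ge0_integral_distribution X (f := fun x => (leverage mu phi lam x)%:E)).
- exact: (integral_leverage mer lam0 shrink_gam).
- by apply/measurable_EFinP; exact: (measurable_leverage mer lam0).
- by move=> x; rewrite lee_fin.
Qed.

Let noise_part (t : N.-tuple (T * R)) (y : T) : R :=
  \sum_s g s t y * residual fstar (tnth t s).

Let mfstar : measurable_fun setT fstar.
Proof. exact: Lfun2_measurable (HL2 Hfstar). Qed.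

Let measurable_noise_part :
  measurable_fun [set: N.-tuple (T * R) * T] (fun p => noise_part p.1 p.2).
Proof.
apply: measurable_sum => s; apply: measurable_funM; first exact: mg.
apply: measurable_funB.
  exact: (measurableT_comp (measurable_response s) measurable_fst).
apply: (measurableT_comp mfstar).
exact: (measurableT_comp (measurable_design s) measurable_fst).
Qed.

(** The variance term: cross terms vanish at every evaluation point, before
    integrating over it. *)
Let integral_noise_part :
  (\int[Q]_w \int[P]_y (noise_part (z w) y ^+ 2)%:E <=
   (sigma ^+ 2 * (N%:R * (4 / n%:R ^+ 2 * gam + tr / (n%:R * lam) * delta)))%:E)%E.
Proof.
have mzp : measurable_fun [set: Om * T] (fun p => (z p.1, p.2)).
  by apply: measurable_fun_pair => //; exact: measurableT_comp.
rewrite (@fubini_tonelli _ _ _ _ _ Q P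
  (fun p : Om * T => (noise_part (z p.1) p.2 ^+ 2)%:E)); last 2 first.
- apply/measurable_EFinP; apply: measurable_funX.
  exact: (measurableT_comp measurable_noise_part mzp).
- by move=> p; rewrite lee_fin sqr_ge0.
have mg2 s : measurable_fun [set: Om * T] (fun p => (g s (z p.1) p.2 ^+ 2)%:E).
  by apply/measurable_EFinP; apply: measurable_funX; exact: (measurableT_comp (mg s) mzp).
have pt y : (\int[Q]_w (noise_part (z w) y ^+ 2)%:E <=
   (sigma ^+ 2)%:E * \sum_s \int[Q]_w (g s (z w) y ^+ 2)%:E)%E.
  apply: (@noise_sum_var _ _ _ _ _ _ _ _ _ _ (HL2 Hfstar) fstar_cond noise_cond
    _ _ Q N z mz iid (fun s t => g s t y) (Num.sqrt ((n%:R * lam)^-1 * K y y))).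
  - by move=> s; exact: mg1.
  - move=> s t t' tt'; rewrite /g; congr (ridge_basis K _ _ _ _ _).
    by apply/funext => u; exact: tt'.
  - move=> s t; rewrite -sqrtr_sqr ler_wsqrtr//.
    have Hg := ridge_basis_H rk (block a (a s)) (design t) lam s.
    apply: le_trans (rkhs_eval_le rk y Hg) _.
    apply: ler_wpM2r; first exact: rkhs_kernel_diag_ge0 rk y.
    have := ridge_basis_norm psd rk (design t) lam0 (block_gt0 (a s)) (in_block s).
    by rewrite a_even.
have mI s : measurable_fun setT (fun y => \int[Q]_w (g s (z w) y ^+ 2)%:E)%E.
  apply: (@measurable_fun_fubini_tonelli_G _ _ _ _ _ Q
    (fun p : Om * T => (g s (z p.1) p.2 ^+ 2)%:E)) => //.
  by move=> p; rewrite lee_fin sqr_ge0.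
have I0 s y : (0 <= \int[Q]_w (g s (z w) y ^+ 2)%:E)%E.
  by apply: integral_ge0 => w _; rewrite lee_fin sqr_ge0.

apply: (@le_trans _ _ (\int[P]_y
    ((sigma ^+ 2)%:E * \sum_s \int[Q]_w (g s (z w) y ^+ 2)%:E))%E).
  apply: ge0_le_integral => //.
  - by move=> y _; apply: integral_ge0 => w _; rewrite lee_fin sqr_ge0.
  - apply: (@measurable_fun_fubini_tonelli_G _ _ _ _ _ Q
      (fun p : Om * T => (noise_part (z p.1) p.2 ^+ 2)%:E)).
      apply/measurable_EFinP; apply: measurable_funX.
      exact: (measurableT_comp measurable_noise_part mzp).
    by move=> p; rewrite lee_fin sqr_ge0.
  - by apply: emeasurable_funM => //; exact: emeasurable_sum.
  - by move=> y _; exact: pt.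
rewrite ge0_integralZl_EFin ?sqr_ge0//; last 2 first.
- by move=> y _; apply: sume_ge0.
- exact: emeasurable_sum.
rewrite [leRHS]EFinM; apply: lee_wpmul2l; first by rewrite lee_fin sqr_ge0.
rewrite ge0_integral_sum//.
set C := _ + _; apply: (@le_trans _ _ (\sum_(s < N) C%:E)%E).
  apply: lee_sum => s _; apply: le_trans (integral_g s).
  rewrite -(@fubini_tonelli _ _ _ _ _ Q P
    (fun p : Om * T => (g s (z p.1) p.2 ^+ 2)%:E))//.
  by move=> p; rewrite lee_fin sqr_ge0.
by rewrite sumEFin lee_fin sumr_const card_ord mulr_natl.
Qed.

Let F := ip fstar fstar.

Let F0 : 0 <= F. Proof. exact: ip_ge0 rk _ Hfstar. Qed.

Let bias i (t : N.-tuple (T * R)) : T -> R :=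
  ridge K (block a i) (design t) lam (fun u => fstar (design t u)) \- fstar.

Definition block_average (t : N.-tuple (T * R)) : T -> R :=
  averaged_estimate (fun i : 'I_m => ridge K (block a i) (design t) lam (response t)).

Let mean_m : 0 < m%:R :> R. Proof. by rewrite ltr0n. Qed.

Let block_average_split t y :
  block_average t y - fstar y =
  m%:R^-1 * \sum_i bias i t y + m%:R^-1 * noise_part t y.
Proof.
rewrite /block_average /averaged_estimate -mulrDr.
have -> : fstar y = m%:R^-1 * \sum_(i < m) fstar y.
  by rewrite sumr_const card_ord -(mulr_natl (fstar y) m) mulKf ?(lt0r_neq0 mean_m).
rewrite -mulrBr -sumrB; congr (_ * _).
have -> : noise_part t y = \sum_(i < m) \sum_(s in block a i)
    ridge_basis K (block a i) (design t) lam s y * residual fstar (tnth t s).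
  rewrite /noise_part (partition_big (fun s : 'I_N => a s) xpredT)//=.
  apply: eq_bigr => i _; rewrite (eq_bigl (mem (block a i))); last first.
    by move=> s; rewrite /= inE.
  by apply: eq_bigr => s; rewrite /= inE => /eqP asi; rewrite /g asi.
rewrite -big_split/=; apply: eq_bigr => i _.
rewrite /bias /= addrAC; congr (_ - _).
rewrite /ridge -big_split/=; apply: eq_bigr => s _.
by rewrite /residual /response /design; ring.
Qed.

Let measurable_ridge (v : N.-tuple (T * R) -> 'I_N -> R) i :
  (forall s, measurable_fun [set: N.-tuple (T * R)] (v ^~ s)) ->
  measurable_fun [set: N.-tuple (T * R) * T]
    (fun p => ridge K (block a i) (design p.1) lam (v p.1) p.2).
Proof.
move=> mv; rewrite /ridge.
rewrite (_ : (fun p => _) = fun p : N.-tuple (T * R) * T =>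
    \sum_(s <- enum (block a i)) v p.1 s * ridge_basis K (block a i) (design p.1) lam s p.2).
  apply: measurable_sum => s; apply: measurable_funM; last exact: mridge_basis.
  exact: (measurableT_comp (mv s) measurable_fst).
by apply/funext => p; rewrite big_enum.
Qed.

Let measurable_error :
  measurable_fun [set: N.-tuple (T * R) * T] (fun p => block_average p.1 p.2 - fstar p.2).
Proof.
apply: measurable_funB; last exact: (measurableT_comp mfstar measurable_snd).
apply: measurable_funM => //; apply: measurable_sum => i.
exact: (measurable_ridge i measurable_response).
Qed.

Lemma measurable_block_risk : measurable_fun [set: N.-tuple (T * R)]
  (fun t => \int[P]_y ((block_average t y - fstar y) ^+ 2)%:E)%E.
Proof.
apply: (@measurable_fun_fubini_tonelli_F _ _ _ _ _ P
  (fun p : N.-tuple (T * R) * T => ((block_average p.1 p.2 - fstar p.2) ^+ 2)%:E)).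
  by apply/measurable_EFinP; apply: measurable_funX; exact: measurable_error.
by move=> p; rewrite lee_fin sqr_ge0.
Qed.

Let integral_bias_le i w :
  (\int[P]_y (bias i (z w) y ^+ 2)%:E <=
   (2 * (lam * F) + tr * F * \1_(bad i) w)%:E)%E.
Proof.
have l0 : 0 <= 2 * (lam * F) by rewrite !mulr_ge0// ltW.
rewrite indicE; have [wb|wg] := boolP (w \in bad i).
  apply: le_trans (integral_bias psd rk HL2 mer mu_tr lam0 (design (z w)) (block_gt0 i) Hfstar) _.
  by rewrite lee_fin mulr1 lerDr.
have gd : good mu phi lam (block a i) (design (z w)).
  by apply: contrapT => h; move: wg; rewrite notin_setE; apply.
apply: le_trans (integral_bias_good psd rk HL2 mer mu_tr lam0 (block_gt0 i) Hfstar gd) _.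
by rewrite lee_fin mulr0 addr0.
Qed.

Let block_risk_le w :
  (\int[P]_y ((block_average (z w) y - fstar y) ^+ 2)%:E <=
   (4 * (lam * F))%:E + \sum_(i < m) (2 / m%:R * (tr * F) * \1_(bad i) w)%:E +
   (2 / m%:R ^+ 2)%:E * \int[P]_y (noise_part (z w) y ^+ 2)%:E)%E.
Proof.
have mbias i : measurable_fun setT (fun y => bias i (z w) y).
  apply: measurable_funB => //.
  apply: (@measurableT_comp _ _ _ _ _ _
    (fun p => ridge K (block a i) (design p.1) lam (fun u => fstar (design p.1 u)) p.2) _
    (fun y => (z w, y)) _ (measurable_pair1 (z w))).
  apply: (measurable_ridge (v := fun t u => fstar (design t u)) i) => s.
  exact: (measurableT_comp mfstar (measurable_design s)).
have mnoise : measurable_fun setT (fun y => noise_part (z w) y).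
  exact: (measurableT_comp measurable_noise_part (measurable_pair1 (z w))).
have c1 : 0 <= 2 / m%:R :> R by rewrite divr_ge0.
have c2 : 0 <= 2 / m%:R ^+ 2 :> R by rewrite divr_ge0// exprn_ge0.
apply: (@le_trans _ _ (\int[P]_y
   ((2 / m%:R)%:E * \sum_(i < m) (bias i (z w) y ^+ 2)%:E +
    (2 / m%:R ^+ 2)%:E * (noise_part (z w) y ^+ 2)%:E))%E).
  apply: ge0_le_integral => //.
  - by move=> y _; rewrite lee_fin sqr_ge0.
  - apply/measurable_EFinP; apply: measurable_funX.
    exact: (measurableT_comp measurable_error (measurable_pair1 (z w))).
  - apply: emeasurable_funD; apply: emeasurable_funM => //.
      by apply: emeasurable_sum => i; apply/measurable_EFinP; exact: measurable_funX.
    by apply/measurable_EFinP; exact: measurable_funX.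
  - move=> y _; rewrite sumEFin -!EFinM -EFinD lee_fin block_average_split.
    set b := \sum_i _; set v := noise_part _ _.
    have bs : b ^+ 2 <= m%:R * \sum_(i < m) bias i (z w) y ^+ 2.
      have := sum_CS (index_enum 'I_m) xpredT (fun=> 1) (fun i => bias i (z w) y).
      under eq_bigr do rewrite mul1r.
      by under [X in _ <= X * _ -> _]eq_bigr do rewrite expr1n; rewrite sumr_const card_ord.
    have bs2 : m%:R^-1 * (m%:R^-1 * b ^+ 2) <= m%:R^-1 * \sum_(i < m) bias i (z w) y ^+ 2.
      apply: ler_wpM2l; first by rewrite invr_ge0.
      by rewrite ler_pdivrMl.
    have -> : 2 / m%:R ^+ 2 * v ^+ 2 = 2 * (m%:R^-1 * v) ^+ 2.
      by rewrite exprMn exprVn; ring.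
    move: bs2; rewrite -mulrA (_ : m%:R^-1 * (m%:R^-1 * b ^+ 2) = (m%:R^-1 * b) ^+ 2); last first.
      by rewrite exprMn exprVn expr2 invfM; ring.
    move: (m%:R^-1 * \sum_(i < m) _ ^+ 2) (m%:R^-1 * b) (m%:R^-1 * v) => q x x' xq.
    by have := sqr_ge0 (x - x'); rewrite !expr2 in xq *; nra.
rewrite ge0_integralD//; last 4 first.
- move=> y _; apply: mule_ge0; first by rewrite lee_fin.
  by apply: sume_ge0 => i _; rewrite lee_fin sqr_ge0.
- apply: emeasurable_funM => //.
  by apply: emeasurable_sum => i; apply/measurable_EFinP; exact: measurable_funX.
- by move=> y _; rewrite -EFinM lee_fin mulr_ge0 ?sqr_ge0.
- by apply: emeasurable_funM => //; apply/measurable_EFinP; exact: measurable_funX.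
apply: leeD; last first.
  rewrite ge0_integralZl_EFin//; last by apply/measurable_EFinP; exact: measurable_funX.
  by move=> y _; rewrite lee_fin sqr_ge0.
rewrite ge0_integralZl_EFin//; last 2 first.
- by move=> y _; apply: sume_ge0 => i _; rewrite lee_fin sqr_ge0.
- by apply: emeasurable_sum => i; apply/measurable_EFinP; exact: measurable_funX.
rewrite ge0_integral_sum//; last 2 first.
- by move=> i; apply/measurable_EFinP; exact: measurable_funX.
- by move=> i y _; rewrite lee_fin sqr_ge0.
apply: (@le_trans _ _ ((2 / m%:R)%:E *
    \sum_(i < m) (2 * (lam * F) + tr * F * \1_(bad i) w)%:E)%E).
  by apply: lee_wpmul2l; [rewrite lee_fin|apply: lee_sum => i _; exact: integral_bias_le].
rewrite !sumEFin -EFinM -EFinD lee_fin big_split/= mulrDr.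
rewrite sumr_const card_ord mulr_sumr.
apply: lerD; last by apply: ler_sum => i _; rewrite -!mulrA.
rewrite le_eqVlt; apply/orP; left; apply/eqP; rewrite -mulr_natl.
by field; rewrite lt0r_neq0.
Qed.

(** The bias is not reduced by averaging, by convexity of the square; the noise
    terms are uncorrelated, so averaging divides their variance by [m]. *)
Lemma block_risk :
  (\int[Q]_w \int[P]_y ((block_average (z w) y - fstar y) ^+ 2)%:E <=
   (4 * (lam * F) + 2 * (tr * F) * delta +
    2 * sigma ^+ 2 * (4 * gam / N%:R + tr * delta / (m%:R * lam)))%:E)%E.
Proof.
have mzp : measurable_fun [set: Om * T] (fun p => (z p.1, p.2)).
  by apply: measurable_fun_pair => //; exact: measurableT_comp.
have mN : measurable_fun setT (fun w => \int[P]_y (noise_part (z w) y ^+ 2)%:E)%E.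
  apply: (@measurable_fun_fubini_tonelli_F _ _ _ _ _ P
    (fun p : Om * T => (noise_part (z p.1) p.2 ^+ 2)%:E)).
    apply/measurable_EFinP; apply: measurable_funX.
    exact: (measurableT_comp measurable_noise_part mzp).
  by move=> p; rewrite lee_fin sqr_ge0.
have N0 w : (0 <= \int[P]_y (noise_part (z w) y ^+ 2)%:E)%E.
  by apply: integral_ge0 => y _; rewrite lee_fin sqr_ge0.
have c0 : 0 <= 2 / m%:R * (tr * F) by rewrite mulr_ge0 ?divr_ge0// mulr_ge0.
have c2 : 0 <= 2 / m%:R ^+ 2 :> R by rewrite divr_ge0// exprn_ge0.
have l0 : 0 <= 4 * (lam * F) by rewrite !mulr_ge0// ltW.
have mb i : measurable_fun setT (fun w => (2 / m%:R * (tr * F) * \1_(bad i) w)%:E).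
  by apply/measurable_EFinP; apply: measurable_funM => //; exact: measurable_indic.
have b0 i w : (0 <= (2 / m%:R * (tr * F) * \1_(bad i) w)%:E)%E.
  by rewrite lee_fin mulr_ge0.
apply: (@le_trans _ _ (\int[Q]_w
  ((4 * (lam * F))%:E + \sum_(i < m) (2 / m%:R * (tr * F) * \1_(bad i) w)%:E +
   (2 / m%:R ^+ 2)%:E * \int[P]_y (noise_part (z w) y ^+ 2)%:E))%E).
  apply: ge0_le_integral => //.
  - by move=> w _; apply: integral_ge0 => y _; rewrite lee_fin sqr_ge0.
  - exact: (measurableT_comp measurable_block_risk mz).
  - apply: emeasurable_funD; last exact: emeasurable_funM.
    by apply: emeasurable_funD => //; exact: emeasurable_sum.
rewrite ge0_integralD//; last 4 first.
- by move=> w _; apply: adde_ge0; [rewrite lee_fin|apply: sume_ge0].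
- by apply: emeasurable_funD => //; exact: emeasurable_sum.
- by move=> w _; apply: mule_ge0; [rewrite lee_fin|].
- by apply: emeasurable_funM => //; exact: measurable_cst.
rewrite ge0_integralZl_EFin//.
rewrite ge0_integralD//; last 2 first.
- by move=> w _; apply: sume_ge0.
- exact: emeasurable_sum.
rewrite integral_cst//= probability_setT mule1 ge0_integral_sum//.
apply: (@le_trans _ _ ((4 * (lam * F))%:E +
   \sum_(i < m) (2 / m%:R * (tr * F) * delta)%:E +
   (2 / m%:R ^+ 2)%:E *
   (sigma ^+ 2 * (N%:R * (4 / n%:R ^+ 2 * gam + tr / (n%:R * lam) * delta)))%:E)%E).
  apply: leeD; last by apply: lee_wpmul2l; [rewrite lee_fin|exact: integral_noise_part].
  apply: leeD => //; apply: lee_sum => i _; exact: integral_bad.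
rewrite sumEFin -EFinM -!EFinD lee_fin sumr_const card_ord le_eqVlt.
have n_neq0 : n%:R != 0 :> R by rewrite pnatr_eq0 -lt0n.
have m_neq0 : m%:R != 0 :> R by rewrite pnatr_eq0 -lt0n.
have lam_neq0 : lam != 0 by rewrite lt0r_neq0.
apply/orP; left; apply/eqP; rewrite N_mn natrM -mulr_natl.
by field; rewrite n_neq0 m_neq0 lam_neq0.
Qed.

End risk.

(** * Averaging over the random split *)

(** The restricted measure does not charge the complement of [A]. *)
Lemma ge0_integral_mrestr d (D : measurableType d) (R : realType)
    (mu : {measure set D -> \bar R}) (A : set D) (mA : measurable A) (f : D -> \bar R) :
  measurable_fun setT f -> (forall w, 0 <= f w)%E ->
  (\int[mrestr mu mA]_w f w = \int[mu]_(w in A) f w)%E.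
Proof.
move=> mf f0; rewrite (@ge0_negligible_integral _ _ _ _ setT (~` A))//.
- rewrite setTD setCK; apply: eq_measure_integral => B mB BA.
  by rewrite /= /mrestr setIidl.
- exact: measurableC.
- by rewrite /= /mrestr setICl measure0.
Qed.

Lemma L2norm_sqr d (D : measurableType d) (R : realType)
    (mu : {measure set D -> \bar R}) (f : D -> R) :
  (L2norm mu f ^+ 2 = \int[mu]_x (f x ^+ 2)%:E)%E.
Proof.
have sqrE (x : \bar R) : (0 <= x -> x ^+ 2 = x `^ 2)%E.
  case: x => [r||]//; last by rewrite poweRyr// expe2 mulyy.
  by rewrite lee_fin => r0; rewrite -EFin_expe poweR_EFin powR_mulrn.
rewrite /L2norm sqrE ?Lnorm_ge0// poweR_Lnorm//.
by apply: eq_integral => x _; rewrite /= powR_mulrn// real_normK ?num_real.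
Qed.

Section random_split.
Context (d d1 : measure_display) (T : measurableType d) (R : realType)
  (Om : measurableType d1) (Q : probability Om R) (N m : nat)
  (xs : 'I_N -> {RV Q >-> T}) (ys : 'I_N -> {RV Q >-> R})
  (S : Om -> {ffun 'I_N -> 'I_m}).
Hypothesis S_split : uniform_even_split xs ys S.

Definition sample (w : Om) : N.-tuple (T * R) := [tuple (xs i w, ys i w) | i < N].

Lemma measurable_sample : measurable_fun setT sample.
Proof.
apply/measurable_fun_tnthP => i.
rewrite (_ : _ \o _ = fun w => (xs i w, ys i w)); first exact: measurable_fun_pair.
by apply/funext => w; rewrite /= tnth_mktuple.
Qed.

Let E := even_splits N m.

Let mS a : measurable [set w | S w = a].
Proof. by case: S_split. Qed.

(** The split is independent of the sample, so restricting to one value of the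
    split only rescales the law of the sample. *)
Let integral_given_split a (F : N.-tuple (T * R) -> \bar R) : a \in E ->
  measurable_fun setT F -> (forall t, 0 <= F t)%E ->
  (\int[Q]_(w in [set w | S w = a]) F (sample w) =
   (#|E|%:R^-1)%:E * \int[Q]_w F (sample w))%E.
Proof.
move=> aE mF F0; have mFs : measurable_fun setT (F \o sample).
  exact: (measurableT_comp mF measurable_sample).
rewrite -(ge0_integral_mrestr Q (mS a))//.
have k0 : 0 <= #|E|%:R^-1 :> R by rewrite invr_ge0.
rewrite -[#|E|%:R^-1]/((NngNum k0)%:num) -ge0_integral_mscale//.
apply: (integral_tuple_law measurable_sample measurable_sample) => //.
  by rewrite /= /mrestr setTI (le_lt_trans (probability_le1 Q (mS a)))// ltry.
move=> B mB; case: S_split => _ _ /(_ a B aE mB).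
have sE : [set w | forall i, B i (tnth (sample w) i)] =
          [set w | forall i, B i (xs i w, ys i w)].
  by apply/seteqP; split => w /= h i; have := h i; rewrite tnth_mktuple.
rewrite /= /mrestr /mscale/= sE => <-; congr (Q _).
by apply/seteqP; split => w [].
Qed.

Lemma random_split_le (F : {ffun 'I_N -> 'I_m} -> N.-tuple (T * R) -> \bar R) (b : R) :
  0 <= b ->
  (forall a, a \in E -> measurable_fun setT (F a)) ->
  (forall a t, 0 <= F a t)%E ->
  (forall a, a \in E -> \int[Q]_w F a (sample w) <= b%:E)%E ->
  (\int[Q]_w F (S w) (sample w) <= b%:E)%E.
Proof.
move=> b0 mF F0 Fb; case: (S_split) => SE _ _.
pose G a w := if a \in E then ((F a \o sample) \_ [set w | S w = a]) w else 0%E.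
have G0 a w : (0 <= G a w)%E.
  by rewrite /G; case: ifP => // _; rewrite patchE; case: ifP => // _; exact: F0.
have mG a : measurable_fun setT (G a).
  rewrite /G; have [aE|_] := boolP (a \in E); last exact: measurable_cst.
  apply/(measurable_restrict _ (mS a)) => //.
  rewrite setTI; apply: measurable_funTS.
  by apply: (measurableT_comp (mF a aE)); exact: measurable_sample.
rewrite (eq_integral (fun w => \sum_a G a w)%E); last first.
  move=> w _; rewrite (bigD1 (S w))//= {1}/G SE patchE mem_set//= big1 ?adde0//.
  move=> a aS; rewrite /G; case: ifP => // _; rewrite patchE memNset//= => SwA.
  by rewrite SwA eqxx in aS.
rewrite ge0_integral_sum//.
apply: (@le_trans _ _ (\sum_a (if a \in E then #|E|%:R^-1 * b else 0)%:E)%E).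
  apply: lee_sum => a _; rewrite /G; case: ifPn => [aE|_]; last by rewrite integral0.
  rewrite -integral_mkcond (integral_given_split aE (mF a aE) (F0 a)) EFinM.
  by apply: lee_wpmul2l; [rewrite lee_fin invr_ge0|exact: Fb].
rewrite sumEFin lee_fin -big_mkcond/= sumr_const -(mulr_natl (_ * b)) mulrA.
have [E0|E0] := eqVneq #|E| 0%N; last by rewrite divff ?mul1r ?pnatr_eq0.
by rewrite E0 mul0r mul0r.
Qed.

End random_split.

(** * Failure probability under moment and boundedness assumptions *)

Lemma centred_product_powR_le (R : realType) (k a b t : R) : 0 <= k -> 0 <= t <= 1 ->
  ((a * b - t) ^+ 2) `^ (k / 2) <= 2 `^ k * (`|a| `^ (2 * k) + `|b| `^ (2 * k) + 1).
Proof.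
move=> k0 /andP[t0 t1].
have -> : ((a * b - t) ^+ 2) `^ (k / 2) = `|a * b - t| `^ k.
  by rewrite -real_normK ?num_real// -powR_mulrn// -powRrM; congr powR; field.
set M := Num.max 1 (Num.max `|a| `|b|).
have M1 : 1 <= M by rewrite le_max lexx.
have Ma : `|a| <= M by rewrite !le_max lexx orbT.
have Mb : `|b| <= M by rewrite !le_max lexx !orbT.
have h : `|a * b - t| <= 2 * (M * M).
  apply: le_trans (ler_normB _ _) _; rewrite normrM (ger0_norm t0).
  have := ler_pM (normr_ge0 a) (normr_ge0 b) Ma Mb.
  by move: (`|a| * `|b|) => c; nra.
have M0 : 0 <= M by lra.
apply: le_trans (ge0_ler_powR k0 _ _ h) _; rewrite ?nnegrE ?mulr_ge0//.
rewrite powRM ?mulr_ge0//; apply: ler_wpM2l; first exact: powR_ge0.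
have -> : (M * M) `^ k = M `^ (2 * k).
  by rewrite -expr2 -powR_mulrn// -powRrM.
rewrite /M; have pa := powR_ge0 `|a| (2 * k); have pb := powR_ge0 `|b| (2 * k).
have [|] := leP 1 (Num.max `|a| `|b|) => _; last by rewrite powR1; lra.
by case: (leP `|a| `|b|) => _; lra.
Qed.

Section bad_block.
Context (d0 d : measure_display) (Om0 : measurableType d0) (T : measurableType d)
  (R : realType) (P0 : probability Om0 R) (X : {RV P0 >-> T}) (Y : {RV P0 >-> R})
  (K : T -> T -> R) (mu : nat -> R) (phi : nat -> T -> R) (lam gam : R).
Hypothesis mer : mercer_expansion (distribution P0 X) K mu phi.
Hypothesis lam0 : 0 < lam.
Hypothesis gam0 : 0 < gam.
Hypothesis shrink_gam : forall J, \sum_(j < J) shrink mu lam j <= gam.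
Context d1 (Om : measurableType d1) (Q : probability Om R) (N : nat)
  (z : Om -> N.-tuple (T * R)).

Let z0 (v : Om0) : T * R := (X v, Y v).

Hypothesis mz : measurable_fun setT z.
Hypothesis iid : forall B : 'I_N -> set (T * R), (forall i, measurable (B i)) ->
  (Q [set w | forall i, B i (tnth (z w) i)] =
   \prod_(i < N) P0 [set w | B i (z0 w)])%E.
Context (B : {set 'I_N}).
Hypothesis B0 : (0 < #|B|)%N.

Let mz0 : measurable_fun setT z0. Proof. exact: measurable_fun_pair. Qed.

Let f i j (y : T * R) : R := phi i y.1 * phi j y.1 - (i == j)%:R.

Let mf i j : measurable_fun setT (f i j).
Proof.
apply: measurable_funB => //; apply: measurable_funM;
  exact: (measurableT_comp (measurable_phi mer _) measurable_fst).
Qed.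

Let integrable_phi2 i j : P0.-integrable setT (fun v => (phi i (X v) * phi j (X v))%:E).
Proof.
have mphi k := measurable_phi mer k.
have mp : measurable_fun setT (fun v => (phi i (X v) * phi j (X v))%:E).
  by apply/measurable_EFinP; apply: measurable_funM; apply: measurableT_comp.
have /integrableP[_ fi] := integrable_phiM mer i j.
apply/integrableP; split => //; move: fi; rewrite ge0_integral_distribution//.
by apply: measurableT_comp => //; apply/measurable_EFinP; exact: measurable_funM.
Qed.

Let f_int i j : P0.-integrable setT (EFin \o (f i j \o z0)).
Proof.
rewrite (_ : EFin \o _ =
  (fun v => (phi i (X v) * phi j (X v))%:E) \- cst ((i == j)%:R%:E))%E.
  by apply: integrableB => //; exact: finite_measure_integrable_cst.
by apply/funext => v; rewrite /= -EFinB.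
Qed.

Let f_mean0 i j : (\int[P0]_v (f i j (z0 v))%:E = 0)%E.
Proof.
under eq_integral do rewrite EFinB.
rewrite integralB//=; last exact: finite_measure_integrable_cst.
have mphi k := measurable_phi mer k.
have := @integral_distribution _ _ _ _ _ P0 X
  (fun x => (phi i x * phi j x)%:E) _ (integrable_phi2 i j).
rewrite (integral_phiM mer) => /(_ _)/esym ->; last first.
  by apply/measurable_EFinP; exact: measurable_funM.
by rewrite integral_cst//= probability_setT mule1 subee.
Qed.

Let n : R := #|B|%:R.
Let n0 : 0 < n. Proof. by rewrite ltr0n. Qed.

Let mom p L : 1 <= p ->
  (forall i j, (\int[Q]_w (((\sum_(s in B) f i j (tnth (z w) s)) ^+ 2) `^ p)%:E <= L%:E)%E) ->
  0 <= L ->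
  (Q [set w | ~ good mu phi lam B (design (z w))] <=
   ((4 * gam ^+ 2 / n ^+ 2) `^ p * L)%:E)%E.
Proof.
move=> p1 hL L0; have n2 : 0 <= (n ^+ 2)^-1 by rewrite invr_ge0 sqr_ge0.
have g2 : 0 <= 4 * gam ^+ 2 by rewrite mulr_ge0 ?sqr_ge0.
rewrite (powRM _ g2 n2) -mulrA.
apply: (not_good_prob mer lam0 gam0 shrink_gam (x := fun w => design (z w))) => //.
- by move=> s; exact: (measurableT_comp (measurable_design s) mz).
- by rewrite mulr_ge0 ?powR_ge0.
move=> i j; under eq_integral => w _.
  rewrite (_ : (cov_dev phi B (design (z w)) i j ^+ 2) `^ p =
    (n ^+ 2)^-1 `^ p * ((\sum_(s in B) f i j (tnth (z w) s)) ^+ 2) `^ p); last first.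
    by rewrite -powRM ?sqr_ge0// /cov_dev exprMn exprVn.
  rewrite EFinM; over.
rewrite ge0_integralZl_EFin ?powR_ge0//; last 2 first.
- by move=> w _; rewrite lee_fin powR_ge0.
- apply/measurable_EFinP; apply: (measurableT_comp (measurable_powR _)).
  apply: measurable_funX; under eq_fun do rewrite -big_enum.
  apply: measurable_sum => s.
  exact: (measurableT_comp (mf i j) (measurableT_comp (measurable_tnth s) mz)).
by rewrite EFinM; apply: lee_wpmul2l => //; rewrite lee_fin powR_ge0.
Qed.

(** The entries of the covariance deviation are centred means of [n] independent
    variables, so their moments of order [k] decay like [n `^ (- (k / 2))]. *)
Lemma bad_block_moment k rho : 2 <= k -> 0 < rho ->
  (forall j, \int[P0]_w (`|phi j (X w)| `^ (2 * k))%:E <= (rho `^ (2 * k))%:E)%E ->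
  (Q [set w | ~ good mu phi lam B (design (z w))] <=
   (moment_cst (k / 2) * (2 `^ k * (2 * rho `^ (2 * k) + 1)) *
    (4 * gam ^+ 2 / n) `^ (k / 2))%:E)%E.
Proof.
move=> k2 rho0 hm; set tau := 2 `^ k * _.
have p1 : 1 <= k / 2 by lra.
have tau0 : 0 <= tau by rewrite mulr_ge0 ?powR_ge0 ?addr_ge0 ?mulr_ge0 ?powR_ge0.
have M0 := moment_cst_ge0 p1.
have mphi j : measurable_fun setT (fun v => phi j (X v)).
  exact: (measurableT_comp (measurable_phi mer j)).
have mphik j : measurable_fun setT (fun v => (`|phi j (X v)| `^ (2 * k))%:E).
  apply/measurable_EFinP; apply: (measurableT_comp (measurable_powR _)).
  exact: measurableT_comp.
have tauE i j : (\int[P0]_v ((f i j (z0 v) ^+ 2) `^ (k / 2))%:E <= tau%:E)%E.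
  apply: (@le_trans _ _ (\int[P0]_v ((2 `^ k)%:E *
     ((`|phi i (X v)| `^ (2 * k))%:E + (`|phi j (X v)| `^ (2 * k))%:E + 1%:E)))%E).
    apply: ge0_le_integral => //.
    - by move=> v _; rewrite lee_fin powR_ge0.
    - apply/measurable_EFinP; apply: (measurableT_comp (measurable_powR _)).
      by apply: measurable_funX; exact: (measurableT_comp (mf i j) mz0).
    - apply: emeasurable_funM => //; apply: emeasurable_funD => //.
      exact: emeasurable_funD.
    - move=> v _; rewrite -!EFinD -EFinM lee_fin.
      apply: centred_product_powR_le; first by lra.
      by case: (i == j); rewrite /= ?ler01 ?lexx.
  rewrite ge0_integralZl_EFin ?powR_ge0//; last 2 first.
  - by move=> v _; rewrite -!EFinD lee_fin !addr_ge0 ?powR_ge0.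
  - by apply: emeasurable_funD => //; exact: emeasurable_funD.
  rewrite /tau EFinM; apply: lee_wpmul2l; first by rewrite lee_fin powR_ge0.
  rewrite ge0_integralD//; last 2 first.
  - by move=> v _; rewrite -!EFinD lee_fin !addr_ge0 ?powR_ge0.
  - exact: emeasurable_funD.
  rewrite ge0_integralD//.
  rewrite integral_cst//= probability_setT mule1.
  rewrite (_ : 2 * rho `^ (2 * k) + 1 = rho `^ (2 * k) + rho `^ (2 * k) + 1); last by ring.
  by rewrite !EFinD; apply: leeD => //; apply: leeD.
have := mom p1 (fun i j => sum_moment_power mz0 mz iid (mf i j) (f_int i j)
  (f_mean0 i j) B0 p1 tau0 (tauE i j)).
have L0 : 0 <= moment_cst (k / 2) * #|B|%:R `^ (k / 2) * tau.
  by apply: mulr_ge0 => //; apply: mulr_ge0.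
move=> /(_ L0)/le_trans; apply.
have g2 : 0 <= 4 * gam ^+ 2 / n ^+ 2.
  by apply: divr_ge0; rewrite ?sqr_ge0//; apply: mulr_ge0; rewrite ?sqr_ge0.
rewrite lee_fin le_eqVlt; apply/orP; left; apply/eqP.
rewrite -/n (_ : 4 * gam ^+ 2 / n = 4 * gam ^+ 2 / n ^+ 2 * n); last first.
  by field; rewrite (lt0r_neq0 n0).
by rewrite (powRM _ g2 (ltW n0)); ring.
Qed.

(** Here [p] is free: it will be taken to be the logarithm of the sample size, so
    that the bound decays like a power of the sample size. *)
Lemma bad_block_bounded p rho : 1 <= p -> 1 <= rho ->
  (forall j x, `|phi j x| <= rho) ->
  (Q [set w | ~ good mu phi lam B (design (z w))] <=
   (2 * (128 * expR 1 * p * gam ^+ 2 * rho ^+ 4 / n) `^ p)%:E)%E.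
Proof.
move=> p1 rho1 hb; have p0 : 0 < p by lra.
have rho0 : 0 < rho by lra.
have fb i j y : `|f i j y| <= 2 * rho ^+ 2.
  apply: le_trans (ler_normB _ _) _; rewrite normrM [X in _ + X]ger0_norm//.
  have -> : 2 * rho ^+ 2 = rho * rho + rho * rho by ring.
  apply: lerD; first by apply: ler_pM.
  have : 1 <= rho * rho by rewrite -[leLHS](mulr1 1); exact: ler_pM.
  by case: (i == j) => /= h; lra.
have b0 : 0 < 2 * rho ^+ 2 by rewrite mulr_gt0// exprn_gt0.
have := mom p1 (fun i j => sum_moment_bounded mz0 mz iid (mf i j) (f_int i j)
  (f_mean0 i j) B0 p1 b0 (fb i j)).
have L0 : 0 <= 2 * (8 * expR 1 * p * (2 * rho ^+ 2) ^+ 2 * #|B|%:R) `^ p.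
  by rewrite mulr_ge0// powR_ge0.
move=> /(_ L0)/le_trans; apply.
have g2 : 0 <= 4 * gam ^+ 2 / n ^+ 2.
  by apply: divr_ge0; rewrite ?sqr_ge0//; apply: mulr_ge0; rewrite ?sqr_ge0.
have e0 : 0 <= 8 * expR 1 * p * (2 * rho ^+ 2) ^+ 2 * n.
  have e1 := expR_ge0 (1 : R); apply: mulr_ge0 (ltW n0).
  by apply: mulr_ge0 (sqr_ge0 _); apply: mulr_ge0 (ltW p0); apply: mulr_ge0.
rewrite lee_fin -/n mulrCA -(powRM _ g2 e0).
rewrite le_eqVlt; apply/orP; left; apply/eqP; congr (_ * _ `^ _).
by field; rewrite (lt0r_neq0 n0).
Qed.

End bad_block.

(** * Risk of the averaged estimate over the random split *)

Section averaged_risk.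
Context (d0 d d1 : measure_display) (Om0 : measurableType d0) (T : measurableType d)
  (R : realType) (P0 : probability Om0 R) (X : {RV P0 >-> T}) (Y : {RV P0 >-> R})
  (K : T -> T -> R) (H : set (T -> R)) (ip : (T -> R) -> (T -> R) -> R)
  (mu : nat -> R) (phi : nat -> T -> R) (fstar : T -> R) (sigma tr lam gam : R).

Let P := distribution P0 X.

Hypothesis psd : psd_kernel K.
Hypothesis rk : is_rkhs K H ip.
Hypothesis HL2 : forall f, H f -> f \in Lfun P 2%:E.
Hypothesis mer : mercer_expansion P K mu phi.
Hypothesis mu_tr : forall J, \sum_(j < J) mu j <= tr.
Hypothesis lam0 : 0 < lam.
Hypothesis shrink_gam : forall J, \sum_(j < J) shrink mu lam j <= gam.
Hypothesis Hfstar : H fstar.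
Hypothesis fstar_cond : is_cond_expectation X Y fstar.
Hypothesis noise_cond : exists2 v : T -> R,
  is_cond_expectation X (fun w => (Y w - fstar (X w)) ^+ 2) v &
  forall x, v x <= sigma ^+ 2.

Context (Om : measurableType d1) (Q : probability Om R) (N m : nat)
  (xs : 'I_N -> {RV Q >-> T}) (ys : 'I_N -> {RV Q >-> R})
  (S : Om -> {ffun 'I_N -> 'I_m}) (fhat : Om -> 'I_m -> T -> R).
Hypothesis N0 : (0 < N)%N.
Hypothesis m0 : (0 < m)%N.
Hypothesis mN : (m %| N)%N.
Hypothesis iid : iid_sample X Y xs ys.
Hypothesis S_split : uniform_even_split xs ys S.
Hypothesis fhat_krr : forall w i, is_krr_estimate H ip lam (block (S w) i)
  (fun s => xs s w) (fun s => ys s w) (fhat w i).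

Lemma iid_tuple (B : 'I_N -> set (T * R)) : (forall i, measurable (B i)) ->
  (Q [set w | forall i, B i (tnth (sample xs ys w) i)] =
   \prod_(i < N) P0 [set w | B i (X w, Y w)])%E.
Proof.
move=> mB; rewrite -iid//; congr (Q _); apply/seteqP.
by split => w /= h i; have := h i; rewrite tnth_mktuple.
Qed.

Lemma design_sample w : design (sample xs ys w) = fun s => xs s w.
Proof. by apply/funext => s; rewrite /design tnth_mktuple. Qed.

Lemma response_sample w : response (sample xs ys w) = fun s => ys s w.
Proof. by apply/funext => s; rewrite /response tnth_mktuple. Qed.

Let n := (N %/ m)%N.

Let n0 : (0 < n)%N. Proof. by rewrite divn_gt0// dvdn_leq. Qed.

Let E_block a : a \in even_splits N m -> forall i, #|block a i| = n.
Proof. by rewrite inE => /forallP h i; exact/eqP. Qed.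

(** The ridge estimates of all blocks are functions of the sample and of the
    split; the risk for each fixed split was bounded independently of the split. *)
Lemma averaged_risk delta : 0 <= delta ->
  (forall B : {set 'I_N}, #|B| = n ->
    Q [set w | ~ good mu phi lam B (design (sample xs ys w))] <= delta%:E)%E ->
  (\int[Q]_w (L2norm P (averaged_estimate (fhat w) \- fstar)%R ^+ 2) <=
   (4 * (lam * ip fstar fstar) + 2 * (tr * ip fstar fstar) * delta +
    2 * sigma ^+ 2 * (4 * gam / N%:R + tr * delta / (m%:R * lam)))%:E)%E.
Proof.
move=> delta0 bad_delta; have F0 := ip_ge0 rk Hfstar.
have tr0 := tr_ge0 mu_tr; have g0 := gam_ge0 shrink_gam.
pose Psi (a : {ffun 'I_N -> 'I_m}) (t : N.-tuple (T * R)) : \bar R :=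
  (\int[P]_y ((block_average K lam a t y - fstar y) ^+ 2)%:E)%E.
rewrite (eq_integral (fun w => Psi (S w) (sample xs ys w))); last first.
  move=> w _; rewrite L2norm_sqr /Psi; apply: eq_integral => y _.
  have SE : S w \in even_splits N m by case: S_split.
  congr (((_ - _) ^+ 2)%:E); rewrite /block_average; congr (averaged_estimate _ y).
  apply/funext => i; rewrite design_sample response_sample.
  by apply: (krr_ridge psd rk lam0 _ (fhat_krr w i)); rewrite E_block.
apply: (random_split_le S_split).
- have lF : 0 <= 4 * (lam * ip fstar fstar) by rewrite mulr_ge0// mulr_ge0// ltW.
  have tF : 0 <= 2 * (tr * ip fstar fstar) * delta by rewrite !mulr_ge0.
  have gN : 0 <= 4 * gam / N%:R by rewrite divr_ge0// mulr_ge0.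
  have td : 0 <= tr * delta / (m%:R * lam).
    by rewrite divr_ge0// mulr_ge0// ltW.
  by rewrite addr_ge0 ?addr_ge0// mulr_ge0 ?addr_ge0// mulr_ge0// sqr_ge0.
- move=> a aE; exact: (measurable_block_risk psd HL2 mer lam0 Hfstar n0 (E_block aE)).
- by move=> a t; apply: integral_ge0 => y _; rewrite lee_fin sqr_ge0.
move=> a aE.
apply: (block_risk psd rk HL2 mer mu_tr lam0 shrink_gam Hfstar fstar_cond noise_cond
  (measurable_sample xs ys) iid_tuple m0 n0 (E_block aE)) => i.
by apply: bad_delta; exact: E_block.
Qed.

End averaged_risk.

(** * Exponentially decaying eigenvalues *)

Lemma ln_nat_unbounded (R : realType) (b : R) :
  exists N0 : nat, forall N, (N0 <= N)%N -> b <= ln N%:R.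
Proof.
have [N0 hN0] : exists N0 : nat, expR b <= N0%:R.
  by exists (Num.bound (expR b)); apply/ltW; apply: archi_boundP; exact: expR_ge0.
exists N0 => N N0N; have h : expR b <= N%:R by apply: le_trans hN0 _; rewrite ler_nat.
by rewrite -(expRK b) ler_ln ?posrE ?expR_gt0// (lt_le_trans (expR_gt0 _) h).
Qed.

Lemma sum_geometric_le (R : realType) (r : R) J : 0 < r < 1 ->
  \sum_(j < J) r ^+ j.+1 <= (1 - r)^-1.
Proof.
move=> /andP[r0 r1]; have h : 0 < 1 - r by lra.
rewrite -[leRHS]mul1r ler_pdivlMr// mulrC.
suff : (1 - r) * \sum_(j < J) r ^+ j.+1 = r - r ^+ J.+1.
  by have := exprn_gt0 J.+1 r0 => ? ->; lra.
elim: J => [|J IH]; first by rewrite big_ord0 mulr0 expr1 subrr.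
by rewrite big_ord_recr/= mulrDr IH [r ^+ J.+2]exprS; ring.
Qed.

Lemma sum_le_indicator (R : realType) (q : R) J : 0 <= q ->
  \sum_(j < J) (j.+1%:R <= q)%R%:R <= q.
Proof.
move=> q0; elim: J => [|J IH]; first by rewrite big_ord0.
have [Jq|Jq] := boolP (J.+1%:R <= q :> R).
  apply: le_trans Jq; rewrite -[leRHS](_ : \sum_(j < J.+1) 1 = _); last first.
    by rewrite sumr_const card_ord.
  by apply: ler_sum => j _; case: (j.+1%:R <= q)%R.
by rewrite big_ord_recr/= (negbTE Jq) addr0.
Qed.

Section gaussian_decay.
Context d (T : measurableType d) (R : realType) (P : probability T R)
  (K : T -> T -> R) (mu : nat -> R) (phi : nat -> T -> R) (c1 c2 : R).
Hypothesis mer : mercer_expansion P K mu phi.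
Hypothesis c1_gt0 : 0 < c1.
Hypothesis c2_gt0 : 0 < c2.
Hypothesis mu_decay : forall j, mu j <= c1 * expR (- (c2 * j.+1%:R ^+ 2)).

Let r : R := expR (- (c2 / 2)).

Let r01 : 0 < r < 1.
Proof. by rewrite /r expR_gt0/= expR_lt1 oppr_lt0 divr_gt0. Qed.

(** A bound on the sum of [c1 * r ^+ j.+1], which majorises the sum of
    [c1 * expR (- (c2 / 2) * j.+1 ^+ 2)]: only half of the decay rate is kept, and
    the square in the exponent is dropped. *)
Definition tail_mass : R := c1 / (1 - r).

Let half_decay j : expR (- (c2 / 2 * j.+1%:R ^+ 2)) <= r ^+ j.+1.
Proof.
rewrite /r -expRM_natl ler_expR.
have j1 : 1 <= j.+1%:R :> R by rewrite ler1n.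
rewrite mulrN lerN2 mulrC; apply: ler_wpM2l; first by rewrite divr_ge0// ltW.
by rewrite expr2 ler_peMr// (le_trans ler01).
Qed.

Lemma tail_mass_gt0 : 0 < tail_mass.
Proof. by rewrite divr_gt0//; move/andP: r01 => [_ ?]; lra. Qed.

Let sum_tail J : \sum_(j < J) c1 * r ^+ j.+1 <= tail_mass.
Proof. by rewrite -mulr_sumr ler_pM2l//; exact: sum_geometric_le. Qed.

Lemma sum_mu_le J : \sum_(j < J) mu j <= tail_mass.
Proof.
apply: le_trans (sum_tail J); apply: ler_sum => j _.
apply: le_trans (mu_decay j) _; rewrite ler_pM2l//.
apply: le_trans (half_decay j); rewrite ler_expR lerN2.
apply: ler_wpM2r; first exact: sqr_ge0.
by have := c2_gt0; lra.
Qed.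

(** The effective dimension for [lam = N^-1] is of order [sqrt (ln N)]: a weight is
    at most [1] up to the index [q] where [expR (- c2 / 2 * q ^+ 2)] reaches
    [N^-1]; beyond it, half of the exponent absorbs the factor [N] and the rest sums
    to a constant. *)
Lemma sum_shrink_le : exists N0 : nat, forall N, (N0 <= N)%N -> forall J,
  \sum_(j < J) shrink mu N%:R^-1 j <= Num.sqrt (8 * ln N%:R / c2).
Proof.
have [N1 hN1] := ln_nat_unbounded (c2 * (1 + tail_mass ^+ 2)).
exists (maxn 1 N1) => N; rewrite geq_max => /andP[N0 /hN1 lnN] J.
have NR : 0 < N%:R :> R by rewrite ltr0n.
have L0 : 0 < ln N%:R :> R.
  by apply: lt_le_trans lnN; rewrite mulr_gt0// ltr_wpDr ?sqr_ge0.
pose q : R := Num.sqrt (2 * ln N%:R / c2).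
have q2 : q ^+ 2 = 2 * ln N%:R / c2.
  by rewrite sqr_sqrtr// divr_ge0 ?mulr_ge0// ltW.
have q0 : 0 <= q := sqrtr_ge0 _.
have -> : Num.sqrt (8 * ln N%:R / c2) = q + q.
  rewrite (_ : 8 * _ / _ = (q + q) ^+ 2); first by rewrite sqrtr_sqr ger0_norm ?addr_ge0.
  by rewrite -mulr2n exprMn_n q2; field; rewrite lt0r_neq0.
have tq : tail_mass <= q.
  rewrite -[leLHS]ger0_norm ?(ltW tail_mass_gt0)// -sqrtr_sqr ler_wsqrtr//.
  rewrite ler_pdivlMr//; move: lnN; have := sqr_ge0 tail_mass.
  by move: (tail_mass ^+ 2) => u; nra.
apply: (@le_trans _ _ (\sum_(j < J) ((j.+1%:R <= q)%R%:R + c1 * r ^+ j.+1))); last first.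
  by rewrite big_split/= lerD ?sum_le_indicator// (le_trans (sum_tail J)).
apply: ler_sum => j _; have mu0 := mercer_ge0 mer j.
have c1r : 0 <= c1 * r ^+ j.+1 by rewrite mulr_ge0 ?exprn_ge0 ?expR_ge0// ltW.
have wt1 : shrink mu N%:R^-1 j <= 1.
  by rewrite /shrink ler_pdivrMr ?mul1r ?lerDl ?invr_ge0// ltr_wpDl ?invr_gt0.
have [jq|jq] := leP j.+1%:R q; first by rewrite /=; lra.
rewrite add0r; apply: (@le_trans _ _ (mu j * N%:R)).
  rewrite /shrink; apply: ler_wpM2l => //; rewrite -[leRHS]invrK.
  by rewrite lef_pV2 ?posrE ?invr_gt0// ?lerDr// ltr_wpDl ?invr_gt0.
apply: le_trans (ler_wpM2r (ltW NR) (mu_decay j)) _.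
rewrite -mulrA ler_pM2l//; apply: le_trans (half_decay j).
rewrite -[X in _ * X]lnK ?posrE// -expRD ler_expR.
have : q ^+ 2 <= j.+1%:R ^+ 2 by rewrite ler_sqr ?nnegrE// ltW.
rewrite q2 ler_pdivrMr//; move: (j.+1%:R ^+ 2) => u; lra.
Qed.

End gaussian_decay.

(** * Block sizes allowed by the two assumptions *)

(** With [L = ln N], the bound on [m] forces the block size [n] to satisfy
    [n `^ (k / 2 - 1) >= const * N * L `^ (k - 2^-1)], and the power of [L] is more
    than enough for the [L `^ (k / 2)] coming from the effective dimension. *)
Lemma polynomial_rate (R : realType) (k a b c L N m n : R) :
  2 < k -> 0 <= a -> 0 < b -> 0 < c -> 1 <= L -> 0 < N -> 0 < n -> N = m * n ->
  m <= c * (N `^ ((k - 4) / (k - 2)) / (b * L `^ ((2 * k - 1) / (k - 2)))) ->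
  n * (a * L / n) `^ (k / 2) <= a `^ (k / 2) * (c / b) `^ (k / 2 - 1) / N.
Proof.
move=> k2 a0 b0 c0 L1 N0 n0 N_mn m_le.
pose h := k / 2 - 1; have h0 : 0 < h by rewrite /h; lra.
have L0 : 0 < L by lra.
have kh : k - 2 = 2 * h by rewrite /h; field.
have h_neq0 := lt0r_neq0 h0.
rewrite (_ : (k - 4) / (k - 2) = 1 - h^-1) in m_le; last first.
  by rewrite kh (_ : k - 4 = 2 * h - 2); [field|rewrite /h; field].
rewrite (_ : (2 * k - 1) / (k - 2) = (k - 2^-1) / h) in m_le; last first.
  by rewrite kh; field.
pose l := L `^ ((k - 2^-1) / h); have l0 : 0 < l by exact: powR_gt0.
pose Nh := N `^ h^-1; have Nh0 : 0 < Nh by exact: powR_gt0.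
have NhE : N `^ (1 - h^-1) = N / Nh.
  by rewrite powRB ?(gt_eqF N0) ?implybT// powRr1 ?ltW.
have n_ge : b / c * Nh * l <= n.
  have mn : N <= c * (N / Nh / (b * l)) * n.
    by rewrite {1}N_mn -NhE ler_pM2r.
  have : 1 <= c / (Nh * b * l) * n.
    rewrite -(ler_pM2l N0) mulr1; apply: le_trans mn _.
    rewrite le_eqVlt; apply/orP; left; apply/eqP; field.
    by rewrite !lt0r_neq0.
  rewrite mulrAC ler_pdivlMr ?mulr_gt0// mul1r => h1.
  rewrite -(ler_pM2l c0) (_ : c * _ = Nh * b * l)//; field; exact: lt0r_neq0.
have nh : (b / c) `^ h * N * L `^ (k - 2^-1) <= n `^ h.
  have bc0 : 0 <= b / c by rewrite divr_ge0// ltW.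
  have NE : N = Nh `^ h by rewrite /Nh -powRrM mulVf// powRr1// ltW.
  have lE : L `^ (k - 2^-1) = l `^ h by rewrite /l -powRrM divfK.
  have bcN := mulr_ge0 bc0 (ltW Nh0).
  rewrite {1}NE lE -(powRM h bc0 (ltW Nh0)) -(powRM h bcN (ltW l0)).
  apply: ge0_ler_powR; rewrite ?nnegrE ?(ltW h0) ?(ltW n0)//.
  exact: mulr_ge0 bcN (ltW l0).
have LL : L `^ (k / 2) <= L `^ (k - 2^-1) by apply: ler_powR => //; lra.
have bcE : (b / c) `^ h * (c / b) `^ h = 1.
  rewrite -powRM ?divr_ge0 ?(ltW b0) ?(ltW c0)// (_ : b / c * (c / b) = 1) ?powR1//.
  by field; rewrite !lt0r_neq0.
have q0 : 0 < n `^ h by exact: powR_gt0.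
have -> : n * (a * L / n) `^ (k / 2) = a `^ (k / 2) * (L `^ (k / 2) / n `^ h).
  have nE : n^-1 `^ (k / 2) = (n `^ h)^-1 / n.
    rewrite -{1}(powR_inv1 (ltW n0)) -powRrM mulN1r powRN (_ : k / 2 = h + 1);
      last by rewrite /h; ring.
    by rewrite powRD ?(gt_eqF n0) ?implybT// (powRr1 (ltW n0)) invfM.
  rewrite powRM ?mulr_ge0 ?invr_ge0 ?(ltW L0) ?(ltW n0)// powRM ?(ltW L0)// nE.
  by field; rewrite !lt0r_neq0.
rewrite -mulrA; apply: ler_wpM2l; first exact: powR_ge0.
rewrite -/h ler_pdivlMr// mulrAC ler_pdivrMr//.
have : (b / c) `^ h * (N * L `^ (k / 2)) <= n `^ h.
  apply: le_trans nh; rewrite -mulrA; apply: ler_wpM2l; first exact: powR_ge0.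
  by apply: ler_wpM2l; first exact: ltW.
move=> /(ler_wpM2l (powR_ge0 (c / b) h)).
by rewrite (mulrA ((c / b) `^ h)) (mulrC ((c / b) `^ h) ((b / c) `^ h)) bcE mul1r mulrC.
Qed.

Lemma split_cst_gt0 (R : realType) (c2 : R) : 0 < c2 -> 0 < c2 / (1024 * expR 1 ^+ 3).
Proof.
move=> c2_gt0; apply: divr_gt0 c2_gt0 _; apply: mulr_gt0; first by rewrite ltr0n.
exact: exprn_gt0 (expR_gt0 _).
Qed.

Section failure_probability.
Context (d0 d : measure_display) (Om0 : measurableType d0) (T : measurableType d)
  (R : realType) (P0 : probability Om0 R) (X : {RV P0 >-> T}) (Y : {RV P0 >-> R})
  (K : T -> T -> R) (mu : nat -> R) (phi : nat -> T -> R) (c2 : R).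
Hypothesis mer : mercer_expansion (distribution P0 X) K mu phi.
Hypothesis c2_gt0 : 0 < c2.

(** The bound has to hold for every probability space carrying the sample, since
    the constants of the theorem are chosen before that space. *)
Definition failure_le (N n : nat) (delta : R) : Prop :=
  forall (d' : measure_display) (Om : measurableType d') (Q : probability Om R)
    (xs : 'I_N -> {RV Q >-> T}) (ys : 'I_N -> {RV Q >-> R}) (B : {set 'I_N}),
  iid_sample X Y xs ys -> #|B| = n ->
  (Q [set w | ~ good mu phi N%:R^-1 B (design (sample xs ys w))] <= delta%:E)%E.

Let gam (N : nat) : R := Num.sqrt (8 * ln N%:R / c2).

Let gam_sqr N : 0 < ln N%:R :> R -> gam N ^+ 2 = 8 * ln N%:R / c2.
Proof. by move=> L0; rewrite sqr_sqrtr// divr_ge0 ?mulr_ge0// ltW. Qed.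

Let gam_gt0 N : 0 < ln N%:R :> R -> 0 < gam N.
Proof. by move=> L0; rewrite sqrtr_gt0 divr_gt0// mulr_gt0. Qed.

(** Moments of order [p = ln N]: the constant in the bound on [m] is chosen so that
    the base of the power in [bad_block_bounded] is at most [expR (- 2)]. *)
Lemma failure_bounded rho N n m : 0 < rho -> (forall j x, `|phi j x| <= rho) ->
  (forall J, \sum_(j < J) shrink mu N%:R^-1 j <= gam N) ->
  1 <= ln N%:R :> R -> (0 < m)%N -> N = (m * n)%N ->
  m%:R <= c2 / (1024 * expR 1 ^+ 3) * (N%:R / (rho ^+ 4 * ln N%:R ^+ 2)) ->
  failure_le N n (2 / N%:R ^+ 2).
Proof.
move=> rho0 hb shrink_gam L1 m0 N_mn m_le d' Om Q xs ys B iid Bn.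
have L0 : 0 < ln N%:R :> R by lra.
have N0 : (0 < N)%N by rewrite lt0n; apply: contraTneq L0 => ->; rewrite ln0// ltxx.
have n0 : (0 < n)%N by move: N0; rewrite N_mn muln_gt0 => /andP[].
have NR : 0 < N%:R :> R by rewrite ltr0n.
have nR : 0 < n%:R :> R by rewrite ltr0n.
have mR : 0 < m%:R :> R by rewrite ltr0n.
(* The functions [phi j] have norm 1 in [L^2]. *)
have rho1 : 1 <= rho.
  have : (1%:E <= (rho ^+ 2)%:E :> \bar R)%E.
    have := integral_phiM mer 0 0; rewrite eqxx => <-.
    rewrite -[leRHS]mule1 -(probability_setT (distribution P0 X)) -integral_cst//.
    apply: ge0_le_integral => //.
    - by move=> x _; rewrite lee_fin -expr2 sqr_ge0.
    - apply/measurable_EFinP; apply: measurable_funM; exact: measurable_phi mer 0.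
    - by move=> x _; rewrite lee_fin -expr2 -real_normK ?num_real// ler_sqr ?nnegrE// ltW.
  by rewrite lee_fin -{1}(expr1n _ 2) ler_sqr ?nnegrE// ltW.
have B0 : (0 < #|B|)%N by rewrite Bn.
have e0 := expR_gt0 (1 : R).
apply: le_trans (bad_block_bounded mer _ (gam_gt0 L0) shrink_gam (measurable_sample xs ys)
  (iid_tuple iid) B0 L1 rho1 hb) _; first by rewrite invr_gt0.
rewrite lee_fin Bn (gam_sqr L0); apply: ler_wpM2l => //.
have -> : (N%:R ^+ 2)^-1 = expR (- 2) `^ ln N%:R :> R.
  rewrite -expRM -(lnK (_ : N%:R \is Num.pos)) ?posrE// -expRM_natr expRK.
  by rewrite -expRN; congr expR; ring.
(* [1024 = 128 * 8], where [8] comes from [gam_sqr]. *)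
pose kap := c2 / (1024 * expR 1 ^+ 3); pose r := rho ^+ 4 * ln N%:R ^+ 2.
rewrite -/kap -/r in m_le.
have k0 : 0 < kap := split_cst_gt0 c2_gt0.
have r0 : 0 < r by rewrite mulr_gt0 ?exprn_gt0.
have r_le : r <= kap * n%:R.
  move: m_le; rewrite N_mn natrM -(mulrA m%:R) mulrCA -[leLHS]mulr1 ler_pM2l//.
  by rewrite mulrA ler_pdivlMr// mul1r.
have -> : 128 * expR 1 * ln N%:R * (8 * ln N%:R / c2) * rho ^+ 4 / n%:R =
    r / (kap * n%:R) * expR (-2).
  have -> : expR (- 2) = (expR 1 ^+ 2)^-1 :> R by rewrite expRN -expRM_natl mulr1.
  rewrite /r /kap; field.
  by rewrite (lt0r_neq0 e0) (lt0r_neq0 nR) (lt0r_neq0 c2_gt0).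
apply: ge0_ler_powR; rewrite ?nnegrE ?expR_ge0 ?(ltW L0)//.
  by rewrite mulr_ge0 ?expR_ge0// divr_ge0 ?(ltW r0)// mulr_ge0 ?(ltW k0).
by rewrite ler_piMl ?expR_ge0// ler_pdivrMr ?mul1r// mulr_gt0.
Qed.

Lemma failure_moment k rho N n : 2 < k -> 0 < rho ->
  (forall j, \int[P0]_w (`|phi j (X w)| `^ (2 * k))%:E <= (rho `^ (2 * k))%:E)%E ->
  (forall J, \sum_(j < J) shrink mu N%:R^-1 j <= gam N) ->
  0 < ln N%:R :> R -> (0 < n)%N ->
  failure_le N n (moment_cst (k / 2) * (2 `^ k * (2 * rho `^ (2 * k) + 1)) *
    (32 / c2 * ln N%:R / n%:R) `^ (k / 2)).
Proof.
move=> k2 rho0 hm shrink_gam L0 n0 d' Om Q xs ys B iid Bn.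
have N0 : (0 < N)%N by rewrite lt0n; apply: contraTneq L0 => ->; rewrite ln0// ltxx.
have lam0 : 0 < N%:R^-1 :> R by rewrite invr_gt0 ltr0n.
have B0 : (0 < #|B|)%N by rewrite Bn.
apply: le_trans (bad_block_moment mer lam0 (gam_gt0 L0) shrink_gam (measurable_sample xs ys)
  (iid_tuple iid) B0 (ltW k2) rho0 hm) _.
rewrite lee_fin Bn (gam_sqr L0) le_eqVlt; apply/orP; left; apply/eqP.
by congr (_ * powR _ _); field; rewrite (lt0r_neq0 c2_gt0) andbT pnatr_eq0 -lt0n.
Qed.

End failure_probability.

(** * The rate *)

Section rate.
Context (d0 d : measure_display) (Om0 : measurableType d0) (T : measurableType d)
  (R : realType) (P0 : probability Om0 R) (X : {RV P0 >-> T}) (Y : {RV P0 >-> R})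
  (K : T -> T -> R) (mu : nat -> R) (phi : nat -> T -> R) (c2 : R) (mmax : nat -> R).
Hypothesis mer : mercer_expansion (distribution P0 X) K mu phi.
Hypothesis c2_gt0 : 0 < c2.
Hypothesis shrink_le : exists N0 : nat, forall N, (N0 <= N)%N -> forall J,
  \sum_(j < J) shrink mu N%:R^-1 j <= Num.sqrt (8 * ln N%:R / c2).

Let c : R := c2 / (1024 * expR 1 ^+ 3).

Let c_gt0 : 0 < c := split_cst_gt0 c2_gt0.

(** In both cases the failure probability is so small that it stays of order
    [N^-1] after multiplication by the block size. *)
Lemma failure_rate :
  (exists k rho : R,
     [/\ 2 < k, 0 < rho,
         forall j, ('E_P0[(fun w => `|phi j (X w)| `^ (2 * k))%R] <= (rho `^ (2 * k))%:E)%E &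
         forall N, mmax N = c * (N%:R `^ ((k - 4) / (k - 2)) /
           (rho `^ (4 * k / (k - 2)) * ln N%:R `^ ((2 * k - 1) / (k - 2))))]) \/
  (exists rho : R,
     [/\ 0 < rho, forall j x, `|phi j x| <= rho &
         forall N, mmax N = c * (N%:R / (rho ^+ 4 * ln N%:R ^+ 2))]) ->
  exists2 D : R, 0 <= D & exists N1 : nat, forall N m, (N1 <= N)%N -> (0 < m)%N ->
    (m %| N)%N -> m%:R <= mmax N ->
    exists delta : R, [/\ 0 <= delta, (N %/ m)%:R * delta <= D / N%:R &
      failure_le X Y mu phi N (N %/ m) delta].
Proof.
have [N2 hN2] := shrink_le; have [N3 hN3] := ln_nat_unbounded (1 : R).
have large N m : (maxn 1 (maxn N2 N3) <= N)%N -> (0 < m)%N -> (m %| N)%N ->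
    [/\ 0 < N%:R :> R, 1 <= ln N%:R :> R, (0 < N %/ m)%N, N = (m * (N %/ m))%N &
        forall J, \sum_(j < J) shrink mu N%:R^-1 j <= Num.sqrt (8 * ln N%:R / c2)].
  rewrite !geq_max => /and3P[N0 /hN2 w /hN3 l] m0 mN; split => //.
  - by rewrite ltr0n.
  - by rewrite divn_gt0// dvdn_leq.
  - by rewrite mulnC divnK.
case=> [[k [rho [k2 rho0 hm mmaxE]]]|[rho [rho0 hb mmaxE]]].
- set t := moment_cst (k / 2) * (2 `^ k * (2 * rho `^ (2 * k) + 1)).
  have t0 : 0 <= t.
    apply: mulr_ge0; first by apply: moment_cst_ge0; lra.
    by rewrite mulr_ge0 ?powR_ge0// addr_ge0// mulr_ge0// powR_ge0.
  set b := rho `^ (4 * k / (k - 2)) in mmaxE; have b0 : 0 < b by exact: powR_gt0.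
  have a0 : 0 <= 32 / c2 by rewrite divr_ge0// ltW.
  exists (t * ((32 / c2) `^ (k / 2) * (c / b) `^ (k / 2 - 1))).
    by rewrite mulr_ge0// mulr_ge0// powR_ge0.
  exists (maxn 1 (maxn N2 N3)) => N m /large h m0 mN m_le.
  have [N0 L1 n0 N_mn w] := h _ m0 mN.
  exists (t * (32 / c2 * ln N%:R / (N %/ m)%:R) `^ (k / 2)); split.
  + by rewrite mulr_ge0// powR_ge0.
  + rewrite mulrCA -[leRHS]mulrA; apply: ler_wpM2l => //.
    apply: (@polynomial_rate _ _ _ b _ _ _ m%:R) => //; rewrite ?ltr0n//.
      by rewrite {1}N_mn natrM.
    by rewrite -mmaxE.
  + have hm' j : (\int[P0]_w (`|phi j (X w)| `^ (2 * k))%:E <= (rho `^ (2 * k))%:E)%E.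
      by have := hm j; rewrite unlock.
    exact: (@failure_moment _ _ _ _ _ _ X Y _ _ _ _ mer c2_gt0 k rho N _
      k2 rho0 hm' w (lt_le_trans ltr01 L1) n0).
- exists 2 => //; exists (maxn 1 (maxn N2 N3)) => N m /large h m0 mN m_le.
  have [N0 L1 n0 N_mn w] := h _ m0 mN.
  exists (2 / N%:R ^+ 2); split.
  + by rewrite divr_ge0// sqr_ge0.
  + rewrite mulrCA ler_wpM2l// ler_pdivrMr ?exprn_gt0// expr2 mulrA mulVf ?lt0r_neq0//.
    by rewrite mul1r ler_nat leq_div.
  + apply: (failure_bounded mer c2_gt0 rho0 hb w L1 m0 N_mn).
    by rewrite -mmaxE.
Qed.

End rate.

Unset Implicit Arguments.
Unset Strict Implicit.
Theorem corollary3 (R : realType) (c2 : R) (hc2 : 0 < c2) :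
  exists2 c : R, 0 < c &
  forall (c1 : R) (d0 d : measure_display)
    (Om0 : measurableType d0) (T : measurableType d) (P0 : probability Om0 R)
    (X : {RV P0 >-> T}) (Y : {RV P0 >-> R})
    (K : T -> T -> R) (H : set (T -> R)) (ip : (T -> R) -> (T -> R) -> R)
    (mu : nat -> R) (phi : nat -> T -> R) (fstar : T -> R) (sigma : R)
    (mmax : nat -> R),
  0 < c1 ->
  psd_kernel K ->
  is_rkhs K H ip ->
  (forall f, H f -> f \in Lfun (distribution P0 X) 2%:E) ->
  mercer_expansion (distribution P0 X) K mu phi ->
  (forall j : nat, mu j <= c1 * expR (- (c2 * j.+1%:R ^+ 2))) ->
  H fstar ->
  is_cond_expectation X Y fstar ->
  0 < sigma ->
  (exists2 v : T -> R,
     is_cond_expectation X (fun w => (Y w - fstar (X w)) ^+ 2) v &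
     forall x, v x <= sigma ^+ 2) ->
  (exists k rho : R,
     [/\ 2 < k, 0 < rho,
         forall j : nat, ('E_P0[(fun w => `|phi j (X w)| `^ (2 * k))%R]
                            <= (rho `^ (2 * k))%:E)%E &
         forall N : nat, mmax N =
           c * (N%:R `^ ((k - 4) / (k - 2)) /
                (rho `^ (4 * k / (k - 2)) *
                 ln N%:R `^ ((2 * k - 1) / (k - 2))))]) \/
  (exists rho : R,
     [/\ 0 < rho,
         forall (j : nat) (x : T), `|phi j x| <= rho &
         forall N : nat, mmax N = c * (N%:R / (rho ^+ 4 * ln N%:R ^+ 2))]) ->
  exists (C : R) (N0 : nat),
  forall (N m : nat), (N0 <= N)%N -> (0 < m)%N -> (m %| N)%N ->
    m%:R <= mmax N ->
  forall (d' : measure_display) (Om : measurableType d') (Q : probability Om R)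
    (xs : 'I_N -> {RV Q >-> T}) (ys : 'I_N -> {RV Q >-> R})
    (S : Om -> {ffun 'I_N -> 'I_m}) (fhat : Om -> 'I_m -> T -> R),
  iid_sample X Y xs ys ->
  uniform_even_split xs ys S ->
  (forall w i, is_krr_estimate H ip N%:R^-1 (block (S w) i)
                 (fun s => xs s w) (fun s => ys s w) (fhat w i)) ->
  (\int[Q]_w (L2norm (distribution P0 X)
                (averaged_estimate (fhat w) \- fstar)%R ^+ 2)
     <= (C * (sigma ^+ 2 * (Num.sqrt (ln N%:R) / N%:R)))%:E)%E.
Proof.
exists (c2 / (1024 * expR 1 ^+ 3)); first exact: split_cst_gt0.
move=> c1 d0 d Om0 T P0 X Y K H ip mu phi fstar sigma mmax c10 psd rk HL2 mer mu_decay
  Hf fcond sigma0 ncond cases.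
have shrink_le := sum_shrink_le mer c10 hc2 mu_decay.
have [D D0 [N1 hN1]] := failure_rate Y mer hc2 shrink_le cases.
have [N2 hN2] := shrink_le; have [N3 hN3] := ln_nat_unbounded (1 : R).
have mu_tr := sum_mu_le c10 hc2 mu_decay.
have tr0 := tail_mass_gt0 c10 hc2.
set tr := tail_mass c1 c2 in mu_tr tr0.
set F := ip fstar fstar; have F0 : 0 <= F := ip_ge0 rk Hf.
set A := Num.sqrt (8 / c2); have A0 : 0 <= A := sqrtr_ge0 _.
set C := 4 * F + 2 * (tr * F) * D + 2 * sigma ^+ 2 * (4 * A + tr * D).
exists (C / sigma ^+ 2), (maxn 1 (maxn N1 (maxn N2 N3))) => N m.
rewrite !geq_max => /and4P[N_gt0 /hN1 h1 /hN2 wtN /hN3 L1] m0 mN m_le.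
move=> d' Om Q xs ys S fhat iid split krr.
have [delta [delta0 n_delta fail]] := h1 _ m0 mN m_le.
have NR : 0 < N%:R :> R by rewrite ltr0n.
have lam0 : 0 < N%:R^-1 :> R by rewrite invr_gt0.
have risk := averaged_risk psd rk HL2 mer mu_tr lam0 wtN Hf fcond ncond N_gt0 m0 mN
  iid split krr delta0 (fun B => fail _ _ Q xs ys B iid).
apply: le_trans risk _; rewrite lee_fin.
have sL : 1 <= Num.sqrt (ln N%:R) :> R by rewrite -[leLHS](@sqrtr1 R) ler_wsqrtr.
have -> : Num.sqrt (8 * ln N%:R / c2) = A * Num.sqrt (ln N%:R).
  by rewrite mulrAC sqrtrM// divr_ge0// ltW.
rewrite -/F; move: (Num.sqrt (ln N%:R)) sL => s s1.
have n_ge1 : 1 <= (N %/ m)%:R :> R by rewrite ler1n divn_gt0// dvdn_leq.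
have mE : (m%:R * N%:R^-1)^-1 = (N %/ m)%:R :> R.
  rewrite -{1}(divnK mN) natrM; field.
  by rewrite !pnatr_eq0 -!lt0n m0 divn_gt0// dvdn_leq.
have delta_le : delta <= D / N%:R.
  by apply: le_trans n_delta; rewrite ler_peMl.
have Ds : D / N%:R <= D / N%:R * s by rewrite ler_peMr// divr_ge0// ltW.
have -> : C / sigma ^+ 2 * (sigma ^+ 2 * (s / N%:R)) =
    4 / N%:R * F * s + 2 * (tr * F) * (D / N%:R * s) +
    2 * sigma ^+ 2 * (4 * (A * s) / N%:R + tr * (D / N%:R * s)).
  by rewrite /C; field; rewrite (lt0r_neq0 NR) (lt0r_neq0 sigma0).
rewrite mulrA mulrA -(mulrA tr) mE.
apply: lerD; first apply: lerD.
- by rewrite ler_peMr// mulr_ge0// divr_ge0// ltW.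
- apply: ler_wpM2l; first by rewrite mulr_ge0// mulr_ge0// ltW.
  exact: le_trans delta_le Ds.
- apply: ler_wpM2l; first by rewrite mulr_ge0// sqr_ge0.
  rewrite lerD2l; apply: ler_wpM2l (ltW tr0) _ _ _.
  by rewrite mulrC; exact: le_trans n_delta Ds.
Qed.
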